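(* Let $\delta\in(0,1)$, let $\nu$ be a probability distribution on $\mathbb Z$, and let $(A_n)_n$ be an increasing sequence of positive real numbers. Consider either of the following two Markov chains $(M_n)_{n\ge0}$ on $\mathbb Z^2$ with $M_0=(0,0)$ almost surely. (a) $\nu$ has zero expectation, $(\nu^{*n}(A_n\,\cdot))_n$ converges to a $\beta$-stable distribution with $\beta\in(1,2]$, and $$P\big(M_{n+1}=(x\pm1,y)\mid M_n=(x,y)\big)=\tfrac{\delta}{2},\qquad P\big(M_{n+1}=(x,y+z)\mid M_n=(x,y)\big)=(1-\delta)\,\nu(z)\quad(z\in\mathbb Z).$$ (b) $\nu$ admits a first moment, $(\tilde\nu^{*n}(A_n\,\cdot))_n$ converges to a $\beta$-stable distribution with $\beta>1$, where $\tilde\nu:=\nu(-\,\cdot)*\nu$, and $$P\big(M_{n+1}=(x\pm1,y)\mid M_n=(x,y)\big)=\tfrac{\delta}{2},\qquad P\big(M_{n+1}=(x,y+z)\mid M_n=(x,y)\big)=(1-\delta)\,\nu((-1)^xz)\quad(z\in\mathbb Z).$$ In each of the cases (a) and (b), $(M_n)_n$ is recurrent if and only if $$\sum_n\frac{1}{A_n\sqrt n}=\infty .$$ In particular, $(M_n)_n$ is transient as soon as $\beta<2$.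
   Context: For a probability distribution $\mu$ on $\mathbb Z$, $\mu^{*n}(A_n\,\cdot)$ denotes the distribution of $(Z_1+\dots+Z_n)/A_n$, where $Z_1,\dots,Z_n$ are i.i.d. with distribution $\mu$; convergence is weak convergence. $\tilde\nu=\nu(-\,\cdot)*\nu$ is the distribution of $Z_2-Z_1$ when $Z_1,Z_2$ are independent with distribution $\nu$. A $\beta$-stable distribution is understood to be non-degenerate (so $\beta\in(1,2]$ in both cases). Recurrent means that almost surely the chain returns to its starting point $(0,0)$ infinitely often; transient means that almost surely it returns to $(0,0)$ only finitely often. *)

(* Defs.v *)
From HB Require Import structures.
From mathcomp Require Import all_boot all_order all_algebra.
From mathcomp Require Import all_classical all_reals all_analysis.

Set Implicit Arguments.
Unset Strict Implicit.
Unset Printing Implicit Defensive.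

Import Order.TTheory GRing.Theory Num.Theory.
Import numFieldNormedType.Exports.

Local Open Scope classical_set_scope.
Local Open Scope ring_scope.

(* MathComp-Analysis provides these instances for nat, but not for int. *)
HB.instance Definition _ := isPointed.Build int 0.
HB.instance Definition _ := @isMeasurable.Build default_measure_display
  int discrete_measurable discrete_measurable0
  discrete_measurableC discrete_measurableU.

Lemma measurable_fun_int d (T : measurableType d) (f : int -> T) :
  measurable_fun [set: int] f.
Proof. by []. Qed.

Lemma measurable_int_prod (B : set (int * int)) : measurable B.
Proof.
apply: countable_measurable; last exact: countableP.
move=> [x y]; have -> : [set (x, y)] = [set x] `*` [set y].
  by apply/seteqP; split => -[a b] /= [] -> ->.
exact: measurableX.
Qed.

Lemma measurable_fun_int_prod d (T : measurableType d) (f : int * int -> T) :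
  measurable_fun [set: int * int] f.
Proof. by move=> _ B _; exact: measurable_int_prod. Qed.

Definition int_add (p : int * int) : int := p.1 + p.2.
HB.instance Definition _ :=
  isMeasurableFun.Build _ _ _ _ int_add (measurable_fun_int_prod int_add).

Definition int_opp (z : int) : int := - z.
HB.instance Definition _ :=
  isMeasurableFun.Build _ _ _ _ int_opp (measurable_fun_int int_opp).

Definition int_div (R : realType) (a : R) (z : int) : R := z%:~R / a.
HB.instance Definition _ (R : realType) (a : R) :=
  isMeasurableFun.Build _ _ _ _ (int_div a) (measurable_fun_int (int_div a)).

Definition convolution (R : realType) (mu nu : probability int R) :
    probability int R :=
  distribution (mu \x nu)%E int_add.

Fixpoint convolution_pow (R : realType) (nu : probability int R) (n : nat) :
    probability int R :=
  if n is n'.+1 then convolution (convolution_pow nu n') nu else \d_(0 : int).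

(* [rescaled_pow nu A n] is the law of (Z_1 + ... + Z_n) / A_n. *)
Definition rescaled_pow (R : realType) (nu : probability int R) (A : R^nat)
    (n : nat) : probability R R :=
  distribution (convolution_pow nu n) (int_div (A n)).

Definition symmetrized (R : realType) (nu : probability int R) :
    probability int R :=
  convolution (distribution nu int_opp) nu.

Definition weakly_converges (R : realType) (mu_ : nat -> probability R R)
    (mu : probability R R) : Prop :=
  forall f : R -> R, continuous f -> (exists K : R, forall x, `|f x| <= K) ->
    (\int[mu_ n]_x (f x)%:E)%E @[n --> \oo] --> (\int[mu]_x (f x)%:E)%E.

(* Stability in the broad sense: if X_1, X_2 are independent copies of X ~ mu,
   then a X_1 + b X_2 has the law of c X + s with c = (a^beta + b^beta)^(1/beta),
   for some shift s. *)
Definition stable_distribution (R : realType) (beta : R)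
    (mu : probability R R) : Prop :=
  [/\ 0 < beta <= 2,
      forall x : R, mu [set x] <> 1%E &
      forall a b : R, 0 < a -> 0 < b -> exists s : R,
        forall B : set R, measurable B ->
          (mu \x mu)%E [set p : R * R | B (a * p.1 + b * p.2)] =
          mu [set x | B ((a `^ beta + b `^ beta) `^ beta^-1 * x + s)]].

Definition in_stable_domain (R : realType) (beta : R) (nu : probability int R)
    (A : R^nat) : Prop :=
  exists2 mu : probability R R,
    stable_distribution beta mu & weakly_converges (rescaled_pow nu A) mu.

Definition markov_chain (R : realType) (d : measure_display)
    (Omega : measurableType d) (P : probability Omega R)
    (M : nat -> {RV P >-> (int * int)%type})
    (x0 : int * int) (p : int * int -> int * int -> \bar R) : Prop :=
  P [set w | M 0%N w = x0] = 1%E /\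
  forall (n : nat) (x : nat -> int * int),
    (P [set w | forall k, (k <= n.+1)%N -> M k w = x k] =
     P [set w | forall k, (k <= n)%N -> M k w = x k] * p (x n) (x n.+1))%E.

Definition transition_a (R : realType) (delta : R) (nu : probability int R)
    (s t : int * int) : \bar R :=
  let: (x, y) := s in let: (x', y') := t in
  if (y' == y) && ((x' == x + 1) || (x' == x - 1)) then (delta / 2)%:E
  else if x' == x then ((1 - delta)%:E * nu [set (y' - y)%R])%E
  else 0%E.

Definition transition_b (R : realType) (delta : R) (nu : probability int R)
    (s t : int * int) : \bar R :=
  let: (x, y) := s in let: (x', y') := t in
  if (y' == y) && ((x' == x + 1) || (x' == x - 1)) then (delta / 2)%:E
  else if x' == x then ((1 - delta)%:E * nu [set ((-1) ^ x * (y' - y))%R])%E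
  else 0%E.

Definition case_a (R : realType) (delta : R) (nu : probability int R)
    (A : R^nat) (beta : R) (d : measure_display) (Omega : measurableType d)
    (P : probability Omega R) (M : nat -> {RV P >-> (int * int)%type}) : Prop :=
  [/\ nu.-integrable [set: int] (fun z => (z%:~R)%:E),
      ('E_nu[fun z => z%:~R] = 0)%E,
      1 < beta <= 2,
      in_stable_domain beta nu A &
      markov_chain M (0, 0) (transition_a delta nu)].

Definition case_b (R : realType) (delta : R) (nu : probability int R)
    (A : R^nat) (beta : R) (d : measure_display) (Omega : measurableType d)
    (P : probability Omega R) (M : nat -> {RV P >-> (int * int)%type}) : Prop :=
  [/\ nu.-integrable [set: int] (fun z => (z%:~R)%:E),
      1 < beta,
      in_stable_domain beta (symmetrized nu) A &
      markov_chain M (0, 0) (transition_b delta nu)].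

Definition recurrent (R : realType) (d : measure_display)
    (Omega : measurableType d) (P : probability Omega R)
    (M : nat -> {RV P >-> (int * int)%type}) : Prop :=
  {ae P, forall w, infinite_set [set n | M n w = (0, 0)]}.

Definition transient (R : realType) (d : measure_display)
    (Omega : measurableType d) (P : probability Omega R)
    (M : nat -> {RV P >-> (int * int)%type}) : Prop :=
  {ae P, forall w, finite_set [set n | M n w = (0, 0)]}.

(* Main.v *)
(** A vertical step taken after j horizontal ones has sign kappa ^ j, with
    kappa = 1 in case (a) and -1 in case (b), so both chains are governed by one
    operator on functions of j and of the height. Recurrence means that the Green
    sum of P (M_n = 0) diverges, and condensation turns the series of the theorem
    into the sum of b_i = 2 ^ i / A_(4 ^ i).

    Upper bound of the Green sum by C times the sum of the b_i: a Fejer kernel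
    dominates the indicator of height 0 by an average of cosines cos (t y), for
    which the potential can be computed, and the characteristic function phi of
    nu satisfies 1 - |phi t| ^ 2 >= c / n for t of order 1 / A_n.

    Lower bound: let G and H be the discounted Green functions, with discount r,
    started after an even and an odd number of horizontal steps. Pairing their
    equations gives (1 - r) |G + H|^2 <= C G(0) in l^2, while the heights up to
    time N are tight at scale A_N, so that G + H has mass c N on |y| <= K A_N when
    1 - r = 1 / N. By Cauchy-Schwarz G(0) >= c N / A_N, and a mixture over
    N = 4 ^ i yields the sum of the b_i. In case (b) the tightness uses the first
    moment of nu and A_N >= c sqrt N.

    For beta < 2, stability gives |phi s| ^ 4 = |phi (2 ^ (1 / beta) s)| ^ 2 for the
    limit law, hence A_(4 ^ l n) >= 2 ^ (l + 1) A_n for some l and all large n, and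
    the b_i decrease geometrically along steps of length l. *)

Require Import Defs.
From HB Require Import structures.
From mathcomp Require Import all_boot all_order all_algebra.
From mathcomp Require Import all_classical all_reals all_analysis.
From mathcomp Require Import measurable_realfun.
From mathcomp Require Import ring lra zify.

Set Implicit Arguments.
Unset Strict Implicit.
Unset Printing Implicit Defensive.

Import Order.TTheory GRing.Theory Num.Theory.
Import numFieldNormedType.Exports.

Local Open Scope classical_set_scope.
Local Open Scope ring_scope.

(** [nu] may be periodic or carried by a sublattice, so no local limit theorem for P (M_n = 0) is at
    hand; both bounds average instead, the upper one over frequencies and the lower one over
    heights. Everything needed about [nu] in both bounds passes through the difference S_n - S'_n of
    two independent sums: its characteristic function is |phi| ^ (2 n), which ignores centering, and
    it is the only thing controlled in case (b). The discount of the Green functions is r per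
    horizontal step, not per unit of time. This is what links them to the chain: P (M_n = 0) carries
    the weight [srw j 0], of order 1 / sqrt j for even j, and the mixture of the geometric weights
    (1 - 4 ^ (-i)) ^ j with coefficients 2 ^ (-i) has the same order. In the upper bound the same
    weight is not geometric, so the potential of a cosine has no closed form; its coefficients solve
    a recursion in j and are bounded by a supersolution. *)

Section bounded_functions.
Context {R : realType}.

Definition bd (T : Type) (f : T -> R) := exists K : R, forall x, `|f x| <= K.

Lemma bd_comp (T U : Type) (f : T -> R) (g : U -> T) :
  bd f -> bd (fun x => f (g x)).
Proof. by case=> K hK; exists K => x; exact: hK. Qed.

Lemma bd_cst (T : Type) (c : R) : bd (fun _ : T => c).
Proof. by exists `|c|. Qed.

Lemma bdD (T : Type) (f g : T -> R) : bd f -> bd g -> bd (fun x => f x + g x).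
Proof.
move=> [K hK] [L hL]; exists (K + L) => x.
by apply: (le_trans (ler_normD _ _)); exact: lerD.
Qed.

Lemma bdN (T : Type) (f : T -> R) : bd f -> bd (fun x => - f x).
Proof. by move=> [K hK]; exists K => x; rewrite normrN. Qed.

Lemma bdB (T : Type) (f g : T -> R) : bd f -> bd g -> bd (fun x => f x - g x).
Proof. by move=> bf bg; apply: bdD => //; exact: bdN. Qed.

Lemma bdM (T : Type) (f g : T -> R) : bd f -> bd g -> bd (fun x => f x * g x).
Proof.
move=> [K hK] [L hL]; exists (K * L) => x.
by rewrite normrM; apply: ler_pM.
Qed.

Lemma bdZ (T : Type) (c : R) (f : T -> R) : bd f -> bd (fun x => c * f x).
Proof. by move=> bf; apply: bdM => //; exact: bd_cst. Qed.

Lemma bd_sum (T I : Type) (s : seq I) (f : I -> T -> R) :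
  (forall i, bd (f i)) -> bd (fun x => \sum_(i <- s) f i x).
Proof.
move=> bf; elim: s => [|i s ih].
  by under eq_fun do rewrite big_nil; exact: bd_cst.
by under eq_fun do rewrite big_cons; exact: bdD.
Qed.

Lemma bd_indic (T : Type) (b : T -> bool) : bd (fun x => (b x)%:R : R).
Proof. by exists 1 => x; case: (b x); rewrite ?normr1 ?normr0. Qed.

Lemma bd_cos (T : Type) (g : T -> R) : bd (fun x => cos (g x)).
Proof. by exists 1 => x; rewrite ler_norml cos_geN1 cos_le1. Qed.

Lemma bd_sin (T : Type) (g : T -> R) : bd (fun x => sin (g x)).
Proof. by exists 1 => x; rewrite ler_norml sin_geN1 sin_le1. Qed.

End bounded_functions.

#[local] Hint Resolve bd_cst bd_cos bd_sin bd_indic : core.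

(** * Expectations of bounded functions *)

Section expectation.
Context {R : realType} {d : measure_display} {T : measurableType d}.
Implicit Types (mu : probability T R) (f g : T -> R).

Definition Ex mu f : R := \int[mu]_x f x.

Lemma bd_integrable mu f : measurable_fun setT f -> bd f ->
  mu.-integrable setT (EFin \o f).
Proof.
move=> mf [K hK]; apply: measurable_bounded_integrable => //.
  by rewrite (le_lt_trans (probability_le1 _ _)) ?ltry.
exists K; split; first exact: num_real.
by move=> M KM x _ /=; exact: le_trans (hK x) (ltW KM).
Qed.

Lemma Ex_EFin mu f : measurable_fun setT f -> bd f ->
  (\int[mu]_x (f x)%:E)%E = (Ex mu f)%:E.
Proof.
move=> mf bf; rewrite /Ex /Rintegral fineK//.
by apply: integrable_fin_num => //; exact: bd_integrable.
Qed.

Lemma ExD_meas mu f g : measurable_fun setT f -> measurable_fun setT g ->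
  bd f -> bd g -> Ex mu (fun x => f x + g x) = Ex mu f + Ex mu g.
Proof. by move=> *; rewrite /Ex RintegralD//; exact: bd_integrable. Qed.

Lemma ExB_meas mu f g : measurable_fun setT f -> measurable_fun setT g ->
  bd f -> bd g -> Ex mu (fun x => f x - g x) = Ex mu f - Ex mu g.
Proof. by move=> *; rewrite /Ex RintegralB//; exact: bd_integrable. Qed.

Lemma ExZ_meas mu (c : R) f : measurable_fun setT f -> bd f ->
  Ex mu (fun x => c * f x) = c * Ex mu f.
Proof. by move=> *; rewrite /Ex RintegralZl//; exact: bd_integrable. Qed.

Lemma Ex_cst mu (c : R) : Ex mu (fun=> c) = c.
Proof.
rewrite /Ex Rintegral_cst//.
by rewrite [X in fine X]probability_setT mulr1.
Qed.

Lemma le_Ex_meas mu f g : measurable_fun setT f -> measurable_fun setT g ->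
  bd f -> bd g -> (forall x, f x <= g x) -> Ex mu f <= Ex mu g.
Proof. by move=> *; apply: le_Rintegral => //; exact: bd_integrable. Qed.

Lemma Ex_ge0 mu f : (forall x, 0 <= f x) -> 0 <= Ex mu f.
Proof. by move=> f0; exact: Rintegral_ge0. Qed.

Lemma eq_Ex mu f g : f =1 g -> Ex mu f = Ex mu g.
Proof. by move=> /funext ->. Qed.

End expectation.

Section expectation_int.
Context {R : realType}.
Implicit Types (mu nu : probability int R) (f g : int -> R).

Lemma ExD mu f g : bd f -> bd g -> Ex mu (fun x => f x + g x) = Ex mu f + Ex mu g.
Proof. by move=> *; exact: ExD_meas. Qed.

Lemma ExB mu f g : bd f -> bd g -> Ex mu (fun x => f x - g x) = Ex mu f - Ex mu g.
Proof. by move=> *; exact: ExB_meas. Qed.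

Lemma ExZ mu (c : R) f : bd f -> Ex mu (fun x => c * f x) = c * Ex mu f.
Proof. by move=> *; exact: ExZ_meas. Qed.

Lemma le_Ex mu f g : bd f -> bd g -> (forall x, f x <= g x) -> Ex mu f <= Ex mu g.
Proof. by move=> *; exact: le_Ex_meas. Qed.

Lemma Ex_norm_le mu f (K : R) : (forall x, `|f x| <= K) -> `|Ex mu f| <= K.
Proof.
move=> hK; have bf : bd f by exists K.
rewrite ler_norml; apply/andP; split.
  rewrite -[leLHS](Ex_cst mu); apply: le_Ex => // x.
  by have := hK x; rewrite ler_norml => /andP[].
rewrite -[leRHS](Ex_cst mu); apply: le_Ex => // x.
by have := hK x; rewrite ler_norml => /andP[].
Qed.

Lemma bd_Ex (T : Type) mu (f : T -> int -> R) (K : R) :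
  (forall x y, `|f x y| <= K) -> bd (fun x => Ex mu (f x)).
Proof. by move=> hK; exists K => x; exact: Ex_norm_le. Qed.

Lemma Ex_prod mu nu (f : int * int -> R) : bd f ->
  (\int[(mu \x nu)%E]_p (f p)%:E)%E = (Ex mu (fun x => Ex nu (fun y => f (x, y))))%:E.
Proof.
move=> [K hK]; have bf : bd f by exists K.
have mf : measurable_fun setT (EFin \o f) by exact: measurable_fun_int_prod.
have intf : (mu \x nu)%E.-integrable setT (EFin \o f).
  by apply: bd_integrable => //; exact: measurable_fun_int_prod.
rewrite -(integral12_prod_meas1 intf) /fubini_F.
rewrite -Ex_EFin//; last by apply: bd_Ex => x y; exact: hK.
by apply: eq_integral => x _; rewrite -Ex_EFin//; exact: bd_comp.
Qed.

Lemma Ex_swap mu nu (f : int -> int -> R) (K : R) : (forall x y, `|f x y| <= K) ->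
  Ex mu (fun x => Ex nu (fun y => f x y)) = Ex nu (fun y => Ex mu (fun x => f x y)).
Proof.
move=> hK; pose F p : R := f p.1 p.2.
have bF : bd F by exists K => -[x y]; exact: hK.
have mF : measurable_fun setT (EFin \o F) by exact: measurable_fun_int_prod.
have intF : (mu \x nu)%E.-integrable setT (EFin \o F).
  by apply: bd_integrable => //; exact: measurable_fun_int_prod.
apply: EFin_inj; rewrite -(Ex_prod mu nu bF) -(integral21_prod_meas1 intF).
rewrite /fubini_G -Ex_EFin//; last by apply: bd_Ex => x y; exact: hK.
by apply: eq_integral => y _; rewrite -Ex_EFin//; exists K => x; exact: hK.
Qed.

Lemma Ex_convolution mu nu f : bd f ->
  Ex (convolution mu nu) f = Ex mu (fun x => Ex nu (fun y => f (x + y))).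
Proof.
move=> bf; apply: EFin_inj; rewrite -Ex_EFin// integral_distribution//.
  by rewrite (Ex_prod mu nu (f := f \o int_add))//; exact: bd_comp.
by apply: bd_integrable; [exact: measurable_fun_int_prod|exact: bd_comp].
Qed.

Lemma Ex_opp mu f : bd f -> Ex (distribution mu int_opp) f = Ex mu (fun x => f (- x)).
Proof.
move=> bf; apply: EFin_inj; rewrite -Ex_EFin// integral_distribution//.
  by rewrite -Ex_EFin//; exact: bd_comp.
by apply: bd_integrable => //; exact: bd_comp.
Qed.

Lemma Ex_symmetrized mu f : bd f ->
  Ex (symmetrized mu) f = Ex mu (fun x => Ex mu (fun y => f (- x + y))).
Proof.
move=> [K hK]; rewrite Ex_convolution; last by exists K.
by rewrite Ex_opp//; apply: bd_Ex => x y; exact: hK.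
Qed.

Lemma Ex_rescaled mu (A : R^nat) n (f : R -> R) : measurable_fun setT f -> bd f ->
  Ex (rescaled_pow mu A n) f = Ex (convolution_pow mu n) (fun x => f (x%:~R / A n)).
Proof.
move=> mf bf; apply: EFin_inj; rewrite -Ex_EFin// integral_distribution//.
- by rewrite -Ex_EFin//; exact: bd_comp.
- exact/measurable_EFinP.
- by apply: bd_integrable => //; exact: bd_comp.
Qed.

Lemma Ex_pow0 mu f : Ex (convolution_pow mu 0) f = f 0.
Proof.
rewrite /Ex /Rintegral /= integral_dirac//.
by rewrite diracT mul1e.
Qed.

Lemma Ex_powS mu n f : bd f -> Ex (convolution_pow mu n.+1) f =
  Ex (convolution_pow mu n) (fun x => Ex mu (fun y => f (x + y))).
Proof. by move=> bf; rewrite Ex_convolution. Qed.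

Lemma Ex_powD mu m n f : bd f -> Ex (convolution_pow mu (m + n)) f =
  Ex (convolution_pow mu m) (fun x => Ex (convolution_pow mu n) (fun y => f (x + y))).
Proof.
move=> [K hK]; elim: n f hK => [|n ih] f hK.
  by rewrite addn0; apply: eq_Ex => x; rewrite Ex_pow0 addr0.
rewrite addnS Ex_powS; last by exists K.
rewrite ih; last by move=> x; exact: Ex_norm_le.
apply: eq_Ex => x; rewrite Ex_powS; last by exists K => y; exact: hK.
by apply: eq_Ex => y; apply: eq_Ex => z; rewrite addrA.
Qed.

End expectation_int.

(** * The chain seen through its horizontal steps *)

Section vertical_operator.
Context {R : realType}.
Variables (delta : R) (nu : probability int R) (kappa : int).
Hypothesis delta01 : 0 <= delta <= 1.
Implicit Types f g : nat -> int -> R.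

Definition bd2 f := exists K : R, forall j y, `|f j y| <= K.

(* One step of the chain (number of horizontal steps, height): a vertical step
   taken after j horizontal ones has sign kappa ^ j, because a simple random walk
   on Z sits at a site of the parity of j after j steps. *)
Definition vop f : nat -> int -> R := fun j y =>
  delta * f j.+1 y + (1 - delta) * Ex nu (fun z => f j (y + kappa ^+ j * z)).

Lemma bd2_row f j (h : int -> int) : bd2 f -> bd (fun y => f j (h y)).
Proof. by case=> K hK; exists K => y; exact: hK. Qed.

Lemma vop_norm_le f (K : R) : (forall j y, `|f j y| <= K) ->
  forall j y, `|vop f j y| <= K.
Proof.
move=> hK j y; have [d0 d1] := andP delta01; rewrite /vop.
have -> : K = delta * K + (1 - delta) * K by ring.
apply: (le_trans (ler_normD _ _)); rewrite !normrM (ger0_norm d0).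
rewrite (@ger0_norm _ (1 - delta)) ?subr_ge0//.
by apply: lerD; apply: ler_wpM2l => //; rewrite ?subr_ge0//; exact: Ex_norm_le.
Qed.

Lemma vop_bd f : bd2 f -> bd2 (vop f).
Proof. by case=> K hK; exists K; exact: vop_norm_le. Qed.

Lemma vopD f g : bd2 f -> bd2 g ->
  vop (fun j y => f j y + g j y) = (fun j y => vop f j y + vop g j y).
Proof.
move=> bf bg; apply/funext => j; apply/funext => y.
by rewrite /vop ExD; [ring|exact: bd2_row..].
Qed.

Lemma vopZ (c : R) f : bd2 f ->
  vop (fun j y => c * f j y) = (fun j y => c * vop f j y).
Proof.
move=> bf; apply/funext => j; apply/funext => y.
by rewrite /vop ExZ; [ring|exact: bd2_row].
Qed.

Lemma le_vop f g : bd2 f -> bd2 g -> (forall j y, f j y <= g j y) ->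
  forall j y, vop f j y <= vop g j y.
Proof.
move=> bf bg fg j y; have [d0 d1] := andP delta01.
apply: lerD; apply: ler_wpM2l => //; rewrite ?subr_ge0//.
by apply: le_Ex => //; exact: bd2_row.
Qed.

Definition vopn n f := iter n vop f.

Lemma vopnS n f : vopn n.+1 f = vop (vopn n f). Proof. by []. Qed.

Lemma vopnSr n f : vopn n.+1 f = vopn n (vop f). Proof. exact: iterSr. Qed.

Lemma vopn_norm_le n f (K : R) : (forall j y, `|f j y| <= K) ->
  forall j y, `|vopn n f j y| <= K.
Proof. by move=> hK; elim: n => [//|n ih] j y; exact: vop_norm_le. Qed.

Lemma vopn_bd n f : bd2 f -> bd2 (vopn n f).
Proof. by case=> K hK; exists K; exact: vopn_norm_le. Qed.

Lemma vopnD n f g : bd2 f -> bd2 g ->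
  vopn n (fun j y => f j y + g j y) = (fun j y => vopn n f j y + vopn n g j y).
Proof.
move=> bf bg; elim: n => [//|n ih].
by rewrite vopnS ih vopD//; exact: vopn_bd.
Qed.

Lemma vopnZ n (c : R) f : bd2 f ->
  vopn n (fun j y => c * f j y) = (fun j y => c * vopn n f j y).
Proof.
by move=> bf; elim: n => [//|n ih]; rewrite vopnS ih vopZ//; exact: vopn_bd.
Qed.

Lemma bd2_sum (I : Type) (s : seq I) (f : I -> nat -> int -> R) :
  (forall i, bd2 (f i)) -> bd2 (fun j y => \sum_(i <- s) f i j y).
Proof.
move=> bf.
have [K hK] : bd (fun p : nat * int => \sum_(i <- s) f i p.1 p.2).
  by apply: bd_sum => i; have [K hK] := bf i; exists K => -[j y]; exact: hK.
by exists K => j y; exact: (hK (j, y)).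
Qed.

Lemma vopn_sum n (I : Type) (s : seq I) (f : I -> nat -> int -> R) :
  (forall i, bd2 (f i)) ->
  vopn n (fun j y => \sum_(i <- s) f i j y) =
  (fun j y => \sum_(i <- s) vopn n (f i) j y).
Proof.
move=> bf; elim: s => [|i s ih].
  transitivity (vopn n (fun j y => 0 * (0 : R))).
    by congr vopn; apply/funext => j; apply/funext => y; rewrite big_nil mul0r.
  rewrite vopnZ; last by exists 0 => *; rewrite normr0.
  by apply/funext => j; apply/funext => y; rewrite mul0r big_nil.
transitivity (vopn n (fun j y => f i j y + \sum_(i <- s) f i j y)).
  by congr vopn; apply/funext => j; apply/funext => y; rewrite big_cons.
rewrite vopnD ?ih//; last exact: bd2_sum.
by apply/funext => j; apply/funext => y; rewrite big_cons.
Qed.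

Lemma le_vopn n f g : bd2 f -> bd2 g -> (forall j y, f j y <= g j y) ->
  forall j y, vopn n f j y <= vopn n g j y.
Proof.
move=> bf bg fg; elim: n => [//|n ih] j y.
by apply: le_vop => //; exact: vopn_bd.
Qed.

Lemma vopn_cst n (c : R) : vopn n (fun _ _ => c) = (fun _ _ => c).
Proof.
elim: n => [//|n ih]; rewrite vopnS ih; apply/funext => j; apply/funext => y.
by rewrite /vop Ex_cst; ring.
Qed.

Lemma vopn_ge0 n f : bd2 f -> (forall j y, 0 <= f j y) ->
  forall j y, 0 <= vopn n f j y.
Proof.
move=> bf f0 j y; rewrite -[leLHS](congr1 (fun h => h j y) (vopn_cst n 0)).
by apply: le_vopn => //; exists 0 => *; rewrite normr0.
Qed.

Lemma vopn_shift n f (a : int) :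
  vopn n (fun j y => f j (y + a)) = (fun j y => vopn n f j (y + a)).
Proof.
elim: n => [//|n ih]; rewrite vopnS ih; apply/funext => j; apply/funext => y.
rewrite /vop; congr (_ + _ * _); apply: eq_Ex => z.
by congr (vopn _ _ _); ring.
Qed.

(** The substitution (j, y) -> (j + 1, kappa y) commutes with one step because kappa (y + kappa ^ j
    z) = kappa y + kappa ^ (j + 1) z. It relates starts after an odd and after an even number of
    horizontal steps. *)
Lemma vopn_flip n f : vopn n (fun j y => f j.+1 (kappa * y)) =
  (fun j y => vopn n f j.+1 (kappa * y)).
Proof.
elim: n => [//|n ih]; rewrite vopnS ih; apply/funext => j; apply/funext => y.
rewrite /vop; congr (_ + _ * _); apply: eq_Ex => z.
by congr (vopn _ _ _); rewrite exprS; ring.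
Qed.

(** Each step raises j by at most one, so a cutoff at j <= J is invisible to the first J steps from
    j = 0. The potentials used later can therefore have finitely many nonzero coefficients. *)
Lemma vopn_local n f g J : (forall j y, (j <= J)%N -> f j y = g j y) ->
  forall j y, (j + n <= J)%N -> vopn n f j y = vopn n g j y.
Proof.
move=> fg; clear delta01; elim: n => [|n ih] j y jn; first by apply: fg; rewrite -(addn0 j).
rewrite !vopnS /vop; congr (_ * _ + _ * _); first by apply: ih; lia.
by apply: eq_Ex => z; apply: ih; lia.
Qed.

(** At most n of n steps are horizontal, so a discount per horizontal step is at least the discount
    per step. *)
Lemma vopn_geometric n (r : R) f : bd2 f -> 0 <= r <= 1 ->
  (forall j y, 0 <= f j y) ->
  forall j y, r ^+ (j + n) * vopn n f j y <= vopn n (fun j y => r ^+ j * f j y) j y.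
Proof.
move=> bf /andP[r0 r1] f0; have [d0 d1] := andP delta01.
have bg : bd2 (fun j y => r ^+ j * f j y).
  have [K hK] := bf; exists K => j y; rewrite normrM.
  rewrite -[leRHS]mul1r ler_pM// ger0_norm ?exprn_ge0//.
  exact: exprn_ile1.
elim: n => [|n ih] j y; first by rewrite addn0.
rewrite !vopnS {1}/vop mulrDr; apply: lerD.
  by rewrite mulrCA ler_wpM2l// -addSnnS; exact: ih.
rewrite mulrCA ler_wpM2l ?subr_ge0// -ExZ; last exact/bd2_row/vopn_bd.
apply: le_Ex.
- exact/bdZ/bd2_row/vopn_bd.
- exact/bd2_row/vopn_bd.
move=> z; apply: le_trans (ih _ _).
rewrite addnS exprS -mulrA ler_piMl// mulr_ge0 ?exprn_ge0//.
exact: vopn_ge0.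
Qed.

(** Telescoping of F = Phi - vop Phi. A bounded solution of this equation bounds the Green sums of F
    uniformly in n. *)
Lemma potential_sum n (Phi F : nat -> int -> R) : bd2 Phi -> bd2 F ->
  (forall j y, Phi j y = F j y + vop Phi j y) ->
  forall j y, \sum_(k < n) vopn k F j y = Phi j y - vopn n Phi j y.
Proof.
move=> bP bF PE; elim: n => [|n ih] j y.
  by rewrite big_ord0 /= subrr.
rewrite big_ord_recr /= ih.
have -> : vopn n Phi j y = vopn n F j y + vopn n.+1 Phi j y.
  rewrite vopnSr -[RHS]/((fun j y => vopn n F j y + vopn n (vop Phi) j y) j y).
  rewrite -vopnD//; last exact: vop_bd.
  by congr (vopn _ _ _ _); apply/funext => i; apply/funext => x; exact: PE.
by rewrite /= -/(vopn n Phi); ring.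
Qed.

End vertical_operator.

(** * Fourier upper bound of the Green sum *)

Section fourier_potential.
Context {R : realType}.
Variables (delta : R) (nu : probability int R) (kappa : int).
Hypothesis delta01 : 0 < delta < 1.
Hypothesis kappa1 : kappa = 1 \/ kappa = -1.

(** Real part, imaginary part and squared modulus of the characteristic function; complex arithmetic
    is written out on pairs. *)
Definition charC (mu : probability int R) (t : R) : R := Ex mu (fun z => cos (t * z%:~R)).
Definition charS (mu : probability int R) (t : R) : R := Ex mu (fun z => sin (t * z%:~R)).
Definition charN (mu : probability int R) (t : R) : R := charC mu t ^+ 2 + charS mu t ^+ 2.

Local Notation sgk j := ((kappa ^+ j)%:~R : R).

Lemma sgk_cases j : kappa ^+ j = 1 \/ kappa ^+ j = -1.
Proof.
case: kappa1 => ->; first by left; rewrite expr1n.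
by elim: j => [|j [|] ih]; [left|right|left]; rewrite // exprS ih ?mulrN ?mulN1r ?opprK ?mulr1.
Qed.

Lemma sgk_sqr j : sgk j ^+ 2 = 1.
Proof. by have [->|->] := sgk_cases j; rewrite ?rmorphN1 ?rmorph1 ?sqrrN ?expr1n. Qed.

Lemma Ex_cos_step t j (y : int) :
  Ex nu (fun z => cos (t * (y + kappa ^+ j * z)%:~R)) =
  cos (t * y%:~R) * charC nu t - sin (t * y%:~R) * (sgk j * charS nu t).
Proof.
rewrite /charC /charS -!ExZ// -?ExB//; [|by do ?apply: bdZ..].
apply: eq_Ex => z; rewrite intrD intrM mulrDr cosD.
by have [->|->] := sgk_cases j;
  rewrite ?rmorphN1 ?rmorph1 ?mul1r ?mulN1r ?mulrN ?cosN ?sinN ?mulrN ?mulNr.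
Qed.

Lemma Ex_sin_step t j (y : int) :
  Ex nu (fun z => sin (t * (y + kappa ^+ j * z)%:~R)) =
  sin (t * y%:~R) * charC nu t + cos (t * y%:~R) * (sgk j * charS nu t).
Proof.
rewrite /charC /charS -!ExZ// -?ExD//; [|by do ?apply: bdZ..].
apply: eq_Ex => z; rewrite intrD intrM mulrDr sinD.
by have [->|->] := sgk_cases j;
  rewrite ?rmorphN1 ?rmorph1 ?mul1r ?mulN1r ?mulrN ?cosN ?sinN ?mulrN ?mulNr.
Qed.

Lemma charN_ge0 mu t : 0 <= charN mu t.
Proof. by rewrite /charN addr_ge0 ?sqr_ge0. Qed.

Lemma charC_le1 mu t : `|charC mu t| <= 1.
Proof. by apply: Ex_norm_le => z; rewrite ler_norml cos_geN1 cos_le1. Qed.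

Let denom t : R := (1 - (1 - delta) * charC nu t) ^+ 2 + ((1 - delta) * charS nu t) ^+ 2.

(** [denom t] is |1 - (1 - delta) phi| ^ 2 = delta ^ 2 + delta (1 - delta) (1 - |phi| ^ 2) + (1 -
    delta) |1 - phi| ^ 2, and the last term is dropped. The 3 comes from 2 k + k ^ 2 <= 3 k. *)
Lemma denom_ge t (k : R) : 0 <= k <= 1 ->
  3 * delta * k <= (1 - delta) * (1 - charN nu t) ->
  delta ^+ 2 * (1 + k) ^+ 2 <= denom t.
Proof.
move=> /andP[k0 k1] hk; have [d0 d1] := andP delta01.
have := charC_le1 nu t; rewrite ler_norml => /andP[cl cu].
have h1 : 0 <= (1 - charC nu t) ^+ 2 by exact: sqr_ge0.
have h2 : 0 <= charS nu t ^+ 2 by exact: sqr_ge0.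
have h3 : delta ^+ 2 + delta * ((1 - delta) * (1 - charN nu t)) <= denom t.
  have -> : denom t = delta ^+ 2 + delta * ((1 - delta) * (1 - charN nu t)) +
     (1 - delta) * ((1 - charC nu t) ^+ 2 + charS nu t ^+ 2).
    by rewrite /denom /charN; ring.
  by rewrite lerDl; apply: mulr_ge0; [lra|exact: addr_ge0].
apply: le_trans h3.
have h4 := ler_wpM2l (ltW d0) hk.
apply: (@le_trans _ _ (delta ^+ 2 + delta * (3 * delta * k))); last lra.
rewrite !expr2 in h1 h2 *; have : 0 <= delta * delta * (k * (1 - k)) by rewrite !mulr_ge0//; lra.
lra.
Qed.

(** Complex coefficients c_j for which Re (c_j e ^ (i t y)) is the potential of the source p_j cos
    (t y): they satisfy c_j = (p_j + delta c_(j+1)) / (1 - (1 - delta) phi_j), where phi_j is phi or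
    its conjugate according to the sign kappa ^ j. The argument [n] counts the steps of this
    downward recursion, which starts from 0. *)
Fixpoint pot_coef (p : nat -> R) t n j : R * R :=
  if n is n'.+1 then
    let x := p j + delta * (pot_coef p t n' j.+1).1 in
    let y := delta * (pot_coef p t n' j.+1).2 in
    let a := 1 - (1 - delta) * charC nu t in
    let b := - ((1 - delta) * (sgk j * charS nu t)) in
    ((x * a + y * b) / denom t, (y * a - x * b) / denom t)
  else (0, 0).

(** [B] is a supersolution: the denominator has modulus at least delta (1 + k), so |c_(j+1)| <=
    B_(j+1) gives |c_j| <= (p_j / delta + B_(j+1)) / (1 + k) <= B_j. *)
Lemma pot_coef_bound (p B : nat -> R) t J (k : R) : (forall j, 0 <= p j) ->
  (forall j, 0 <= B j) -> 0 <= k -> delta ^+ 2 * (1 + k) ^+ 2 <= denom t ->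
  (forall j, (j <= J)%N -> p j / delta + B j.+1 <= (1 + k) * B j) ->
  forall n j, (n + j <= J.+1)%N ->
    (pot_coef p t n j).1 ^+ 2 + (pot_coef p t n j).2 ^+ 2 <= B j ^+ 2.
Proof.
move=> p0 B0 k0 hD hB; have [d0 d1] := andP delta01.
have D0 : 0 < denom t by apply: lt_le_trans hD; rewrite mulr_gt0// exprn_gt0//; lra.
elim=> [|n ih] j nj; first by rewrite /= expr0n /= addr0 sqr_ge0.
rewrite /=; have := ih j.+1; rewrite addnS -addSn => /(_ nj).
set u := (pot_coef p t n j.+1).1; set w := (pot_coef p t n j.+1).2 => huw.
have -> : forall x y a b : R, ((x * a + y * b) / denom t) ^+ 2 +
    ((y * a - x * b) / denom t) ^+ 2 =
    (x ^+ 2 + y ^+ 2) * ((a ^+ 2 + b ^+ 2) / denom t) / denom t.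
  by move=> x y a b; field; rewrite gt_eqF.
have -> : ((1 - (1 - delta) * charC nu t) ^+ 2 +
    (- ((1 - delta) * (sgk j * charS nu t))) ^+ 2) / denom t = 1.
  have -> : (1 - (1 - delta) * charC nu t) ^+ 2 +
    (- ((1 - delta) * (sgk j * charS nu t))) ^+ 2 = denom t.
    rewrite sqrrN !exprMn sgk_sqr /denom exprMn; ring.
  by rewrite divff// gt_eqF.
rewrite mulr1 ler_pdivrMr//.
have Bj := B0 j.+1.
have uB : u <= B j.+1.
  apply: le_trans (ler_norm u) _; rewrite -(ler_pXn2r (n := 2)) ?nnegrE//.
  by rewrite real_normK ?num_real//; have := sqr_ge0 w; lra.
have step : (p j + delta * u) ^+ 2 + (delta * w) ^+ 2 <= (p j + delta * B j.+1) ^+ 2.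
  have h1 : 0 <= p j * delta * (B j.+1 - u) by rewrite !mulr_ge0 ?subr_ge0// ltW.
  have h2 : 0 <= delta ^+ 2 * (B j.+1 ^+ 2 - (u ^+ 2 + w ^+ 2)).
    by rewrite mulr_ge0 ?exprn_ge0 ?subr_ge0// ltW.
  have e1 : (p j + delta * B j.+1) ^+ 2 = (p j + delta * u) ^+ 2 + (delta * w) ^+ 2
    + 2 * (p j * delta * (B j.+1 - u)) + delta ^+ 2 * (B j.+1 ^+ 2 - (u ^+ 2 + w ^+ 2)) by ring.
  lra.
apply: (le_trans step).
have hj : (j <= J)%N by lia.
have pB : p j + delta * B j.+1 <= delta * ((1 + k) * B j).
  have -> : p j + delta * B j.+1 = delta * (p j / delta + B j.+1) by field; rewrite gt_eqF.
  by rewrite ler_wpM2l ?hB// ltW.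
have pB0 : 0 <= p j + delta * B j.+1 by rewrite addr_ge0 ?mulr_ge0// ltW.
apply: (@le_trans _ _ ((delta * ((1 + k) * B j)) ^+ 2)).
  by rewrite ler_pXn2r// nnegrE// (le_trans pB0).
have -> : (delta * ((1 + k) * B j)) ^+ 2 = B j ^+ 2 * (delta ^+ 2 * (1 + k) ^+ 2) by ring.
by rewrite ler_wpM2l ?sqr_ge0.
Qed.

Lemma cos_sin_bound (u w b x : R) : 0 <= b -> u ^+ 2 + w ^+ 2 <= b ^+ 2 ->
  `|u * cos x - w * sin x| <= b.
Proof.
move=> b0 h; rewrite -(ler_pXn2r (n := 2)) ?nnegrE// real_normK ?num_real//.
apply: le_trans h.
have := cos2Dsin2 x; have := sqr_ge0 (u * sin x + w * cos x).
set c := cos x; set s := sin x => h1 h2.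
have : u ^+ 2 + w ^+ 2 = (u * c - w * s) ^+ 2 + (u * s + w * c) ^+ 2.
  by transitivity ((u ^+ 2 + w ^+ 2) * (c ^+ 2 + s ^+ 2)); [rewrite h2 mulr1|ring].
lra.
Qed.

(** The Green sum is the difference of two values of the potential, at time 0 and after n steps, and
    both are at most [B 0] in modulus. *)
Lemma fourier_green_bound (p B : nat -> R) t J (k : R) : (forall j, 0 <= p j) ->
  (forall j, 0 <= B j) -> (forall j, B j <= B 0%N) -> 0 <= k <= 1 ->
  3 * delta * k <= (1 - delta) * (1 - charN nu t) ->
  (forall j, (j <= J)%N -> p j / delta + B j.+1 <= (1 + k) * B j) ->
  forall n, \sum_(i < n) vopn delta nu kappa i
    (fun j y => (j <= J)%:R * p j * cos (t * y%:~R)) 0 0 <= 2 * B 0%N.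
Proof.
move=> p0 B0 BB k01 hk hB n; have [d0 d1] := andP delta01.
have d01 : 0 <= delta <= 1 by apply/andP; split; exact: ltW.
have hD := denom_ge k01 hk; have [k0 k1] := andP k01.
have D0 : 0 < denom t by apply: lt_le_trans hD; rewrite mulr_gt0// exprn_gt0//; lra.
(* Truncated subtraction makes the coefficient 0 for every j > J, where the source vanishes. *)
pose c j := pot_coef p t (J.+1 - j) j.
pose Phi j (y : int) : R := (c j).1 * cos (t * y%:~R) - (c j).2 * sin (t * y%:~R).
have hc j : (c j).1 ^+ 2 + (c j).2 ^+ 2 <= B j ^+ 2.
  have [jJ|jJ] := leqP j J.+1.
    by apply: (pot_coef_bound p0 B0 k0 hD hB); rewrite subnK.
  by rewrite /c (_ : (J.+1 - j = 0)%N) ?expr0n /= ?addr0 ?sqr_ge0//; lia.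
have hPhi j y : `|Phi j y| <= B 0%N.
  by apply: le_trans (BB j); exact: cos_sin_bound.
have bP : bd2 Phi by exists (B 0%N).
rewrite (@potential_sum _ _ _ _ d01 n Phi _)//.
- have := @vopn_norm_le _ delta nu kappa d01 n _ _ hPhi 0%N 0.
  have := hPhi 0%N 0; rewrite !ler_norml => /andP[a1 a2] /andP[b1 b2]; lra.
- have [K hK] : bd (fun j => (j <= J)%:R * p j).
    exists (\sum_(i < J.+1) p i) => j; case: leqP => [jJ|_]; last first.
      by rewrite mul0r normr0 sumr_ge0.
    rewrite mul1r ger0_norm// (bigD1 (Ordinal (jJ : (j < J.+1)%N)))//= lerDl.
    exact: sumr_ge0.
  exists K => j y; rewrite normrM -[leRHS]mulr1 ler_pM//.
  by rewrite ler_norml cos_geN1 cos_le1.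
move=> j y; rewrite /vop /Phi ExB; [|by do ?apply: bdZ..].
rewrite !ExZ// Ex_cos_step Ex_sin_step.
have [jJ|jJ] := leqP j J; last first.
  have z1 : c j = (0, 0) by rewrite /c (_ : (J.+1 - j = 0)%N)//; lia.
  have z2 : c j.+1 = (0, 0) by rewrite /c (_ : (J.+1 - j.+1 = 0)%N)//; lia.
  by rewrite z1 z2 /=; ring.
have -> : c j = pot_coef p t (J.+1 - j.+1).+1 j by rewrite /c; congr pot_coef; lia.
rewrite /= -/(c j.+1) mul1r.
set u := (c j.+1).1; set w := (c j.+1).2.
set C := charC nu t; set S := sgk j * charS nu t.
set x := cos (t * y%:~R); set z := sin (t * y%:~R).
have -> : denom t = (1 - (1 - delta) * C) ^+ 2 + ((1 - delta) * S) ^+ 2.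
  by rewrite /denom /S !exprMn sgk_sqr mul1r.
have DE : (1 - (1 - delta) * C) ^+ 2 + ((1 - delta) * S) ^+ 2 != 0.
  suff <- : denom t = (1 - (1 - delta) * C) ^+ 2 + ((1 - delta) * S) ^+ 2 by rewrite gt_eqF.
  by rewrite /denom /S !exprMn sgk_sqr mul1r.
by field.
Qed.

End fourier_potential.

(** * Return probabilities of the simple random walk *)

Section simple_random_walk.
Context {R : realType}.

Fixpoint srw (j : nat) (x : int) : R :=
  if j is j'.+1 then (srw j' (x - 1) + srw j' (x + 1)) / 2 else (x == 0)%:R.

Lemma srw_ge0 j x : 0 <= srw j x.
Proof.
by elim: j x => [|j ih] x /=; rewrite ?ler0n// divr_ge0// addr_ge0.
Qed.

Lemma srw_le1 j x : srw j x <= 1.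
Proof.
elim: j x => [|j ih] x /=; first by case: eqP.
by have := ih (x - 1); have := ih (x + 1); lra.
Qed.

(** The value at 0 is the goal; all [x] enter because the recursion in [j] leaves the origin. *)
Lemma srw_binomial j x : srw j x =
  if (`|x| <= j)%N && ~~ odd (`|x| + j) then 'C(j, `|x + j%:Z|./2)%:R / 2 ^+ j else 0.
Proof.
elim: j x => [|j ih] x /=.
  rewrite addn0 leqn0 absz_eq0 addr0; case: eqP => [->|_] //=.
  by rewrite bin0 divr1.
rewrite !ih.
have [xj|xj] := leqP `|x|%N j.+1; last first.
  have -> : (absz (x - 1)%R <= j)%N = false by lia.
  have -> : (absz (x + 1)%R <= j)%N = false by lia.
  by rewrite /= addr0 mul0r.
have [xo|xe] := boolP (odd (`|x| + j.+1)); rewrite /=.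
  have -> : ~~ odd (absz (x - 1)%R + j) = false by lia.
  have -> : ~~ odd (absz (x + 1)%R + j) = false by lia.
  by rewrite !andbF addr0 mul0r.
have -> : ~~ odd (absz (x - 1)%R + j) by lia.
have -> : ~~ odd (absz (x + 1)%R + j) by lia.
rewrite !andbT exprS invfM.
have [->|xj1] := eqVneq x (j.+1%:Z).
  have -> : (absz (j.+1%:Z - 1)%R <= j)%N by lia.
  have -> : (absz (j.+1%:Z + 1)%R <= j)%N = false by lia.
  have -> : `|(j.+1%:Z - 1 + j%:Z)%R|./2 = j by lia.
  have -> : `|(j.+1%:Z + j.+1%:Z)%R|./2 = j.+1 by lia.
  by rewrite !binn addr0; field; rewrite expf_neq0.
have [->|xj2] := eqVneq x (- j.+1%:Z).
  have -> : (absz (- j.+1%:Z - 1)%R <= j)%N = false by lia.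
  have -> : (absz (- j.+1%:Z + 1)%R <= j)%N by lia.
  have -> : `|(- j.+1%:Z + 1 + j%:Z)%R|./2 = 0 by lia.
  have -> : `|(- j.+1%:Z + j.+1%:Z)%R|./2 = 0 by lia.
  by rewrite !bin0 add0r; field; rewrite expf_neq0.
have -> : (absz (x - 1)%R <= j)%N by lia.
have -> : (absz (x + 1)%R <= j)%N by lia.
have -> : `|(x + 1 + j%:Z)%R|./2 = (`|(x - 1 + j%:Z)%R|./2).+1 by lia.
have -> : `|(x + j.+1%:Z)%R|./2 = (`|(x - 1 + j%:Z)%R|./2).+1 by lia.
rewrite binS natrD; set a := 'C(_, _)%:R; set b := 'C(_, _)%:R.
by field; rewrite expf_neq0.
Qed.

Lemma srw0_odd j : odd j -> srw j 0 = 0.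
Proof.
by move=> oj; rewrite srw_binomial; case: ifP => // /andP[_]; rewrite add0n oj.
Qed.

Lemma srw0_even m : srw m.*2 0 = 'C(m.*2, m)%:R / 4 ^+ m.
Proof.
rewrite srw_binomial; case: ifP => [_|]; last by rewrite add0n odd_double.
rewrite add0r absz_nat doubleK.
by congr (_ / _); rewrite -mul2n exprM; congr (_ ^+ _); rewrite -natrX.
Qed.

Lemma srw0_rec m : srw m.+1.*2 0 = srw m.*2 0 * ((2 * m%:R + 1) / (2 * m%:R + 2)).
Proof.
rewrite !srw0_even.
have e : ('C(m.+1.*2, m.+1) * m.+1 = 2 * (2 * m + 1) * 'C(m.*2, m))%N.
  have e1 : ('C(m.+1.*2, m.+1) * m.+1 = m.+1.*2 * 'C(m.*2.+1, m))%N.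
    by rewrite mulnC -mul_bin_diag.
  have e2 : ('C(m.*2.+1, m) * m.+1 = m.*2.+1 * 'C(m.*2, m))%N.
    have := mul_bin_diag m.*2.+1 m; rewrite /= => ->.
    rewrite mulnC -(@bin_sub m.*2.+1 m.+1); last lia.
    by congr (_ * 'C(_, _))%N; lia.
  apply/eqP; rewrite -(eqn_pmul2r (ltn0Sn m)); apply/eqP.
  rewrite e1 -mulnA e2; lia.
have eR : ('C(m.+1.*2, m.+1)%:R * (m%:R + 1) = 2 * (2 * m%:R + 1) * 'C(m.*2, m)%:R :> R).
  have /(congr1 (fun n : nat => n%:R : R)) := e.
  by rewrite !natrM -natr1 natrD natrM.
have -> : 'C(m.+1.*2, m.+1)%:R = 2 * (2 * m%:R + 1) * 'C(m.*2, m)%:R / (m%:R + 1) :> R.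
  by rewrite -eR mulfK// natr1 pnatr_eq0.
rewrite exprS; field; rewrite expf_neq0//=; have : 0 <= m%:R :> R by [].
by move=> m0; apply/andP; split; rewrite gt_eqF//; lra.
Qed.

(** The left side does not increase with m, since (2 m + 1) (2 m + 3) <= (2 m + 2) ^ 2. *)
Lemma srw0_upper_sqr m : srw m.*2 0 ^+ 2 * (2 * m%:R + 1) <= 1.
Proof.
elim: m => [|m ih]; first by rewrite /= mulr0 add0r mulr1 expr1n.
rewrite srw0_rec -(natr1 m); set s := srw _ _ in ih *; set x := m%:R in ih *.
have x0 : 0 <= x by exact: ler0n.
have -> : (s * ((2 * x + 1) / (2 * x + 2))) ^+ 2 * (2 * (x + 1) + 1) =
  (s ^+ 2 * (2 * x + 1)) * ((2 * x + 1) * (2 * x + 3) / (2 * x + 2) ^+ 2).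
  by field; rewrite gt_eqF//; lra.
apply: mulr_ile1 => //.
- by rewrite mulr_ge0 ?sqr_ge0//; lra.
- by rewrite divr_ge0 ?mulr_ge0 ?sqr_ge0//; lra.
- rewrite ler_pdivrMr ?exprn_gt0//; [|lra].
  by rewrite mul1r expr2; lra.
Qed.

Lemma srw0_upper j : srw j 0 <= (Num.sqrt j.+1%:R)^-1.
Proof.
have [oj|ej] := boolP (odd j).
  by rewrite srw0_odd// invr_ge0 sqrtr_ge0.
have -> : j = j./2.*2 by rewrite even_halfK.
set m := j./2; rewrite -[leLHS]ger0_norm ?srw_ge0// -sqrtr_sqr -sqrtrV//.
apply: ler_wsqrtr; rewrite -[leRHS]mul1r ler_pdivlMr ?ltr0n//.
have -> : m.*2.+1%:R = 2 * m%:R + 1 :> R by rewrite -(natr1 m.*2) -mul2n natrM.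
exact: srw0_upper_sqr.
Qed.

(** Equality holds at m = 1, and the right side does not decrease because (2 m + 1) ^ 2 >= 4 m (m +
    1). *)
Lemma srw0_lower_sqr m : (0 < m)%N -> 1 <= srw m.*2 0 ^+ 2 * (4 * m%:R).
Proof.
elim: m => [//|[_ _|m /(_ isT) ih _]].
  by rewrite srw0_rec /= (_ : _ * _ = 1 :> R)//; field.
rewrite srw0_rec -(natr1 m.+1); set s := srw _ _ in ih *.
have x1 : 1 <= m.+1%:R :> R by rewrite ler1n.
set x := m.+1%:R in ih x1 *; apply: (le_trans ih).
have -> : (s * ((2 * x + 1) / (2 * x + 2))) ^+ 2 * (4 * (x + 1)) =
   s ^+ 2 * ((2 * x + 1) ^+ 2 / (x + 1)).
  by field; apply/andP; split; rewrite gt_eqF//; lra.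
rewrite ler_wpM2l ?sqr_ge0// ler_pdivlMr; last lra.
by rewrite expr2; lra.
Qed.

Lemma srw0_lower m : (0 < m)%N -> (Num.sqrt (2 * m.*2%:R))^-1 <= srw m.*2 0.
Proof.
move=> m0; rewrite -[leRHS]ger0_norm ?srw_ge0// -sqrtr_sqr -sqrtrV//.
apply: ler_wsqrtr; rewrite -[leLHS]mul1r ler_pdivrMr.
  have -> : 2 * m.*2%:R = 4 * m%:R :> R by rewrite -mul2n natrM; ring.
  exact: srw0_lower_sqr.
by rewrite mulr_gt0// ltr0n double_gt0.
Qed.

End simple_random_walk.

(** * Fejer kernel on the integers *)

Section fejer.
Context {R : realType}.

(** The double sum is |sum over k < L of e ^ (i theta k y)| ^ 2, hence nonnegative, and it equals L
    ^ 2 at y = 0. *)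
Lemma fejer_ge_indicator (L : nat) (theta : R) (y : int) : (0 < L)%N ->
  (y == 0)%:R <=
  (L%:R ^+ 2)^-1 * \sum_(k < L) \sum_(l < L) cos (theta * (k%:R - l%:R) * y%:~R).
Proof.
move=> L0; have L0' : (0 : R) < L%:R by rewrite ltr0n.
rewrite mulrC ler_pdivlMr ?exprn_gt0//.
have [->|y0] := eqVneq y 0; rewrite ?mul1r ?mul0r.
  under eq_bigr do under eq_bigr do rewrite mulr0z mulr0 cos0.
  under eq_bigr do rewrite sumr_const card_ord.
  by rewrite sumr_const card_ord -mulrnA expr2 -natrM.
have -> : \sum_(k < L) \sum_(l < L) cos (theta * (k%:R - l%:R) * y%:~R) =
  (\sum_(k < L) cos (theta * k%:R * y%:~R)) ^+ 2 +
  (\sum_(k < L) sin (theta * k%:R * y%:~R)) ^+ 2.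
  rewrite !expr2 !big_distrlr /= -big_split; apply: eq_bigr => k _ /=.
  rewrite -big_split; apply: eq_bigr => l _ /=.
  by rewrite -cosB; congr cos; ring.
by rewrite addr_ge0 ?sqr_ge0.
Qed.

(** Each distance to k is realized at most twice, once on either side. *)
Lemma sum_dist_le (L : nat) (V : nat -> R) k : (forall m, 0 <= V m) -> (k < L)%N ->
  \sum_(0 <= l < L) V (if (l <= k)%N then (k - l)%N else (l - k)%N) <=
  2 * \sum_(0 <= m < L) V m.
Proof.
move=> V0 kL; have mono n : (n <= L)%N -> \sum_(0 <= m < n) V m <= \sum_(0 <= m < L) V m.
  by move=> nL; rewrite (big_cat_nat (leq0n n) nL)/= lerDl sumr_ge0.
rewrite (big_cat_nat (leq0n k.+1) kL)/= mulr_natl mulr2n; apply: lerD.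
  rewrite big_nat_rev /= add0n.
  rewrite (_ : \sum_(0 <= i < k.+1) _ = \sum_(0 <= i < k.+1) V i); first exact: mono.
  rewrite !big_nat; apply: eq_bigr => i /andP[_ ik].
  by rewrite (_ : (k.+1 - i.+1 <= k)%N) ?subKn//; lia.
rewrite (_ : \sum_(k.+1 <= i < L) _ = \sum_(k.+1 <= i < L) V (i - k)%N); last first.
  by rewrite !big_nat; apply: eq_bigr => i /andP[ki _]; rewrite leqNgt ki.
rewrite -{1}(add0n k.+1) big_addn.
apply: (@le_trans _ _ (\sum_(0 <= i < L - k.+1) V i.+1)).
  by apply: ler_sum => i _; rewrite (_ : (i + k.+1 - k = i.+1)%N)//; lia.
apply: le_trans (mono (L - k.+1).+1 _); last lia.
by rewrite big_nat_recl//= lerDr.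
Qed.

End fejer.

(** * Summation over frequencies, scale by scale *)

Section green_upper_bound.
Context {R : realType}.
Variables (delta : R) (nu : probability int R) (kappa : int).
Hypothesis delta01 : 0 < delta < 1.
Hypothesis kappa1 : kappa = 1 \/ kappa = -1.

Local Notation T := (vopn delta nu kappa).

(* P (M_n = (0, 0)): see P_at_origin. *)
Definition ret n : R := T n (fun j y => srw j 0 * (y == 0)%:R) 0 0.

Lemma green_le_fourier (L J : nat) (theta : R) (V : nat -> R) : (0 < L)%N ->
  (forall m, 0 <= V m) ->
  (forall m, (m < L)%N -> \sum_(i < J.+1)
     T i (fun j y => (j <= J)%:R * srw j 0 * cos (theta * m%:R * y%:~R)) 0 0 <= V m) ->
  \sum_(i < J.+1) ret i <= 2 / L%:R * \sum_(0 <= m < L) V m.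
Proof.
move=> L0 V0 hV; have [d0 d1] := andP delta01.
have d01 : 0 <= delta <= 1 by apply/andP; split; exact: ltW.
pose F (m : nat) j (y : int) : R := (j <= J)%:R * srw j 0 * cos (theta * m%:R * y%:~R).
pose dist k l := if (l <= k)%N then (k - l)%N else (l - k)%N.
have bnd x j : `|(j <= J)%:R * srw j 0 * x| <= `|x| :> R.
  rewrite -[leRHS]mul1r normrM ler_pM// ger0_norm ?mulr_ge0 ?srw_ge0//.
  by apply: mulr_ile1; rewrite ?srw_ge0 ?srw_le1//; case: leqP.
have bF m : bd2 (F m).
  exists 1 => j y; apply: (le_trans (bnd _ _)).
  by rewrite ler_norml cos_geN1 cos_le1.
have distE k l (y : int) :
    cos (theta * (k%:R - l%:R) * y%:~R) = cos (theta * (dist k l)%:R * y%:~R).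
  rewrite /dist; case: leqP => kl; first by rewrite natrB.
  rewrite natrB; last exact: ltnW.
  by rewrite -cosN; congr cos; ring.
have gstep i : (i <= J)%N ->
    ret i <= (L%:R ^+ 2)^-1 * \sum_(k < L) \sum_(l < L) T i (F (dist k l)) 0 0.
  move=> iJ; rewrite /ret.
  (* From j = 0 the first J steps stay in j <= J, so the cutoff can be inserted for free. *)
  rewrite (@vopn_local _ _ _ _ i _
      (fun j (y : int) => (j <= J)%:R * srw j 0 * (y == 0)%:R) J)//; last first.
    by move=> j y ->; rewrite mul1r.
  pose G j y := (L%:R ^+ 2)^-1 * \sum_(k < L) \sum_(l < L) F (dist k l) j y.
  have bG2 : bd2 (fun j y => \sum_(k < L) \sum_(l < L) F (dist k l) j y).
    by apply: bd2_sum => k; exact: bd2_sum.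
  have bG : bd2 G.
    by case: bG2 => K hK; exists (`|(L%:R ^+ 2)^-1| * K) => j y; rewrite normrM ler_wpM2l.
  apply: (@le_trans _ _ (T i G 0 0)).
    apply: le_vopn => //.
      exists 1 => j y; apply: (le_trans (bnd _ _)).
      by case: eqP; rewrite ?normr1 ?normr0.
    move=> j y; rewrite /G /F.
    under [X in _ <= _ * X]eq_bigr do rewrite -mulr_sumr.
    rewrite -mulr_sumr mulrCA; apply: ler_wpM2l.
      by rewrite mulr_ge0 ?srw_ge0.
    under eq_bigr do under eq_bigr do rewrite -distE.
    exact: fejer_ge_indicator.
  rewrite /G vopnZ// vopn_sum//; last by move=> k; exact: bd2_sum.
  by under eq_bigr do rewrite vopn_sum//.
apply: (@le_trans _ _ (\sum_(i < J.+1) (L%:R ^+ 2)^-1 *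
    \sum_(k < L) \sum_(l < L) T i (F (dist k l)) 0 0)).
  by apply: ler_sum => i _; apply: gstep; rewrite -ltnS.
rewrite -mulr_sumr exchange_big /=.
under eq_bigr do rewrite exchange_big /=.
have L0' : (0 : R) < L%:R by rewrite ltr0n.
have -> : 2 / L%:R * \sum_(0 <= m < L) V m =
    (L%:R ^+ 2)^-1 * \sum_(k < L) (2 * \sum_(0 <= m < L) V m).
  by rewrite sumr_const card_ord -mulr_natl; field; rewrite gt_eqF.
rewrite ler_wpM2l ?invr_ge0 ?exprn_ge0//; apply: ler_sum => k _.
apply: le_trans (sum_dist_le V0 (ltn_ord k)).
rewrite big_mkord; apply: ler_sum => l _; apply: hV.
by rewrite /dist; have := ltn_ord k; have := ltn_ord l; case: ifP; lia.
Qed.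

(** 1 / sqrt (j + 1) <= 2 (sqrt (j + 1) - sqrt j). The truncation at s keeps the telescoping
    function nonnegative for all j. *)
Lemma sqrt_step (s : R) j : 0 < s -> j.+1%:R <= s ^+ 2 ->
  (Num.sqrt j.+1%:R)^-1 <=
  2 * (Num.max 0 (s - Num.sqrt j%:R) - Num.max 0 (s - Num.sqrt j.+1%:R)).
Proof.
move=> s0 js; set x := Num.sqrt j%:R; set y := Num.sqrt j.+1%:R.
have x0 : 0 <= x by exact: sqrtr_ge0.
have y0 : 0 < y by rewrite sqrtr_gt0.
have xx : x ^+ 2 = j%:R by rewrite sqr_sqrtr.
have yy : y ^+ 2 = j%:R + 1 by rewrite sqr_sqrtr// natr1.
have xy : x <= y by apply: ler_wsqrtr; rewrite ler_nat.
have ys : y <= s.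
  by rewrite -(ler_pXn2r (n := 2)) ?nnegrE ?(ltW y0) ?(ltW s0)// yy natr1.
rewrite !max_r; [|lra|lra].
have -> : 2 * (s - x - (s - y)) = 2 * (y - x) by ring.
have e : (y - x) * (y + x) = 1 by have := xx; have := yy; rewrite !expr2; lra.
rewrite -[leLHS]mul1r ler_pdivrMr//.
have : 0 <= (y - x) * (y - x) by rewrite mulr_ge0 ?subr_ge0.
lra.
Qed.

(** The source is of order 1 / sqrt (j + 1). As long as j + 1 <= s ^ 2 it is paid for by the
    decrease of the square-root part of the supersolution; beyond, it is at most 1 / s and is
    absorbed by the gain k times the constant part e. The first alternative on J says that the
    second regime never occurs, which allows k = 0, hence the frequency 0. *)
Lemma fourier_green_le (t s e k : R) (J : nat) : 0 < s -> 0 <= e -> 0 <= k <= 1 ->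
  3 * delta * k <= (1 - delta) * (1 - charN nu t) ->
  (J.+1%:R <= s ^+ 2 \/ (delta * s)^-1 <= k * e) -> forall n,
  \sum_(i < n) T i (fun j y => (j <= J)%:R * srw j 0 * cos (t * y%:~R)) 0 0
    <= 2 * (2 / delta * s + e).
Proof.
move=> s0 e0 k01 hk hJ n; have [d0 d1] := andP delta01; have [k0 k1] := andP k01.
pose B j := 2 / delta * Num.max 0 (s - Num.sqrt j%:R) + e.
have -> : 2 / delta * s + e = B 0%N.
  by rewrite /B sqrtr0 subr0 max_r// ltW.
have dd : 0 <= 2 / delta by rewrite divr_ge0// ltW.
have B0 j : 0 <= B j.
  by rewrite /B addr_ge0// mulr_ge0// le_max lexx.
apply: (@fourier_green_bound _ _ _ _ delta01 kappa1 (srw^~ 0) B t J k) => //.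
- by move=> j; exact: srw_ge0.
- move=> j; rewrite /B lerD2r ler_wpM2l//.
  rewrite ge_max; apply/andP; split; first by rewrite le_max lexx.
  by rewrite le_max; apply/orP; right; rewrite lerD2l lerN2 sqrtr0 sqrtr_ge0.
move=> j jJ; have pj : srw j 0 / delta <= (Num.sqrt j.+1%:R)^-1 / delta.
  by rewrite ler_wpM2r ?srw0_upper// invr_ge0 ltW.
have [js|js] := lerP j.+1%:R (s ^+ 2).
  have := sqrt_step s0 js; set u := Num.max _ _; set v := Num.max _ _ => h.
  have h2 : (Num.sqrt j.+1%:R)^-1 / delta <= 2 / delta * (u - v).
    have -> : 2 / delta * (u - v) = 2 * (u - v) / delta by ring.
    by rewrite ler_wpM2r ?invr_ge0 ?(ltW d0).
  have : 0 <= k * B j by rewrite mulr_ge0.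
  rewrite mulrDl mul1r /B -/u -/v; lra.
case: hJ => [hJ|hJ].
  have : j.+1%:R <= J.+1%:R :> R by rewrite ler_nat.
  lra.
have h1 : (Num.sqrt j.+1%:R)^-1 / delta <= k * e.
  apply: le_trans hJ; rewrite invfM mulrC ler_wpM2l ?invr_ge0 ?(ltW d0)//.
  rewrite lef_pV2 ?posrE ?sqrtr_gt0//.
  rewrite -[leLHS]ger0_norm ?(ltW s0)// -sqrtr_sqr; apply: ler_wsqrtr.
  exact: ltW.
have h2 : k * e <= k * B j.
  by rewrite ler_wpM2l// /B lerDr mulr_ge0// le_max lexx.
have h3 : B j.+1 <= B j.
  rewrite /B lerD2r ler_wpM2l// ge_max le_max lexx /= le_max lerD2l lerN2.
  by apply/orP; right; apply: ler_wsqrtr; rewrite ler_nat.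
rewrite mulrDl mul1r; lra.
Qed.

Lemma count_le (L : nat) (x : R) : 0 <= x ->
  \sum_(0 <= m < L) (m.+1%:R <= x :> R)%R%:R <= x.
Proof.
move=> x0; pose S n := \sum_(0 <= m < n) (m.+1%:R <= x :> R)%R%:R : R.
suff /(_ L)[] : forall n, S n <= n%:R /\ S n <= x by [].
move=> {L}; elim=> [|L [ih1 ih2]]; first by rewrite /S big_nil.
have SE : S L.+1 = S L + (L.+1%:R <= x :> R)%R%:R by rewrite /S big_nat_recr.
rewrite SE -(natr1 L); have [Lx|Lx] := lerP (L%:R + 1) x; rewrite /=; split; lra.
Qed.

Lemma last_scale (a : nat -> R) i0 I (x : R) : (forall i, 0 < a i) -> (i0 <= I)%N ->
  1 <= x <= a I / a i0 ->
  exists i, [/\ (i0 <= i <= I)%N, x <= a I / a i & (a I / a i.+1 <= x) || (i == I)].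
Proof.
move=> a0 iI /andP[x1 xi].
suff : forall k, (k <= I - i0)%N -> (exists i, [/\ (i0 <= i <= I)%N,
    x <= a I / a i & (a I / a i.+1 <= x) || (i == I)]) \/
    x <= a I / a (i0 + k)%N.
  move=> /(_ (I - i0)%N (leqnn _)) [//|h]; exists I; split; first by lia.
    by move: h; rewrite subnKC.
  by rewrite eqxx orbT.
elim=> [_|k ihk kI]; first by right; rewrite addn0.
have [//|h] := ihk (ltnW kI); first by left.
have [h2|h2] := lerP x (a I / a (i0 + k.+1)%N); first by right.
left; exists (i0 + k)%N; split=> //; first lia.
by rewrite -addnS (ltW h2).
Qed.

(** With a_i = A_(4 ^ i), a frequency between s0 / a_(i+1) and s0 / a_i has Green sum at most K 2 ^
    i. The frequencies are the multiples of s0 / a_I, of which at most a_I / a_i lie below s0 / a_i;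
    averaging over about a_I / a_(i0) of them gives a multiple of the sum of 2 ^ i / a_i. *)
Lemma green_upper (a : nat -> R) i0 (s0 c : R) : (forall i, 0 < a i) ->
  (forall i, a i <= a i.+1) -> 0 < s0 -> 0 < c ->
  (forall i t, (i0 <= i)%N -> s0 / a i.+1 <= t <= s0 / a i ->
     c / 4 ^+ i <= 1 - charN nu t) ->
  exists2 C : R, 0 <= C & forall I, (i0 <= I)%N ->
    \sum_(n < 4 ^ I) ret n <= C * \sum_(0 <= i < I.+1) 2 ^+ i / a i.
Proof.
move=> a0 ainc s00 c0 hc; have [d0 d1] := andP delta01.
(* At scale i the gain is k = c' / 4 ^ i: the second argument of the minimum is what [denom_ge] asks
   for, the first keeps k <= 1. *)
pose c' := Num.min 1 ((1 - delta) * c / (3 * delta)).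
have c'0 : 0 < c'.
  by rewrite lt_min ltr01 /= divr_gt0// mulr_gt0 ?subr_gt0.
have c'1 : c' <= 1 by rewrite ge_min lexx.
have c'c : 3 * delta * c' <= (1 - delta) * c.
  have : c' <= (1 - delta) * c / (3 * delta) by rewrite ge_min lexx orbT.
  by rewrite ler_pdivlMr ?mulr_gt0// mulrC.
have [K [K0 KE]] : exists K, 0 <= K /\ K = 2 * (2 / delta + (delta * c')^-1).
  by eexists; split; last by []; rewrite mulr_ge0// addr_ge0 ?divr_ge0 ?invr_ge0 ?mulr_ge0// ltW.
exists (2 * a i0 * (K + K)); first by rewrite !mulr_ge0 ?addr_ge0// ltW.
move=> I iI; have aI := a0 I; have ai0 := a0 i0.
pose L := (Num.truncn (a I / a i0)).+1.
pose theta := s0 / a I.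
have [Jn JE] : {J | (4 ^ I = J.+1)%N} by exists (4 ^ I).-1; rewrite prednK// expn_gt0.
have pow2 i : 2 ^+ i ^+ 2 = 4 ^+ i :> R.
  by rewrite -exprM mulnC exprM; congr (_ ^+ _); ring.
have p2 i : 0 < 2 ^+ i :> R by exact: exprn_gt0.
have p4 i : 0 < 4 ^+ i :> R by exact: exprn_gt0.
(* A sum over all scales with m <= a_I / a_i rather than the one scale that contains the frequency:
   it is larger, but summing it over m only requires counting. At m = 0 there is no gain, and the
   trivial bound at time 4 ^ I is used. *)
pose V m := if m is m'.+1 then
   \sum_(i0 <= i < I.+1) (K * 2 ^+ i) * (m'.+1%:R <= a I / a i :> R)%R%:R else K * 2 ^+ I.
have V0 m : 0 <= V m.
  case: m => [|m] /=; first by rewrite mulr_ge0// ltW.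
  by apply: sumr_ge0 => i _; rewrite !mulr_ge0 ?ler0n ?(ltW (p2 _)).
rewrite JE; apply: (@le_trans _ _ (2 / L%:R * \sum_(0 <= m < L) V m)).
  apply: (@green_le_fourier _ _ theta) => // -[_|m mL] /=.
    rewrite mulr0; apply: le_trans (@fourier_green_le 0 (2 ^+ I) 0 0 Jn _ _ _ _ _ _) _ => //.
    - by rewrite lexx ler01.
    - rewrite mulr0 mulr_ge0 ?subr_ge0 ?(ltW d1)// /charN /charC /charS.
      under eq_Ex do rewrite mul0r cos0.
      under [X in _ + X ^+ 2]eq_Ex do rewrite mul0r sin0.
      by rewrite !Ex_cst expr0n expr1n addr0.
    - by left; rewrite -JE pow2 natrX.
    rewrite addr0 KE mulrA ler_wpM2r ?(ltW (p2 I))// ler_wpM2l//.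
    by rewrite lerDl invr_ge0 mulr_ge0// ltW.
  have mle : m.+1%:R <= a I / a i0.
    have h : (Num.truncn (a I / a i0))%:R <= a I / a i0 by rewrite truncn_le divr_ge0// ltW.
    by apply: le_trans h; rewrite ler_nat.
  have [i [/andP[ii iI'] h1 h2]] : exists i, [/\ (i0 <= i <= I)%N,
      m.+1%:R <= a I / a i & (a I / a i.+1 <= m.+1%:R) || (i == I)].
    by apply: last_scale => //; rewrite ler1n mle.
  have tE : s0 / a i.+1 <= theta * m.+1%:R <= s0 / a i.
    apply/andP; split; rewrite /theta.
      case/orP: h2 => [h2|/eqP ->].
        have -> : s0 / a i.+1 = s0 / a I * (a I / a i.+1).
          by field; rewrite !gt_eqF.
        by rewrite ler_wpM2l// divr_ge0// ltW.
      apply: (@le_trans _ _ (s0 / a I)).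
        by rewrite ler_wpM2l ?(ltW s00)// lef_pV2 ?posrE.
      by rewrite ler_peMr ?ler1n// divr_ge0// ltW// a0.
    have -> : s0 / a i = s0 / a I * (a I / a i) by field; rewrite !gt_eqF.
    by rewrite ler_wpM2l// divr_ge0// ltW.
  have hk := hc i _ ii tE.
  apply: (@le_trans _ _ (K * 2 ^+ i)); last first.
    rewrite (big_cat_nat ii (leqW iI'))/= [X in _ <= _ + X]big_ltn ?ltnS//.
    have hb : (m.+1%:R <= a I / a i :> R)%R by [].
    rewrite hb mulr1; apply: (@le_trans _ _ (K * 2 ^+ i + \sum_(i.+1 <= j < I.+1)
       K * 2 ^+ j * (m.+1%:R <= a I / a j :> R)%R%:R)).
      by rewrite lerDl sumr_ge0// => j _; rewrite !mulr_ge0 ?ler0n ?(ltW (p2 _)).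
    by rewrite lerDr sumr_ge0// => j _; rewrite !mulr_ge0 ?ler0n ?(ltW (p2 _)).
  have -> : K * 2 ^+ i = 2 * (2 / delta * 2 ^+ i + 2 ^+ i / (delta * c')).
    by rewrite KE; field; rewrite !gt_eqF.
  (* With s = 2 ^ i and e = 2 ^ i / (delta c'), the product k e is exactly 1 / (delta s). *)
  apply: (@fourier_green_le _ (2 ^+ i) _ (c' / 4 ^+ i)) => //.
  - by rewrite divr_ge0 ?mulr_ge0// ltW.
  - rewrite divr_ge0 ?(ltW c'0) ?(ltW (p4 i))//= ler_pdivrMr// mul1r.
    by apply: (le_trans c'1); apply: exprn_ege1; rewrite ler1n.
  - rewrite mulrA ler_pdivrMr//; apply: (le_trans c'c).
    by rewrite -mulrA ler_wpM2l ?subr_ge0 ?(ltW d1)// -ler_pdivrMr.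
  right; rewrite le_eqVlt; apply/orP; left; apply/eqP.
  by rewrite -pow2; field; rewrite !gt_eqF.
have L1 : a I / a i0 <= L%:R.
  by rewrite /L ltW//; apply: truncnS_gt.
have L0 : (0 : R) < L%:R by rewrite ltr0n.
have iL : L%:R^-1 <= a i0 / a I.
  by rewrite -[leRHS]invrK invf_div lef_pV2 ?posrE ?divr_gt0.
have SV : \sum_(0 <= m < L) V m <= K * 2 ^+ I + K * a I * \sum_(i0 <= i < I.+1) 2 ^+ i / a i.
  rewrite big_nat_recl//= lerD2l exchange_big /= mulr_sumr; apply: ler_sum => i _.
  rewrite -mulr_sumr -mulrA -mulrA ler_wpM2l//.
  have -> : a I * (2 ^+ i / a i) = 2 ^+ i * (a I / a i) by ring.
  by rewrite ler_wpM2l ?(ltW (p2 i))//; apply: count_le; rewrite divr_ge0// ltW.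
set S := \sum_(0 <= i < I.+1) _.
have S1 : \sum_(i0 <= i < I.+1) 2 ^+ i / a i <= S.
  rewrite /S (big_cat_nat (leq0n i0) (leqW iI))/= lerDr sumr_ge0// => i _.
  by rewrite divr_ge0// ltW.
have S2 : 2 ^+ I / a I <= S.
  by rewrite /S big_nat_recr//= lerDr sumr_ge0// => i _; rewrite divr_ge0// ltW.
have SV2 : \sum_(0 <= m < L) V m <= (K + K) * (a I * S).
  apply: (le_trans SV); rewrite mulrDl; apply: lerD.
    by rewrite ler_wpM2l// mulrC -ler_pdivrMr.
  by rewrite -mulrA ler_wpM2l// ler_wpM2l// ltW.
apply: (@le_trans _ _ (2 * (a i0 / a I) * ((K + K) * (a I * S)))).
  by apply: ler_pM => //; [exact: sumr_ge0|rewrite ler_wpM2l].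
rewrite le_eqVlt; apply/orP; left; apply/eqP; field.
by rewrite gt_eqF.
Qed.

End green_upper_bound.

(** * Characteristic function of the vertical steps *)

Section trigonometric_bounds.
Context {R : realType}.

Lemma sin_MVT (x : R) : 0 <= x -> exists2 c, 0 <= c <= x & sin x = cos c * x.
Proof.
move=> x0.
have cs : {within `[0, x], continuous (@sin R)}.
  by apply: continuous_subspaceT => y; exact: continuous_sin.
have [c] := MVT_segment x0 (fun y _ => is_derive_sin y) cs.
by rewrite in_itv /= => cx; rewrite sin0 !subr0 => ->; exists c.
Qed.

Lemma sin_le_id (x : R) : 0 <= x -> sin x <= x.
Proof.
by move=> x0; have [c _ ->] := sin_MVT x0; rewrite ler_piMl// cos_le1.
Qed.

Lemma one_minus_cos (x : R) : 1 - cos x = 2 * sin (x / 2) ^+ 2.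
Proof.
have e : x = (x / 2) *+ 2 by rewrite mulr2n; lra.
by rewrite {1}e cos_mulr2n sin2cos2; ring.
Qed.

Lemma one_minus_cos_le (x : R) : 1 - cos x <= x ^+ 2 / 2.
Proof.
rewrite -cos_norm -(real_normK (num_real x)).
move: (normr_ge0 x); set y := `|x| => y0; rewrite one_minus_cos.
have y20 : 0 <= y / 2 by lra.
have h1 := sin_le_id y20; have [c /andP[c0 cy] e] := sin_MVT y20.
suff h : sin (y / 2) ^+ 2 <= (y / 2) ^+ 2 by rewrite exprMn in h; lra.
rewrite e exprMn; rewrite ler_piMl ?sqr_ge0//.
Qed.

(** On [0, 1/2] the cosine is at least 7/8, so 2 sin (x / 2) ^ 2 >= (49/128) x ^ 2. *)
Lemma one_minus_cos_ge (x : R) : `|x| <= 1 -> x ^+ 2 / 3 <= 1 - cos x.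
Proof.
rewrite -cos_norm -(real_normK (num_real x)).
move: (normr_ge0 x); set y := `|x| => y0 y1; rewrite one_minus_cos.
have y20 : 0 <= y / 2 by lra.
have [c /andP[c0 cy] ->] := sin_MVT y20.
have hc := one_minus_cos_le c.
have c2 : c ^+ 2 <= 1 / 4.
  have -> : 1 / 4 = (1 / 2) ^+ 2 :> R by lra.
  by rewrite ler_pXn2r ?nnegrE//; lra.
have cc : 49 / 64 <= cos c ^+ 2.
  have -> : 49 / 64 = (7 / 8) ^+ 2 :> R by lra.
  by rewrite ler_pXn2r ?nnegrE//; lra.
rewrite !exprMn; have := sqr_ge0 y => yy.
have : 0 <= y ^+ 2 * (cos c ^+ 2 - 49 / 64) by rewrite mulr_ge0// subr_ge0.
lra.
Qed.

End trigonometric_bounds.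

(** * Tails, and differences of independent sums *)

Section tails.
Context {R : realType}.

Lemma measurable_exceeds d (T : measurableType d) (f : T -> R) (K : R) :
  measurable_fun setT f -> measurable_fun setT (fun x => (K < `|f x|)%R%:R : R).
Proof.
move=> mf; have -> : (fun x => (K < `|f x|)%R%:R : R) = \1_[set x | K < `|f x|].
  by apply/funext => x; rewrite indicE mem_setE.
apply: measurable_indic; rewrite -[X in measurable X]setTI.
rewrite (_ : [set x | _] = (fun x => `|f x|) @^-1` `]K, +oo[%classic); last first.
  by apply/seteqP; split => x /=; rewrite in_itv /= andbT.
have mnf : measurable_fun setT (fun x => `|f x|) by exact: measurableT_comp.
by apply: mnf => //; exact: measurable_itv.
Qed.

Lemma Ex_tail_small d (T : measurableType d) (mu : probability T R) (f : T -> R) (eps : R) :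
  measurable_fun setT f -> 0 < eps ->
  exists2 K : R, 0 < K & Ex mu (fun x => (K < `|f x|)%R%:R) <= eps.
Proof.
move=> mf e0; pose F n x : R := (n%:R < `|f x|)%R%:R.
have mF n : measurable_fun setT (F n) by exact: measurable_exceeds.
have [_ _ h] : [/\ mu.-integrable setT (EFin \o (fun _ : T => 0 : R)),
   [sequence (\int[mu]_x `|(F n x)%:E - 0|)%E]_n @ \oo --> 0%E &
   [sequence (\int[mu]_x (F n x)%:E)%E]_n @ \oo --> (\int[mu]_x (0%:E : \bar R))%E].
  apply: (@dominated_convergence _ _ _ mu setT measurableT (fun n x => (F n x)%:E)
     (fun _ => 0%E) (fun _ => 1%E)).
  - by move=> n; exact/measurable_EFinP.
  - exact: measurable_cst.
  - apply: aeW => x _; apply: cvg_near_cst.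
    apply: filterS (nbhs_infty_ger `|f x|) => n fn.
    by rewrite /F ltNge fn.
  - apply: (@bd_integrable _ _ _ mu (cst 1)); [exact: measurable_cst|exact: bd_cst].
  - by apply: aeW => x n _; rewrite /F /= lee_fin; case: ltP; rewrite ?normr1 ?normr0.
rewrite integral0 in h.
have /fine_cvgP[_ h2] := h.
have /cvgrPdist_le /(_ eps e0) [N _ hN] := h2.
exists N.+1%:R => //.
have := hN N.+1 (leqnSn N); rewrite sub0r normrN /= => hh.
apply: le_trans hh; rewrite -/(Ex mu (F N.+1)).
exact: ler_norm.
Qed.

End tails.

Section differences.
Context {R : realType}.
Variable nu : probability int R.
Implicit Types f g : int -> R.

(* Expectation of f (S - S'), with S and S' independent sums of m and n
   independent variables of law nu. *)
Definition Dif m n f : R :=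
  Ex (convolution_pow nu m) (fun x => Ex (convolution_pow nu n) (fun y => f (x - y))).

Lemma Dif_norm_le m n f (K : R) : (forall x, `|f x| <= K) -> `|Dif m n f| <= K.
Proof. by move=> hK; apply: Ex_norm_le => x; apply: Ex_norm_le => y; exact: hK. Qed.

Lemma bd_Dif_inner n f : bd f ->
  bd (fun x => Ex (convolution_pow nu n) (fun y => f (x - y))).
Proof. by case=> K hK; apply: bd_Ex => x y; exact: hK. Qed.

Lemma le_Dif m n f g : bd f -> bd g -> (forall x, f x <= g x) -> Dif m n f <= Dif m n g.
Proof.
move=> bf bg fg; apply: le_Ex; [exact: bd_Dif_inner..|move=> x].
by apply: le_Ex => //; exact: bd_comp.
Qed.

Lemma Dif_cst m n (c : R) : Dif m n (fun=> c) = c.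
Proof. by rewrite /Dif; under eq_Ex do rewrite Ex_cst; rewrite Ex_cst. Qed.

Lemma DifD m n f g : bd f -> bd g ->
  Dif m n (fun x => f x + g x) = Dif m n f + Dif m n g.
Proof.
move=> bf bg; rewrite /Dif -ExD; [|exact: bd_Dif_inner..].
by apply: eq_Ex => x; rewrite ExD//; exact: bd_comp.
Qed.

Lemma DifZ m n (c : R) f : bd f -> Dif m n (fun x => c * f x) = c * Dif m n f.
Proof.
move=> bf; rewrite /Dif -ExZ; last exact: bd_Dif_inner.
by apply: eq_Ex => x; rewrite ExZ//; exact: bd_comp.
Qed.

Lemma Dif_ge0 m n f : (forall x, 0 <= f x) -> 0 <= Dif m n f.
Proof. by move=> f0; apply: Ex_ge0 => x; exact: Ex_ge0. Qed.

Lemma Dif_add a b c e f : bd f ->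
  Dif (a + b) (c + e) f = Dif a c (fun u => Dif b e (fun v => f (u + v))).
Proof.
case=> K hK; rewrite /Dif Ex_powD; last by apply: bd_Ex => x y; exact: hK.
apply: eq_Ex => x; rewrite [in RHS](@Ex_swap _ _ _ _ K); last first.
  by move=> y x'; apply: Ex_norm_le => y'; exact: hK.
apply: eq_Ex => x'; rewrite Ex_powD; last by exists K => y; exact: hK.
by apply: eq_Ex => y; apply: eq_Ex => y'; congr f; ring.
Qed.

Lemma Dif0 f : Dif 0 0 f = f 0.
Proof. by rewrite /Dif !Ex_pow0 subr0. Qed.

Lemma charCS_pow m t :
  charC (convolution_pow nu m.+1) t =
    charC (convolution_pow nu m) t * charC nu t - charS (convolution_pow nu m) t * charS nu t /\
  charS (convolution_pow nu m.+1) t =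
    charS (convolution_pow nu m) t * charC nu t + charC (convolution_pow nu m) t * charS nu t.
Proof.
rewrite /charC /charS !Ex_powS//; split.
  transitivity (Ex (convolution_pow nu m) (fun x =>
    charC nu t * cos (t * x%:~R) - charS nu t * sin (t * x%:~R))).
    apply: eq_Ex => x; have := @Ex_cos_step R nu 1 (or_introl erefl) t 0 x.
    by under eq_Ex do rewrite expr0 mul1r; move=> ->; rewrite expr0; ring.
  by rewrite ExB ?ExZ//; [rewrite /charC /charS; ring|by apply: bdZ..].
transitivity (Ex (convolution_pow nu m) (fun x =>
    charC nu t * sin (t * x%:~R) + charS nu t * cos (t * x%:~R))).
  apply: eq_Ex => x; have := @Ex_sin_step R nu 1 (or_introl erefl) t 0 x.
  by under eq_Ex do rewrite expr0 mul1r; move=> ->; rewrite expr0; ring.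
by rewrite ExD ?ExZ//; [rewrite /charC /charS; ring|by apply: bdZ..].
Qed.

Lemma charN_pow m t : charN (convolution_pow nu m) t = charN nu t ^+ m.
Proof.
elim: m => [|m ih].
  by rewrite /charN /charC /charS !Ex_pow0 mulr0 cos0 sin0 expr1n expr0n addr0.
rewrite exprSr -ih /charN; have [-> ->] := charCS_pow m t; ring.
Qed.

(** S_m - S'_m has the real characteristic function |phi| ^ (2 m): tails of differences control the
    modulus of phi, and conversely. *)
Lemma Dif_cos m t : Dif m m (fun z => cos (t * z%:~R)) = charN nu t ^+ m.
Proof.
rewrite -charN_pow /Dif; set mu := convolution_pow nu m.
transitivity (Ex mu (fun x => charC mu t * cos (t * x%:~R) + charS mu t * sin (t * x%:~R))).
  apply: eq_Ex => x; rewrite /charC /charS mulrC [X in _ + X]mulrC -!ExZ// -ExD//; [|by apply: bdZ..].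
  by apply: eq_Ex => y; rewrite intrB mulrBr cosB.
by rewrite ExD ?ExZ//; apply: bdZ.
Qed.

Definition far (lam : R) (z : int) : R := (lam < `|z%:~R : R|)%R%:R.

Lemma far_ge0 lam z : 0 <= far lam z. Proof. exact: ler0n. Qed.

Lemma bd_far lam : bd (far lam). Proof. exact: bd_indic. Qed.

Lemma far_mono lam lam' z : lam <= lam' -> far lam' z <= far lam z.
Proof.
move=> ll; rewrite /far; case: ltP => h; last by rewrite ler0n.
by rewrite (le_lt_trans ll h).
Qed.

Lemma far_add lam mu x y : far (lam + mu) (x + y) <= far lam x + far mu y.
Proof.
rewrite /far intrD; case: (ltP (lam + mu)) => h /=; last by rewrite addr_ge0 ?ler0n.
have : lam < `|x%:~R : R| \/ mu < `|y%:~R : R|.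
  have [h1|h1] := ltP lam `|x%:~R : R|; first by left.
  by right; have := ler_normD (x%:~R : R) y%:~R; lra.
by case=> ->; rewrite ?lerDl ?lerDr ler0n.
Qed.

Lemma far_opp lam z : far lam (- z) = far lam z.
Proof. by rewrite /far rmorphN normrN. Qed.

Lemma far_Dif_le m n lam mu : Dif m n (far (lam + mu)) <=
  Ex (convolution_pow nu m) (far lam) + Ex (convolution_pow nu n) (far mu).
Proof.
rewrite /Dif; apply: (@le_trans _ _ (Ex (convolution_pow nu m) (fun x =>
    far lam x + Ex (convolution_pow nu n) (far mu)))).
  apply: le_Ex; [exact/bd_Dif_inner/bd_far|by apply: bdD => //; exact: bd_far|move=> x].
  rewrite -[X in _ <= X + _](Ex_cst (convolution_pow nu n)) -ExD//; last exact: bd_far.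
  apply: le_Ex => //.
  - exact/bd_comp/bd_far.
  - by apply: bdD => //; exact: bd_far.
  - by move=> y; rewrite -(far_opp mu y); exact: far_add.
by rewrite ExD ?Ex_cst//; exact: bd_far.
Qed.

(** Union bound over two independent blocks: a sum beyond lam + mu has one block beyond its own
    threshold. *)
Lemma far_Dif_add a b c e lam mu : Dif (a + b) (c + e) (far (lam + mu)) <=
  Dif a c (far lam) + Dif b e (far mu).
Proof.
rewrite Dif_add; last exact: bd_far.
apply: (@le_trans _ _ (Dif a c (fun u => far lam u + Dif b e (far mu)))).
  apply: le_Dif.
  - by exists 1 => x; apply: Dif_norm_le => y; rewrite ger0_norm ?far_ge0// /far; case: ltP.
  - by apply: bdD => //; exact: bd_far.
  - move=> u; rewrite -[X in _ <= X + _](Dif_cst b e) -DifD//; last exact: bd_far.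
    apply: le_Dif; [exact/bd_comp/bd_far|by apply: bdD => //; exact: bd_far|].
    by move=> v; exact: far_add.
by rewrite DifD// ?Dif_cst//; exact: bd_far.
Qed.

Lemma far_Dif_mul k m n lam :
  Dif (k * m) (k * n) (far (k%:R * lam)) <= k%:R * Dif m n (far lam).
Proof.
elim: k => [|k ih].
  by rewrite !mul0n Dif0 mul0r mul0r /far normr0 ltxx.
rewrite !mulSn -natr1 !mulrDl !mul1r [X in far X]addrC [leRHS]addrC.
by apply: (le_trans (far_Dif_add _ _ _ _ _ _)); rewrite lerD2l.
Qed.

Lemma Ex_far_small m (eps : R) : 0 < eps ->
  exists2 K, 0 < K & Ex (convolution_pow nu m) (far K) <= eps.
Proof.
by move=> e0; exact: (@Ex_tail_small R _ int (convolution_pow nu m) (fun z => z%:~R) eps).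
Qed.

Lemma Dif_far_small m (eps : R) : 0 < eps ->
  exists2 K, 0 < K & Dif m m (far K) <= eps.
Proof.
move=> e0; have e2 : 0 < eps / 2 by lra.
have [K K0 hK] := Ex_far_small m e2; exists (K + K); first lra.
by apply: (le_trans (far_Dif_le _ _ _ _)); lra.
Qed.

End differences.

(** * Growth of the normalization and decay of the characteristic function *)

Section characteristic_function_estimates.
Context {R : realType}.
Variable nu : probability int R.

Lemma far_half : far 0 = far (1 / 2) :> (int -> R).
Proof.
apply/funext => z; rewrite /far; have [->|z0] := eqVneq z 0.
  by rewrite normr0 ltxx ltNge divr_ge0.
rewrite normr_gt0 intr_eq0 z0 -intr_norm.
have : 1 <= `|z| by lia.
by rewrite -(ler_int R) => h; rewrite (_ : (1 / 2 < `|z|%:~R :> R)%R)//; lra.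
Qed.

Lemma charN_le1 t : charN nu t <= 1.
Proof.
rewrite -[charN nu t]expr1 -Dif_cos -[leRHS](Dif_cst nu 1 1).
by apply: le_Dif => // x; exact: cos_le1.
Qed.

Lemma one_minus_charN_pow m t :
  1 - charN nu t ^+ m = Dif nu m m (fun z => 1 - cos (t * z%:~R)).
Proof.
have -> : (fun z : int => 1 - cos (t * z%:~R)) = (fun z => 1 + -1 * cos (t * z%:~R)).
  by apply/funext => z; rewrite mulN1r.
by rewrite DifD ?DifZ ?Dif_cst ?Dif_cos ?mulN1r//; exact: bdZ.
Qed.

Lemma one_minus_charN_pow_le m t lam : 0 <= lam ->
  1 - charN nu t ^+ m <= 2 * Dif nu m m (far lam) + (t * lam) ^+ 2 / 2.
Proof.
move=> l0; rewrite one_minus_charN_pow -[X in _ + X](Dif_cst nu m m).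
have bf := @bd_far R lam.
rewrite -DifZ// -DifD//; last exact: bdZ.
apply: le_Dif => [||x]; [exact: bdB|by apply: bdD => //; exact: bdZ|].
rewrite /far; case: ltP => h; rewrite ?mulr1.
  by have := cos_geN1 (t * x%:~R); have := sqr_ge0 (t * lam); lra.
apply: (le_trans (one_minus_cos_le _)); rewrite mulr0 add0r.
rewrite ler_pM2r ?invr_gt0// !exprMn ler_wpM2l ?sqr_ge0//.
by rewrite -[leLHS]real_normK ?num_real// ler_pXn2r ?nnegrE.
Qed.

(** On mu < |z| <= lam one has |t z| <= 1, where 1 - cos (t z) >= (t mu) ^ 2 / 3; elsewhere 1 - cos
    is merely nonnegative. *)
Lemma one_minus_charN_pow_ge m t lam mu : 0 <= mu <= lam -> `|t| * lam <= 1 ->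
  (t * mu) ^+ 2 / 3 * (Dif nu m m (far mu) - Dif nu m m (far lam)) <=
  1 - charN nu t ^+ m.
Proof.
move=> /andP[m0 ml] tl; rewrite one_minus_charN_pow.
have bl := @bd_far R lam; have bm := @bd_far R mu.
have -> : Dif nu m m (far mu) - Dif nu m m (far lam) =
    Dif nu m m (fun z => far mu z + -1 * far lam z).
  by rewrite DifD// ?DifZ ?mulN1r//; exact: bdZ.
rewrite -DifZ; last by apply: bdD => //; exact: bdZ.
apply: le_Dif => [||x]; [by apply/bdZ/bdD => //; exact: bdZ|exact: bdB|].
have := cos_le1 (t * x%:~R); rewrite /far; case: (ltP mu) => h1; last first.
  by rewrite ltNge (le_trans h1 ml)/= => h; rewrite mulr0 addr0 mulr0 subr_ge0.
case: ltP => h2 h; first by rewrite mulN1r subrr mulr0 subr_ge0.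
rewrite mulr0 addr0 mulr1; apply: le_trans (one_minus_cos_ge _).
  rewrite ler_pM2r ?invr_gt0// !exprMn ler_wpM2l ?sqr_ge0//.
  by rewrite -[leRHS]real_normK ?num_real// ler_pXn2r ?nnegrE// ltW.
by rewrite normrM (le_trans _ tl)// ler_wpM2l.
Qed.

Lemma bernoulli_sub (x : R) n : 0 <= x <= 1 -> 1 - x ^+ n <= n%:R * (1 - x).
Proof.
move=> /andP[x0 x1]; elim: n => [|n ih]; first by rewrite expr0 mul0r subrr.
rewrite exprS -natr1.
have : (1 - x) * x ^+ n <= 1 - x by rewrite ler_piMr ?subr_ge0// exprn_ile1.
lra.
Qed.

Lemma bernoulli_inv (x : R) n : 0 <= x <= 1 -> x ^+ n * (1 + n%:R * (1 - x)) <= 1.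
Proof.
move=> /andP[x0 x1]; elim: n => [|n ih]; first by rewrite expr0 mul0r addr0 mulr1.
rewrite exprS -natr1.
have : 0 <= x ^+ n * (1 - x) * ((n%:R + 1) * (1 - x)).
  by rewrite !mulr_ge0 ?subr_ge0 ?exprn_ge0// addr_ge0.
lra.
Qed.

Lemma bernoulli_half (x : R) n : 0 <= x <= 1 -> 1 - x ^+ n <= 1 / 2 -> n%:R * (1 - x) <= 1.
Proof.
move=> x01 h; have := bernoulli_inv n x01; have [x0 x1] := andP x01.
have : 0 <= n%:R * (1 - x) by rewrite mulr_ge0// subr_ge0.
set u := n%:R * _ => u0.
have : (1 / 2) * (1 + u) <= x ^+ n * (1 + u) by rewrite ler_wpM2r; lra.
lra.
Qed.

Variable A : R^nat.
Hypothesis A_gt0 : forall n, (0 < n)%N -> 0 < A n.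
Hypothesis A_incr : forall m n, (0 < m)%N -> (m <= n)%N -> A m <= A n.

(** Together with [difference_spread] this says that A_n is the exact order of S_n - S'_n. Both
    cases (a) and (b) provide the two properties, and the upper bound of the Green sum rests on them
    alone. *)
Definition difference_tight := forall eps : R, 0 < eps -> exists2 K : R, 0 < K &
  exists n0, forall n, (n0 <= n)%N -> Dif nu n n (far (K * A n)) <= eps.

Definition difference_spread := exists2 a : R, 0 < a & exists2 eta : R, 0 < eta &
  exists n0, forall n, (n0 <= n)%N -> eta <= Dif nu n n (far (a * A n)).

Hypothesis hT : difference_tight.
Hypothesis hN : difference_spread.

Lemma far_Dif_mono m n lam mu : lam <= mu -> Dif nu m n (far mu) <= Dif nu m n (far lam).
Proof. by move=> lm; apply: le_Dif => [||x]; [exact: bd_far..|exact: far_mono]. Qed.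

(** If A_(4 n) were much larger than A_n, a difference of sums of length 4 n, cut into four blocks
    of length n that are tight at scale A_n, could not spread at scale A_(4 n). *)
Lemma doubling : exists2 C : R, 0 < C &
  exists n0, forall n, (n0 <= n)%N -> A (4 * n)%N <= C * A n.
Proof.
have [a a0 [eta eta0 [n1 h1]]] := hN.
have e8 : 0 < eta / 8 by lra.
(* Four blocks with tail eta / 8 each give eta / 2 < eta. *)
have [K K0 [n2 h2]] := hT e8.
exists (4 * K / a); first by rewrite divr_gt0// mulr_gt0.
exists (n1 + n2).+1 => n nn.
have n0 : (0 < n)%N by exact: leq_ltn_trans nn.
have n1n : (n1 <= 4 * n)%N by rewrite (leq_trans _ (leq_pmull n _))// (leq_trans _ (ltnW nn))// leq_addr.
have n2n : (n2 <= n)%N by rewrite (leq_trans _ (ltnW nn))// leq_addl.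
rewrite leNgt; apply/negP => h.
have hh : 4 * (K * A n) <= a * A (4 * n)%N.
  have -> : 4 * (K * A n) = a * (4 * K / a * A n) by field; rewrite gt_eqF.
  by rewrite ler_wpM2l ?(ltW a0)// ltW.
suff : eta <= 4 * (eta / 8) by lra.
apply: le_trans (h1 _ n1n) _; apply: le_trans (far_Dif_mono _ _ hh) _.
by apply: le_trans (far_Dif_mul _ _ _ _ _) _; rewrite ler_wpM2l// h2.
Qed.

Lemma charN_scale_lower : exists2 s0 : R, 0 < s0 & exists2 c : R, 0 < c &
  exists n0, forall n t, (n0 <= n)%N -> 0 <= t <= s0 / A n ->
    c * (t * A n) ^+ 2 <= 1 - charN nu t ^+ n.
Proof.
have [a a0 [eta eta0 [n1 h1]]] := hN.
have e2 : 0 < eta / 2 by lra.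
have [K' K'0 [n2 h2]] := hT e2.
pose K := Num.max K' a.
have K0 : 0 < K by rewrite lt_max K'0.
exists K^-1; first by rewrite invr_gt0.
exists (a ^+ 2 / 3 * (eta / 2)); first by rewrite mulr_gt0 ?divr_gt0 ?exprn_gt0.
exists (n1 + n2).+1 => n t nn /andP[t0 tK].
have n0 : (0 < n)%N by exact: leq_ltn_trans nn.
have n1n : (n1 <= n)%N by rewrite (leq_trans _ (ltnW nn))// leq_addr.
have n2n : (n2 <= n)%N by rewrite (leq_trans _ (ltnW nn))// leq_addl.
have An := A_gt0 n0.
apply: le_trans (@one_minus_charN_pow_ge n t (K * A n) (a * A n) _ _); first last.
- by rewrite ger0_norm// mulrCA -ler_pdivlMl// mulr1 -ler_pdivlMr.
- by rewrite mulr_ge0 ?(ltW a0) ?(ltW An)//= ler_wpM2r ?(ltW An)// le_max lexx orbT.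
have -> : a ^+ 2 / 3 * (eta / 2) * (t * A n) ^+ 2 =
  (t * (a * A n)) ^+ 2 / 3 * (eta / 2) by rewrite !exprMn; ring.
rewrite ler_wpM2l ?divr_ge0 ?sqr_ge0//.
have KK : K' * A n <= K * A n by rewrite ler_wpM2r ?(ltW An)// le_max lexx.
have -> : eta / 2 = eta - eta / 2 by lra.
by apply: lerB; [exact: h1|apply: le_trans (far_Dif_mono n n KK) (h2 _ _)].
Qed.

(** Bernoulli turns the bound on 1 - |phi| ^ (2 n) into one on n (1 - |phi| ^ 2), and [doubling]
    keeps t A_n away from 0 on the whole range down to s0 / A_(4 n). These ranges, for n = 4 ^ i,
    leave no gap between consecutive scales. *)
Lemma charN_lower : exists2 s0 : R, 0 < s0 & exists2 c : R, 0 < c &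
  exists n0, forall n t, (n0 <= n)%N -> s0 / A (4 * n)%N <= t <= s0 / A n ->
    c / n%:R <= 1 - charN nu t.
Proof.
have [s0 s00 [c c0 [n1 h1]]] := charN_scale_lower.
have [C C0 [n2 h2]] := doubling.
exists s0 => //; exists (c * (s0 / C) ^+ 2).
  by rewrite mulr_gt0// exprn_gt0// divr_gt0.
exists (n1 + n2).+1 => n t nn /andP[t1 t2].
have n0 : (0 < n)%N by exact: leq_ltn_trans nn.
have n1n : (n1 <= n)%N by rewrite (leq_trans _ (ltnW nn))// leq_addr.
have n2n : (n2 <= n)%N by rewrite (leq_trans _ (ltnW nn))// leq_addl.
have An := A_gt0 n0.
have A4n : 0 < A (4 * n)%N by apply: A_gt0; rewrite muln_gt0.
have t0 : 0 <= t by apply: le_trans t1; rewrite divr_ge0// ltW.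
rewrite ler_pdivrMr ?ltr0n// mulrC [leRHS]mulrC.
apply: le_trans (bernoulli_sub _ _); last by rewrite charN_ge0 charN_le1.
apply: le_trans (h1 n t n1n _); last by rewrite t0.
rewrite mulrC ler_wpM2l ?(ltW c0)//.
have h : s0 / C <= t * A n.
  rewrite ler_pdivrMr// -mulrA [A n * C]mulrC; apply: (@le_trans _ _ (t * A (4 * n)%N)).
    by rewrite -ler_pdivrMr.
  by rewrite ler_wpM2l// h2.
by rewrite ler_pXn2r ?nnegrE ?(divr_ge0 (ltW s00) (ltW C0)) ?(mulr_ge0 t0 (ltW An)).
Qed.

Lemma spread_one : 0 < Dif nu 1 1 (far 0).
Proof.
have [a a0 [eta eta0 [n1 h1]]] := hN.
rewrite lt_neqAle Dif_ge0 ?andbT; last by move=> x; exact: far_ge0.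
apply/eqP => e.
have h0 : 0 <= a * A n1.+1 by rewrite mulr_ge0 ?(ltW a0)// ltW// A_gt0.
suff : eta <= n1.+1%:R * 0 by rewrite mulr0 leNgt eta0.
apply: le_trans (h1 n1.+1 (leqnSn _)) _; apply: le_trans (far_Dif_mono _ _ h0) _.
have := far_Dif_mul nu n1.+1 1 1 0; rewrite -e mulr0 muln1; exact.
Qed.

(** A nondegenerate law has 1 - |phi t| ^ 2 >= q t ^ 2 near 0, while tightness gives n (1 - |phi t|
    ^ 2) <= 1 for some t of order 1 / A_n. *)
Lemma diffusive_growth : exists2 c : R, 0 < c &
  exists n0, forall n, (n0 <= n)%N -> c * n%:R <= A n ^+ 2.
Proof.
have [q [q0 hb]] : exists q : R, 0 < q /\ exists2 l : R, 0 < l &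
    forall t, `|t| * l <= 1 -> q * t ^+ 2 <= 1 - charN nu t.
  have q0 := spread_one; have [q qE] : exists q, q = Dif nu 1 1 (far 0) by exists (Dif nu 1 1 (far 0)).
  rewrite -qE in q0; have q2 : 0 < q / 2 by lra.
  have ml (l : R) : 0 < l -> 0 <= (1 / 2 : R) <= l + 1.
    by move=> l0; apply/andP; split; lra.
  have [l l0 hl] := Dif_far_small nu 1 q2.
  exists (q / 24); split; first lra.
  exists (l + 1) => [|t tl]; first by rewrite addr_gt0.
  rewrite -[charN nu t]expr1; apply: le_trans (one_minus_charN_pow_ge 1 (ml _ l0) tl).
  have -> : q / 24 * t ^+ 2 = (t * (1 / 2)) ^+ 2 / 3 * (q - q / 2) by field.
  rewrite ler_wpM2l ?divr_ge0 ?sqr_ge0// -far_half -qE lerD2l lerN2.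
  by apply: le_trans hl; apply: far_Dif_mono; rewrite lerDl.
have [l l0 {}hb] := hb.
have e8 : (0 : R) < 1 / 8 by lra.
have [K K0 [n1 h1]] := hT e8.
have A1 := A_gt0 (ltn0Sn 0).
have den0 : 0 < l + 2 * A 1%N * K by rewrite !addr_gt0 ?mulr_gt0.
(* Chosen so that t = g A_1 / A_n, which is at most g, satisfies both t l <= 1 and t K A_n <=
   1/2. *)
pose g := (l + 2 * A 1%N * K)^-1.
have g0 : 0 < g by rewrite invr_gt0.
have g1 : g * l + g * (2 * A 1%N * K) = 1.
  by rewrite -mulrDr mulVf// gt_eqF.
have g2 : 0 <= g * (2 * A 1%N * K) by rewrite !mulr_ge0// ltW.
have g3 : 0 <= g * l by rewrite mulr_ge0// ltW.
exists (q * (g * A 1%N) ^+ 2).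
  by rewrite mulr_gt0// exprn_gt0// mulr_gt0.
exists n1.+1 => n nn; have n0 : (0 < n)%N by exact: leq_ltn_trans nn.
have An := A_gt0 n0.
pose t := g * A 1%N / A n.
have t0 : 0 < t by rewrite divr_gt0// mulr_gt0.
have tg : t <= g by rewrite /t ler_pdivrMr// ler_wpM2l ?A_incr// ltW.
have tA : t * A n = g * A 1%N by rewrite /t divfK// gt_eqF.
have hbt : q * t ^+ 2 <= 1 - charN nu t.
  apply: hb; rewrite ger0_norm ?(ltW t0)//.
  apply: (@le_trans _ _ (g * l)); first by rewrite ler_wpM2r// ltW.
  by rewrite -g1 lerDl.
have hu : 1 - charN nu t ^+ n <= 1 / 2.
  apply: le_trans (@one_minus_charN_pow_le n t (K * A n) (ltW (mulr_gt0 K0 An))) _.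
  have -> : 1 / 2 = 2 * (1 / 8) + (1 / 2) ^+ 2 :> R by field.
  apply: lerD; first by rewrite ler_wpM2l// h1// ltnW.
  have -> : t * (K * A n) = g * (2 * A 1%N * K) / 2 by rewrite mulrCA tA; field.
  rewrite ler_pdivrMr//; apply: (@le_trans _ _ ((1 / 2) ^+ 2)).
    rewrite ler_pXn2r ?nnegrE ?divr_ge0// ler_pM2r ?invr_gt0//.
    by rewrite -[leRHS]g1 lerDr.
  by rewrite ler_peMr ?sqr_ge0// ler1n.
have hn : n%:R * (1 - charN nu t) <= 1.
  by apply: bernoulli_half => //; rewrite charN_ge0 charN_le1.
have h : n%:R * (q * t ^+ 2) <= 1.
  by apply: le_trans hn; rewrite ler_wpM2l.
have -> : q * (g * A 1%N) ^+ 2 * n%:R = n%:R * (q * t ^+ 2) * A n ^+ 2.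
  by rewrite -tA; ring.
by rewrite ler_piMl// sqr_ge0.
Qed.

End characteristic_function_estimates.

(** * Lower bound of the Green sum *)

Section lattice_sums.
Context {R : realType}.
Implicit Types F f g : int -> R.

(* 0, -1, 1, -2, 2, ... *)
Definition int_enum (n : nat) : int := if odd n then Negz n./2 else Posz n./2.

Lemma int_enum_bij : set_bij [set: nat] [set: int] int_enum.
Proof.
split=> //.
- by move=> m n _ _; rewrite /int_enum; do 2 case: ifP => ?; move=> []; lia.
- move=> [n|n] _; [exists n.*2|exists n.*2.+1] => //; rewrite /int_enum /= odd_double /=.
    by rewrite doubleK.
  by rewrite uphalf_double.
Qed.

(** A series along [int_enum] has both features needed: its first 2 B + 1 terms run over the window
    |y| <= B, and for nonnegative terms it is an unordered sum, hence invariant under shifts. *)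
Definition isum F : \bar R := (\sum_(k <oo) (F (int_enum k))%:E)%E.

Lemma isum_esum F : (forall x, 0 <= F x) -> isum F = (\esum_(x in [set: int]) (F x)%:E)%E.
Proof.
move=> F0; rewrite /isum nneseries_esumT; last by move=> n; rewrite lee_fin.
by rewrite (reindex_esum _ _ _ _ int_enum_bij).
Qed.

Lemma isum_shift F (z : int) : (forall x, 0 <= F x) -> isum (fun x => F (x + z)) = isum F.
Proof.
move=> F0; rewrite !isum_esum// [RHS](reindex_esum [set: int] _ (fun x => x + z))//.
split=> //; first by move=> x y _ _ /addIr.
by move=> x _; exists (x - z); rewrite ?subrK.
Qed.

Lemma isum_ge0 F : (forall x, 0 <= F x) -> (0 <= isum F)%E.
Proof. by move=> F0; apply: nneseries_ge0 => n _ _; rewrite lee_fin. Qed.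

Lemma le_isum F f : (forall x, 0 <= F x) -> (forall x, F x <= f x) -> (isum F <= isum f)%E.
Proof. by move=> F0 Ff; apply: lee_nneseries => n _; rewrite lee_fin. Qed.

Lemma isumD F f : (forall x, 0 <= F x) -> (forall x, 0 <= f x) ->
  isum (fun x => F x + f x) = (isum F + isum f)%E.
Proof.
move=> F0 f0; by rewrite /isum -nneseriesD// => n _; rewrite lee_fin.
Qed.

Lemma isumZ (c : R) F : 0 <= c -> (forall x, 0 <= F x) ->
  isum (fun x => c * F x) = (c%:E * isum F)%E.
Proof.
move=> c0 F0; rewrite /isum -nneseriesZl//; last by move=> n _; rewrite lee_fin.
Qed.

Lemma isum_le_bound F (M : R) : (forall x, 0 <= F x) ->
  (forall n, \sum_(0 <= k < n) F (int_enum k) <= M) -> (isum F <= M%:E)%E.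
Proof.
move=> F0 hM; apply: lime_le.
  by apply: is_cvg_nneseries => n _ _; rewrite lee_fin.
by apply: nearW => n; rewrite sumEFin lee_fin.
Qed.

Lemma isum_ge_partial F n : (forall x, 0 <= F x) ->
  ((\sum_(0 <= k < n) F (int_enum k))%:E <= isum F)%E.
Proof.
move=> F0; rewrite -sumEFin; apply: nneseries_lim_ge => k _; by rewrite lee_fin.
Qed.

Lemma isum_delta f : (forall x, 0 <= f x) -> isum (fun x => (x == 0)%:R * f x) = (f 0)%:E.
Proof.
move=> f0; rewrite /isum (nneseriesD1 (n := 0%N))//=; last first.
  by move=> n _; rewrite lee_fin mulr_ge0.
rewrite mul1r eseries0 ?adde0// => -[//|n] _ _.
rewrite (_ : int_enum n.+1 == 0 = false) ?mul0r//.
by apply/negbTE/eqP; rewrite /int_enum; case: ifP => ?; lia.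
Qed.

Variable nu : probability int R.

Lemma Ex_isum (F : int -> int -> R) : (forall x z, 0 <= F x z) -> (forall x, bd (F x)) ->
  isum (fun x => Ex nu (F x)) = (\int[nu]_z isum (fun x => F x z))%E.
Proof.
move=> F0 bF; rewrite /isum integral_nneseries//; last by move=> n z _; rewrite lee_fin.
by apply: eq_eseriesr => n _; rewrite Ex_EFin.
Qed.

Definition steps (s : int) f : int -> R := fun x => Ex nu (fun z => f (x + s * z)).

Lemma steps_ge0 s f : (forall x, 0 <= f x) -> forall x, 0 <= steps s f x.
Proof. by move=> f0 x; exact: Ex_ge0. Qed.

Lemma isum_steps s f g : (forall x, 0 <= f x) -> (forall x, 0 <= g x) -> bd g ->
  isum (fun x => f x * steps s g x) = (\int[nu]_z isum (fun x => f x * g (x + s * z))%R)%E.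
Proof.
move=> f0 g0 bg; rewrite -(@Ex_isum (fun x z => f x * g (x + s * z))).
- congr isum; apply/funext => x; rewrite ExZ//; exact: bd_comp.
- by move=> x z; rewrite mulr_ge0.
- by move=> x; apply: bdZ; exact: bd_comp.
Qed.

(** Tonelli, then a shift of the lattice by s z for each fixed z. *)
Lemma isum_steps_adjoint s f g : (forall x, 0 <= f x) -> (forall x, 0 <= g x) ->
  bd f -> bd g ->
  isum (fun x => f x * steps s g x) = isum (fun x => steps (- s) f x * g x).
Proof.
move=> f0 g0 bf bg; rewrite isum_steps//.
transitivity (isum (fun x => g x * steps (- s) f x)); last first.
  by congr isum; apply/funext => x; rewrite mulrC.
rewrite isum_steps//; apply: eq_integral => z _.
rewrite -[RHS](@isum_shift _ (s * z)) => [|x]; last by rewrite mulr_ge0.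
congr isum; apply/funext => x; rewrite mulrC; congr (_ * f _); ring.
Qed.

(** The averaging operator is a contraction of l^2, in the form given by 2 a b <= a ^ 2 + b ^ 2 and
    shift invariance for each z. *)
Lemma isum_steps_le s f g : (forall x, 0 <= f x) -> (forall x, 0 <= g x) ->
  bd f -> bd g -> (isum (fun x => f x ^+ 2)%R < +oo)%E -> (isum (fun x => g x ^+ 2)%R < +oo)%E ->
  (isum (fun x => f x * steps s g x)%R <=
   (2^-1)%:E * (isum (fun x => f x ^+ 2)%R + isum (fun x => g x ^+ 2)%R))%E.
Proof.
move=> f0 g0 bf bg ff gg; rewrite isum_steps//.
set M := (_ * _)%E; apply: (@le_trans _ _ (\int[nu]_z M)%E); last first.
  by rewrite integral_cst// [X in (_ * X)%E]probability_setT mule1.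
apply: ge0_le_integral => //.
- by move=> z _; apply: isum_ge0 => x; rewrite mulr_ge0.
move=> z _; rewrite /M -(@isum_shift (fun x => g x ^+ 2) (s * z)); last first.
  by move=> x; exact: sqr_ge0.
rewrite -isumD; [|by move=> x; exact: sqr_ge0..].
rewrite -isumZ//; last by move=> x; rewrite addr_ge0 ?sqr_ge0.
apply: le_isum => x; first by rewrite mulr_ge0.
have := sqr_ge0 (f x - g (x + s * z)); rewrite sqrrB; lra.
Qed.

Lemma cauchy_schwarz_sum (u : nat -> R) n :
  (\sum_(0 <= k < n) u k) ^+ 2 <= n%:R * \sum_(0 <= k < n) u k ^+ 2.
Proof.
case: n => [|n]; first by rewrite !big_nil mul0r expr0n.
set S := \sum_(0 <= k < n.+1) u k; set Q := \sum_(_ <= _ < _) _.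
have n0 : (0 : R) < n.+1%:R by rewrite ltr0n.
pose c := S / n.+1%:R.
have : 0 <= \sum_(0 <= k < n.+1) (u k - c) ^+ 2 by apply: sumr_ge0 => k _; exact: sqr_ge0.
have -> : \sum_(0 <= k < n.+1) (u k - c) ^+ 2 = Q - 2 * c * S + n.+1%:R * c ^+ 2.
  rewrite /Q /S mulr_sumr -sumrB.
  have -> : n.+1%:R * c ^+ 2 = \sum_(0 <= k < n.+1) c ^+ 2.
    by rewrite sumr_const_nat subn0 mulr_natl.
  by rewrite -big_split; apply: eq_bigr => k _ /=; ring.
have cS : n.+1%:R * c = S by rewrite /c mulrC divfK// gt_eqF.
move=> /(ler_wpM2l (ltW n0)); rewrite mulr0.
have -> : n.+1%:R * (Q - 2 * c * S + n.+1%:R * c ^+ 2) =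
  n.+1%:R * Q - 2 * (n.+1%:R * c) * S + (n.+1%:R * c) ^+ 2 by ring.
by rewrite cS; lra.
Qed.

Lemma sum_window (B : nat) (y : int) :
  \sum_(0 <= k < B.*2.+1) (y + int_enum k == 0)%:R = (`|y| <= B)%N%:R :> R.
Proof.
elim: B => [|B ih].
  by rewrite double0 big_nat1 addr0 leqn0 absz_eq0.
rewrite doubleS big_nat_recr//= big_nat_recr//= ih /int_enum /= odd_double /=.
rewrite doubleK uphalf_double.
have [h|h] := leqP `|y|%N B.
  have -> : (`|y| <= B.+1)%N by lia.
  have -> : (y + Negz B == 0) = false by lia.
  have -> : (y + B.+1 == 0) = false by lia.
  by rewrite !addr0.
have [h2|h2] := leqP `|y|%N B.+1; last first.
  have -> : (y + Negz B == 0) = false by lia.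
  have -> : (y + B.+1 == 0) = false by lia.
  by rewrite !addr0.
case: (lerP 0 y) => y0.
  have -> : (y + Negz B == 0) by lia.
  have -> : (y + B.+1 == 0) = false by lia.
  by rewrite addr0 add0r.
have -> : (y + Negz B == 0) = false by lia.
have -> : (y + B.+1 == 0) by lia.
by rewrite addr0 add0r.
Qed.

End lattice_sums.

Section monotone_limits.
Context {R : realType}.

Lemma Ex_cvg (nu : probability int R) (F : nat -> int -> R) (f : int -> R) (K : R) :
  (forall n x, `|F n x| <= K) -> (forall x, F^~ x @ \oo --> f x) ->
  (fun n => Ex nu (F n)) @ \oo --> Ex nu f.
Proof.
move=> FK Ff.
have [_ _ h] : [/\ nu.-integrable setT (EFin \o f),
   [sequence (\int[nu]_x `|(F n x)%:E - (f x)%:E|)%E]_n @ \oo --> 0%E &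
   [sequence (\int[nu]_x (F n x)%:E)%E]_n @ \oo --> (\int[nu]_x (f x)%:E)%E].
  apply: (@dominated_convergence _ _ _ nu setT measurableT (fun n x => (F n x)%:E)
     (EFin \o f) (fun _ => K%:E)) => //.
  - by apply: aeW => x _; apply: cvg_EFin; [exact: nearW|exact: Ff].
  - by apply: (@bd_integrable _ _ _ nu (cst K)); [exact: measurable_cst|exact: bd_cst].
  - by apply: aeW => x n _; rewrite /= lee_fin.
have bf : bd f.
  exists K => x; have : (fun n => `|F n x|) @ \oo --> `|f x| by exact: cvg_norm.
  move=> hx; rewrite -(cvg_lim _ hx)//.
  apply: limr_le; first by apply/cvg_ex; exists `|f x|.
  exact: nearW.
rewrite (@Ex_EFin _ _ _ nu f _ bf)// in h.
by have /fine_cvgP[_] := h.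
Qed.

Lemma nondecreasing_bounded_cvg (u : nat -> R) (M : R) :
  (forall n, u n <= u n.+1) -> (forall n, u n <= M) ->
  [/\ u @ \oo --> limn u, limn u <= M & forall n, u n <= limn u].
Proof.
move=> und uM.
have nd : nondecreasing_seq u by apply/nondecreasing_seqP.
have cu : cvgn u.
  by apply: nondecreasing_is_cvgn => //; exists M => _ [n _ <-].
split=> //; first by apply: limr_le => //; exact: nearW.
by move=> n; exact: nondecreasing_cvgn_le.
Qed.

Lemma cvg_sum_nat (F : nat -> nat -> R) (f : nat -> R) k :
  (forall i, (fun n => F n i) @ \oo --> f i) ->
  (fun n => \sum_(0 <= i < k) F n i) @ \oo --> \sum_(0 <= i < k) f i.
Proof.
move=> Ff; elim: k => [|k ih].
  by rewrite big_nil; under eq_fun do rewrite big_nil; exact: cvg_cst.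
rewrite big_nat_recr//=; under eq_fun do rewrite big_nat_recr//=.
exact: cvgD.
Qed.

End monotone_limits.

Local Ltac pos := try (move=> ?); repeat first
  [exact: sqr_ge0 | exact: ler0n | exact: steps_ge0 | done | by rewrite subr_ge0 ltW
  | exact: ltW | apply: addr_ge0 | apply: mulr_ge0 | apply: exprn_ge0].

(** * Discounted Green functions in l^2 *)

Section even_green.
Context {R : realType}.
Variables (delta : R) (nu : probability int R) (kappa : int).
Hypothesis delta01 : 0 < delta < 1.
Hypothesis kappa1 : kappa = 1 \/ kappa = -1.
Variable r : R.
Hypothesis r01 : 1 / 2 <= r < 1.

Local Notation T := (vopn delta nu kappa).

(** The restriction to even j matches the simple random walk, which is at 0 only at even times. *)
Definition evw j (b : bool) : R := r ^+ j * ((~~ odd j)%:R * b%:R).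

Let delta01' : 0 <= delta <= 1.
Proof. by case/andP: delta01 => d0 d1; rewrite !ltW. Qed.

Let r0 : 0 < r. Proof. by case/andP: r01 => ? ?; lra. Qed.
Let r1 : r < 1. Proof. by case/andP: r01. Qed.

Lemma evw_ge0 j b : 0 <= evw j b.
Proof. by rewrite /evw !mulr_ge0 ?exprn_ge0 ?ler0n// ltW. Qed.

Lemma evw_le j b : evw j b <= r ^+ j.
Proof.
rewrite /evw ler_piMr ?exprn_ge0 ?(ltW r0)//.
by case: (odd j); case: b; rewrite /= ?mulr0 ?mulr1 ?mul0r.
Qed.

Lemma bd2_pow : bd2 (fun j (_ : int) => r ^+ j).
Proof.
by exists 1 => j _; rewrite ger0_norm ?exprn_ge0 ?exprn_ile1 ?ltW.
Qed.

Lemma bd2_evw (b : int -> bool) : bd2 (fun j y => evw j (b y)).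
Proof.
exists 1 => j y; rewrite ger0_norm ?evw_ge0// (le_trans (evw_le _ _))//.
by rewrite exprn_ile1 ?ltW.
Qed.

Let M : R := (delta * (1 - r))^-1.

Let M0 : 0 <= M.
Proof. by case/andP: delta01 => d0 d1; rewrite invr_ge0 mulr_ge0 ?subr_ge0 ?ltW. Qed.

(** The potential of r ^ j is M r ^ j, because M delta (1 - r) = 1. *)
Lemma geometric_green n j y : \sum_(k < n) T k (fun j _ => r ^+ j) j y <= M.
Proof.
have [d0 d1] := andP delta01.
have bM : bd2 (fun j (_ : int) => M * r ^+ j).
  have [K hK] := bd2_pow; exists (M * K) => i x.
  by rewrite normrM (ger0_norm M0) ler_wpM2l// hK.
rewrite (@potential_sum _ _ _ _ delta01' n (fun j _ => M * r ^+ j))//.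
- have h1 : M * r ^+ j <= M by rewrite ler_piMr// exprn_ile1 ?ltW.
  have := @vopn_ge0 _ _ nu kappa delta01' n _ bM
    (fun i _ => mulr_ge0 M0 (exprn_ge0 i (ltW r0))) j y.
  lra.
- exact: bd2_pow.
move=> i x; rewrite /vop Ex_cst /M exprS; field.
by rewrite !gt_eqF ?subr_gt0.
Qed.

Definition gpart n j y : R := \sum_(0 <= k < n) T k (fun j y => evw j (y == 0)) j y.

Lemma gpartS n j y : gpart n.+1 j y = gpart n j y + T n (fun j y => evw j (y == 0)) j y.
Proof. by rewrite /gpart big_nat_recr. Qed.

Lemma T_ge0 n (b : int -> bool) j y : 0 <= T n (fun j y => evw j (b y)) j y.
Proof. by apply: vopn_ge0 => //; [exact: bd2_evw|move=> *; exact: evw_ge0]. Qed.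

Lemma gpart_nd n j y : gpart n j y <= gpart n.+1 j y.
Proof. by rewrite gpartS lerDl T_ge0. Qed.

Lemma gpart_ge0 n j y : 0 <= gpart n j y.
Proof. by apply: sumr_ge0 => k _; exact: T_ge0. Qed.

Lemma gpart_le n j y : gpart n j y <= M.
Proof.
apply: le_trans (geometric_green n j y); rewrite /gpart big_mkord.
apply: ler_sum => k _; apply: le_vopn => //; [exact: bd2_evw|exact: bd2_pow|].
by move=> i x; exact: evw_le.
Qed.

Definition green j y : R := limn (fun n => gpart n j y).

Lemma green_spec j y : [/\ (fun n => gpart n j y) @ \oo --> green j y, green j y <= M &
  forall n, gpart n j y <= green j y].
Proof.
apply: nondecreasing_bounded_cvg => n; [exact: gpart_nd|exact: gpart_le].
Qed.

Lemma green_ge0 j y : 0 <= green j y.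
Proof. by have [_ _ /(_ 0%N)] := green_spec j y; apply: le_trans; exact: gpart_ge0. Qed.

Lemma green_norm j y : `|green j y| <= M.
Proof. by rewrite ger0_norm ?green_ge0//; have [] := green_spec j y. Qed.

Lemma bd_green j : bd (green j).
Proof. by exists M; exact: green_norm. Qed.

Lemma bd2_gpart n : bd2 (gpart n).
Proof. by exists M => j y; rewrite ger0_norm ?gpart_le ?gpart_ge0. Qed.

Lemma gpart_rec n j y : gpart n.+1 j y = evw j (y == 0) + vop delta nu kappa (gpart n) j y.
Proof.
elim: n => [|n ih].
  rewrite gpartS /gpart big_nil /= add0r.
  have -> : (fun j y => \sum_(0 <= k < 0) T k (fun j y => evw j (y == 0)) j y) =
     (fun _ _ => 0) by apply/funext => i; apply/funext => x; rewrite big_nil.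
  by rewrite /vop Ex_cst !mulr0 !addr0.
rewrite gpartS ih vopnS -addrA; congr (_ + _).
rewrite -[LHS]/((fun j y => vop delta nu kappa (gpart n) j y +
   vop delta nu kappa (T n (fun j y => evw j (y == 0))) j y) j y).
rewrite -vopD//; [|exact: bd2_gpart|by apply: vopn_bd => //; exact: bd2_evw].
by congr (vop _ _ _ _ _ _); apply/funext => i; apply/funext => x; rewrite gpartS.
Qed.

Lemma green_eq j y : green j y =
  evw j (y == 0) + delta * green j.+1 y + (1 - delta) * steps nu (kappa ^+ j) (green j) y.
Proof.
have [h1 _ _] := green_spec j y.
have h2 : (fun n => gpart n.+1 j y) @ \oo --> green j y.
  by have := h1; rewrite -(cvg_shiftS (fun n => gpart n j y)).
apply: (cvg_unique _ h2) => //.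
have -> : (fun n => gpart n.+1 j y) = (fun n => evw j (y == 0) + delta * gpart n j.+1 y +
    (1 - delta) * Ex nu (fun z => gpart n j (y + kappa ^+ j * z))).
  by apply/funext => n; rewrite gpart_rec /vop addrA.
apply: cvgD; last first.
  apply: cvgMr; apply: (@Ex_cvg _ _ _ _ M) => [n z|z].
    by rewrite ger0_norm ?gpart_le ?gpart_ge0.
  by have [] := green_spec j (y + kappa ^+ j * z).
apply: cvgD; first exact: cvg_cst.
by apply: cvgMr; have [] := green_spec j.+1 y.
Qed.

Lemma kappaK : kappa * kappa = 1.
Proof. by case: kappa1 => ->. Qed.

Lemma T_add2 n (b : int -> bool) j y :
  T n (fun j y => evw j (b y)) j.+2 y = r ^+ 2 * T n (fun j y => evw j (b y)) j y.
Proof.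
pose f j y := evw j (b y).
have e1 := vopn_flip delta nu kappa n f.
have e2 := vopn_flip delta nu kappa n (fun j y => f j.+1 (kappa * y)).
rewrite e1 in e2.
have -> : T n f j.+2 y = T n (fun j y => f j.+2 (kappa * (kappa * y))) j y.
  by rewrite e2 mulrA kappaK mul1r.
rewrite -[RHS]/((fun j y => r ^+ 2 * T n f j y) j y) -vopnZ//; last exact: bd2_evw.
congr (vopn _ _ _ _ _ _); apply/funext => i; apply/funext => x.
rewrite /f /evw (mulrA kappa) kappaK mul1r /= negbK !exprS; ring.
Qed.

(** Two extra horizontal steps restore sign and parity, so the first-step equations for all j close
    up into a system for [green 0] and [green 1]. *)
Lemma green_add2 j y : green j.+2 y = r ^+ 2 * green j y.
Proof.
have [h1 _ _] := green_spec j.+2 y; have [h2 _ _] := green_spec j y.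
apply: (cvg_unique _ h1) => //.
have -> : (fun n => gpart n j.+2 y) = (fun n => r ^+ 2 * gpart n j y).
  apply/funext => n; rewrite /gpart mulr_sumr; apply: eq_bigr => k _; exact: T_add2.
exact: cvgMr.
Qed.

Lemma partial_window (n m : nat) (y : int) : (n <= m.*2.+1)%N ->
  \sum_(0 <= k < n) (y + int_enum k == 0)%:R <= 1 :> R.
Proof.
move=> nm; apply: (@le_trans _ _ (\sum_(0 <= k < m.*2.+1) (y + int_enum k == 0)%:R)).
  by rewrite (big_cat_nat (leq0n n) nm)/= lerDl sumr_ge0.
by rewrite sum_window; case: leqP.
Qed.

(** By translation invariance in the height, summing over starting points amounts to enlarging the
    target, whose indicator is still at most 1. This gives the l^1 bound on the Green functions. *)
Lemma T_translates n k j : \sum_(0 <= i < k) T n (fun j y => evw j (y == 0)) j (int_enum i) =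
  T n (fun j y => r ^+ j * ((~~ odd j)%:R * \sum_(0 <= i < k) (y + int_enum i == 0)%:R)) j 0.
Proof.
transitivity (T n (fun j y => \sum_(i <- index_iota 0 k) evw j (y + int_enum i == 0)) j 0).
  rewrite vopn_sum//; last first.
    by move=> i; exact: (bd2_evw (fun y => y + int_enum i == 0)).
  apply: eq_bigr => i _; rewrite (vopn_shift _ _ _ _ (fun j y => evw j (y == 0))).
  by rewrite add0r.
congr (vopn _ _ _ _ _ _); apply/funext => i; apply/funext => x.
by rewrite !mulr_sumr.
Qed.

Lemma gpart_mass n k j : \sum_(0 <= i < k) gpart n j (int_enum i) <= M.
Proof.
rewrite /gpart exchange_big /=; apply: le_trans (geometric_green n j 0).
rewrite big_mkord; apply: ler_sum => i _; rewrite T_translates; apply: le_vopn => //.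
- exists 1 => a x; rewrite ger0_norm ?mulr_ge0 ?exprn_ge0 ?sumr_ge0 ?(ltW r0)//.
  rewrite mulr_ile1 ?exprn_ge0 ?exprn_ile1 ?mulr_ge0 ?sumr_ge0 ?(ltW r0) ?(ltW r1)//.
  rewrite mulr_ile1 ?sumr_ge0//; first by case: (odd a).
  by apply: (@partial_window _ k); lia.
- exact: bd2_pow.
move=> a x; rewrite ler_piMr ?exprn_ge0 ?(ltW r0)//.
rewrite mulr_ile1 ?sumr_ge0//; first by case: (odd a).
by apply: (@partial_window _ k); lia.
Qed.

Lemma green_mass k j : \sum_(0 <= i < k) green j (int_enum i) <= M.
Proof.
have h : (fun n => \sum_(0 <= i < k) gpart n j (int_enum i)) @ \oo -->
    \sum_(0 <= i < k) green j (int_enum i).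
  by apply: cvg_sum_nat => i; have [] := green_spec j (int_enum i).
rewrite -(cvg_lim _ h)//; apply: limr_le; first by apply/cvg_ex; eexists; exact: h.
by apply: nearW => n; exact: gpart_mass.
Qed.

Lemma green_l2 j : (isum (fun y => green j y ^+ 2)%R < +oo)%E.
Proof.
apply: (@le_lt_trans _ _ (M * M)%:E); last exact: ltry.
apply: isum_le_bound => [x|n]; first exact: sqr_ge0.
apply: (@le_trans _ _ (\sum_(0 <= k < n) M * green j (int_enum k))).
  apply: ler_sum => k _; rewrite expr2 ler_wpM2r ?green_ge0//.
  by have [] := green_spec j (int_enum k).
by rewrite -mulr_sumr ler_wpM2l// green_mass.
Qed.

Let G y := green 0 y.
Let H y := green 1 y.

Let G0 y : 0 <= G y. Proof. exact: green_ge0. Qed.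
Let H0 y : 0 <= H y. Proof. exact: green_ge0. Qed.

Let G_eq y : G y = (y == 0)%:R + delta * H y + (1 - delta) * steps nu 1 G y.
Proof. by rewrite /G green_eq /evw expr0 !mul1r. Qed.

Let H_eq y : H y = delta * r ^+ 2 * G y + (1 - delta) * steps nu kappa H y.
Proof.
rewrite /H green_eq /evw /= mul0r mulr0 add0r expr1; congr (_ + _).
by rewrite green_add2 mulrA.
Qed.

Lemma isum_fin (F : int -> R) : (forall x, 0 <= F x) -> (isum F < +oo)%E ->
  exists2 a : R, 0 <= a & isum F = a%:E.
Proof.
move=> F0 Fy; have := isum_ge0 F0; case: (isum F) Fy => // a _.
by rewrite lee_fin => a0; exists a.
Qed.

Lemma isum_mul_fin (f g : int -> R) : (forall x, 0 <= f x) -> (forall x, 0 <= g x) ->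
  (isum (fun y => f y ^+ 2)%R < +oo)%E -> (isum (fun y => g y ^+ 2)%R < +oo)%E ->
  (isum (fun y => f y * g y)%R < +oo)%E.
Proof.
move=> f0 g0 ff gg; apply: (@le_lt_trans _ _ (isum (fun y => f y ^+ 2)%R + isum (fun y => g y ^+ 2)%R)%E).
  rewrite -isumD; [|by move=> x; exact: sqr_ge0..].
  apply: le_isum => x; first by rewrite mulr_ge0.
  have := sqr_ge0 (f x - g x); have := mulr_ge0 (f0 x) (g0 x); rewrite sqrrB; lra.
by rewrite lte_add_pinfty.
Qed.

Lemma steps_l2_fin s (f g : int -> R) : (forall x, 0 <= f x) -> (forall x, 0 <= g x) ->
  bd f -> bd g ->
  (isum (fun y => f y ^+ 2)%R < +oo)%E -> (isum (fun y => g y ^+ 2)%R < +oo)%E ->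
  (isum (fun y => f y * steps nu s g y)%R < +oo)%E.
Proof.
move=> f0 g0 bf bg ff gg; apply: le_lt_trans (isum_steps_le nu s f0 g0 bf bg ff gg) _.
by rewrite lte_mul_pinfty// lte_add_pinfty.
Qed.

Lemma partial_sqr_le (F : int -> R) (a : R) n : (forall x, 0 <= F x) ->
  isum (fun x => F x ^+ 2) = a%:E ->
  (\sum_(0 <= k < n) F (int_enum k)) ^+ 2 <= n%:R * a.
Proof.
move=> F0 Fa; apply: le_trans (cauchy_schwarz_sum _ _) _; rewrite ler_wpM2l//.
by rewrite -lee_fin -Fa; apply: isum_ge_partial => x; exact: sqr_ge0.
Qed.

Let H0_le : delta * H 0 <= G 0.
Proof.
have [d0 d1] := andP delta01.
rewrite [G 0]G_eq eqxx -addrA addrCA lerDl addr_ge0// mulr_ge0 ?subr_ge0 ?(ltW d1)//.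
exact: steps_ge0.
Qed.

(* The operators steps nu 1 and steps nu (-1) are adjoint, so pairing the equation
   of G with H and that of H with G gives H 0 = delta (r ^ 2 |G|^2 - |H|^2). *)
Lemma green_l2_alternating n : kappa = -1 ->
  delta ^+ 2 * r ^+ 2 * (1 - r ^+ 2) *
    (\sum_(0 <= k < n) (G (int_enum k) + H (int_enum k))) ^+ 2 <= 4 * n%:R * G 0.
Proof.
move=> kE; have [d0 d1] := andP delta01.
have bG := bd_green 0; have bH := bd_green 1.
have [gg gg0 ggE] := isum_fin (fun y => sqr_ge0 (G y)) (green_l2 0).
have [hh hh0 hhE] := isum_fin (fun y => sqr_ge0 (H y)) (green_l2 1).
have [gh gh0 ghE] := isum_fin (fun y => mulr_ge0 (H0 y) (G0 y))
  (isum_mul_fin H0 G0 (green_l2 1) (green_l2 0)).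
have [x x0 xE] := isum_fin (fun y => mulr_ge0 (H0 y) (steps_ge0 nu 1 G0 y))
  (steps_l2_fin 1 H0 G0 bH bG (green_l2 1) (green_l2 0)).
have [z z0 zE] := isum_fin (fun y => mulr_ge0 (H0 y) (steps_ge0 nu (-1) H0 y))
  (steps_l2_fin (-1) H0 H0 bH bH (green_l2 1) (green_l2 1)).
have e1 : gh = H 0 + delta * hh + (1 - delta) * x.
  apply: EFin_inj; rewrite !EFinD !EFinM -ghE -hhE -xE -(isum_delta H0).
  rewrite -!isumZ; [|by pos..].
  rewrite -!isumD; [|by pos..].
  by congr isum; apply/funext => y; rewrite [in LHS]G_eq; ring.
have e2 : gh = delta * r ^+ 2 * gg + (1 - delta) * x.
  have xE' : isum (fun y => steps nu (- 1) H y * G y) = x%:E.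
    by rewrite -xE (isum_steps_adjoint nu 1 H0 G0 bH bG).
  have dr : 0 <= delta * r ^+ 2 by rewrite mulr_ge0 ?sqr_ge0// ltW.
  apply: EFin_inj; rewrite !EFinD EFinM [((1 - delta) * x)%:E]EFinM -ghE -ggE -xE'.
  rewrite -!isumZ; [|by pos..].
  rewrite -!isumD; [|by pos..].
  by congr isum; apply/funext => y; rewrite [in LHS]H_eq kE; ring.
(* It remains to bound |H| by |G|. Pairing the equation of H with H itself and using the contraction
   gives |H| ^ 2 <= r ^ 2 (G, H); as 2 r ^ 2 (G, H) <= r ^ 4 |G| ^ 2 + |H| ^ 2, this yields |H| ^ 2
   <= r ^ 4 |G| ^ 2. *)
have e3 : hh = delta * r ^+ 2 * gh + (1 - delta) * z.
  have dr : 0 <= delta * r ^+ 2 by rewrite mulr_ge0 ?sqr_ge0// ltW.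
  apply: EFin_inj; rewrite !EFinD EFinM [((1 - delta) * z)%:E]EFinM -ghE -hhE -zE.
  rewrite -!isumZ; [|by pos..].
  rewrite -!isumD; [|by pos..].
  by congr isum; apply/funext => y; rewrite expr2 [X in X * _ = _]H_eq kE; ring.
have e4 : z <= hh.
  have := isum_steps_le nu (-1) H0 H0 bH bH (green_l2 1) (green_l2 1).
  by rewrite zE hhE -EFinD -EFinM lee_fin; lra.
have e5 : 2 * r ^+ 2 * gh <= r ^+ 4 * gg + hh.
  have : ((2 * r ^+ 2)%:E * isum (fun y => H y * G y)%R <=
    (r ^+ 4)%:E * isum (fun y => G y ^+ 2)%R + isum (fun y => H y ^+ 2)%R)%E.
    rewrite -!isumZ; [|by pos..].
    rewrite -isumD; [|by pos..].
    apply: le_isum => y; first by pos.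
    have := sqr_ge0 (r ^+ 2 * G y - H y); rewrite sqrrB exprMn -exprM; lra.
  by rewrite ggE ghE hhE -!EFinM -EFinD lee_fin.
have e6 : delta * hh <= delta * (r ^+ 4 * gg).
  have := ler_wpM2l (ltW d0) e5; have h1d : 0 <= 1 - delta by rewrite subr_ge0 ltW.
  have := ler_wpM2l h1d e4; lra.
have e7 : hh <= r ^+ 4 * gg by move: e6; rewrite ler_pM2l.
have e8 : delta * r ^+ 2 * (1 - r ^+ 2) * gg <= H 0.
  have -> : H 0 = delta * (r ^+ 2 * gg - hh) by move: e1 e2; lra.
  have -> : delta * r ^+ 2 * (1 - r ^+ 2) * gg = delta * (r ^+ 2 * gg - r ^+ 4 * gg).
    by rewrite (_ : r ^+ 4 = r ^+ 2 * r ^+ 2); ring.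
  by rewrite ler_wpM2l ?(ltW d0)// lerD2l lerN2.
have rr : 0 <= 1 - r ^+ 2 by rewrite subr_ge0 exprn_ile1 ?ltW.
have r4 : r ^+ 4 <= 1 by rewrite exprn_ile1 ?ltW.
have hg : hh <= gg by apply: (le_trans e7); rewrite ler_piMl.
pose S1 := \sum_(0 <= k < n) G (int_enum k); pose S2 := \sum_(0 <= k < n) H (int_enum k).
have s1 : S1 ^+ 2 <= n%:R * gg by exact: partial_sqr_le.
have s2 : S2 ^+ 2 <= n%:R * gg.
  by apply: (le_trans (partial_sqr_le n H0 hhE)); rewrite ler_wpM2l.
rewrite big_split /= -/S1 -/S2.
have s3 : (S1 + S2) ^+ 2 <= 4 * (n%:R * gg).
  have := sqr_ge0 (S1 - S2); rewrite sqrrB sqrrD; lra.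
have c0 : 0 <= delta ^+ 2 * r ^+ 2 * (1 - r ^+ 2).
  by pos.
apply: (le_trans (ler_wpM2l c0 s3)).
have -> : delta ^+ 2 * r ^+ 2 * (1 - r ^+ 2) * (4 * (n%:R * gg)) =
  4 * n%:R * (delta * (delta * r ^+ 2 * (1 - r ^+ 2) * gg)) by ring.
rewrite ler_wpM2l ?mulr_ge0//; apply: le_trans H0_le.
by rewrite ler_wpM2l// ltW.
Qed.

(** Without alternation the system decouples: V = G + H / r solves the scalar equation V = 1_0 +
    delta r V + (1 - delta) [steps nu 1 V]. Pairing it with V gives delta (1 - r) |V| ^ 2 <= V 0,
    and V dominates G + H. *)
Lemma green_l2_plain n : kappa = 1 ->
  delta ^+ 2 * (1 - r) *
    (\sum_(0 <= k < n) (G (int_enum k) + H (int_enum k))) ^+ 2 <= 3 * n%:R * G 0.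
Proof.
move=> kE; have [d0 d1] := andP delta01; have [rh _] := andP r01.
pose V y := G y + r^-1 * H y.
have ri : 0 <= r^-1 by rewrite invr_ge0 ltW.
have V0 y : 0 <= V y by rewrite addr_ge0// mulr_ge0.
have bV : bd V by apply: bdD; [exact: bd_green|apply: bdZ; exact: bd_green].
have V_eq y : V y = (y == 0)%:R + delta * r * V y + (1 - delta) * steps nu 1 V y.
  have sV : steps nu 1 V y = steps nu 1 G y + r^-1 * steps nu 1 H y.
    rewrite /steps ExD ?ExZ//; [exact: bd_comp (bd_green 1)|exact: bd_comp (bd_green 0)|].
    by apply: bdZ; exact: bd_comp (bd_green 1).
  by rewrite sV /V {1}G_eq {2}H_eq kE; field; rewrite gt_eqF.
have vl2 : (isum (fun y => V y ^+ 2)%R < +oo)%E.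
  apply: (@le_lt_trans _ _ (isum (fun y => 2 * G y ^+ 2 + 2 * r^-1 ^+ 2 * H y ^+ 2)%R)).
    apply: le_isum => y; first exact: sqr_ge0.
    have := sqr_ge0 (G y - r^-1 * H y); rewrite /V sqrrB sqrrD exprMn; lra.
  rewrite isumD; first last.
  - by move=> y; rewrite !mulr_ge0 ?sqr_ge0.
  - by move=> y; rewrite mulr_ge0 ?sqr_ge0.
  rewrite !isumZ ?mulr_ge0 ?sqr_ge0//; [|by move=> y; exact: sqr_ge0..].
  have [gg gg0 ->] := isum_fin (fun y => sqr_ge0 (G y)) (green_l2 0).
  have [hh hh0 ->] := isum_fin (fun y => sqr_ge0 (H y)) (green_l2 1).
  by rewrite -!EFinM -EFinD ltry.
have [vv vv0 vvE] := isum_fin (fun y => sqr_ge0 (V y)) vl2.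
have [x x0 xE] := isum_fin (fun y => mulr_ge0 (V0 y) (steps_ge0 nu 1 V0 y))
  (steps_l2_fin 1 V0 V0 bV bV vl2 vl2).
have dr : 0 <= delta * r by rewrite mulr_ge0 ?ltW.
have e1 : vv = V 0 + delta * r * vv + (1 - delta) * x.
  apply: EFin_inj; rewrite 2!EFinD [((1 - delta) * x)%:E]EFinM [(delta * r * vv)%:E]EFinM.
  rewrite -vvE -xE -(isum_delta V0).
  rewrite -!isumZ; [|by pos..].
  rewrite -!isumD; [|by pos..].
  by congr isum; apply/funext => y; rewrite expr2 [X in X * _ = _]V_eq; ring.
have e2 : x <= vv.
  have := isum_steps_le nu 1 V0 V0 bV bV vl2 vl2.
  by rewrite xE vvE -EFinD -EFinM lee_fin; lra.
have e3 : delta * (1 - r) * vv <= V 0.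
  have h1d : 0 <= 1 - delta by rewrite subr_ge0 ltW.
  have := ler_wpM2l h1d e2; lra.
have e4 : delta * V 0 <= 3 * G 0.
  have r2 : r^-1 <= 2.
    by rewrite -[leRHS]invrK lef_pV2 ?posrE ?invr_gt0//; lra.
  have := ler_wpM2r (mulr_ge0 (ltW d0) (H0 0)) r2.
  have := ler_wpM2r (G0 0) (ltW d1).
  rewrite /V; have := H0_le; lra.
have s : (\sum_(0 <= k < n) (G (int_enum k) + H (int_enum k))) ^+ 2 <= n%:R * vv.
  apply: le_trans (partial_sqr_le n V0 vvE).
  rewrite ler_pXn2r ?nnegrE ?sumr_ge0//; last by move=> k _; rewrite addr_ge0.
  apply: ler_sum => k _; rewrite lerD2l ler_peMl//.
  by rewrite -[leLHS]invr1 lef_pV2 ?posrE// ltW.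
have c0 : 0 <= delta ^+ 2 * (1 - r) by rewrite mulr_ge0 ?sqr_ge0// subr_ge0 ltW.
apply: (le_trans (ler_wpM2l c0 s)).
have -> : delta ^+ 2 * (1 - r) * (n%:R * vv) = n%:R * (delta * (delta * (1 - r) * vv)) by ring.
have -> : 3 * n%:R * G 0 = n%:R * (3 * G 0) by ring.
rewrite ler_wpM2l//; apply: le_trans e4.
by rewrite ler_wpM2l// ltW.
Qed.

(** The constant 16 covers both cases: in the alternating one, 4 r ^ 2 (1 + r) >= 1 because r >=
    1/2. *)
Lemma green_l2_bound n : delta ^+ 2 * (1 - r) *
  (\sum_(0 <= k < n) (green 0 (int_enum k) + green 1 (int_enum k))) ^+ 2 <=
  16 * n%:R * green 0 0.
Proof.
have n0 : 0 <= n%:R * G 0 by rewrite mulr_ge0.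
case: kappa1 => [k1|k1].
  by apply: (le_trans (green_l2_plain n k1)); rewrite -/(G 0); lra.
have := green_l2_alternating n k1; set S := (\sum_(0 <= k < n) _) ^+ 2 => h.
have S0 : 0 <= S by exact: sqr_ge0.
have [rh r1'] := andP r01; rewrite -/(G 0).
have : delta ^+ 2 * (1 - r) * S <= 4 * (delta ^+ 2 * r ^+ 2 * (1 - r ^+ 2) * S).
  have -> : 4 * (delta ^+ 2 * r ^+ 2 * (1 - r ^+ 2) * S) =
     delta ^+ 2 * (1 - r) * S * (4 * r ^+ 2 * (1 + r)) by ring.
  rewrite ler_peMr; [by []|by pos|].
  have : (1 / 2) ^+ 2 <= r ^+ 2 by rewrite ler_pXn2r ?nnegrE//; lra.
  rewrite [(1 / 2) ^+ 2]expr2 => h2.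
  have : 0 <= r ^+ 2 * r by rewrite mulr_ge0 ?sqr_ge0// ltW.
  lra.
lra.
Qed.

End even_green.

(** * From l^2 norms to the Green sum *)

Section green_lower_bound.
Context {R : realType}.
Variables (delta : R) (nu : probability int R) (kappa : int).
Hypothesis delta01 : 0 < delta < 1.
Hypothesis kappa1 : kappa = 1 \/ kappa = -1.

Local Notation T := (vopn delta nu kappa).

Let delta01' : 0 <= delta <= 1.
Proof. by case/andP: delta01 => d0 d1; rewrite !ltW. Qed.

Definition inside (B : nat) (y : int) : bool := (`|y| <= B)%N.

(** For every path, exactly one of the starts j = 0 and j = 1 ends with an even j, so the parity
    restriction disappears in G + H at the price of a factor r. The window is symmetric, hence
    indifferent to the flip by kappa. *)
Lemma green_window (r : R) (N B : nat) (q : R) : 1 / 2 <= r < 1 -> 0 <= q ->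
  (forall i, (i < N)%N -> q <= T i (fun _ y => (inside B y)%:R) 0 0) ->
  N%:R * r ^+ N * q <= \sum_(0 <= k < B.*2.+1)
    (green delta nu kappa r 0 (int_enum k) + green delta nu kappa r 1 (int_enum k)).
Proof.
move=> r01 q0 hq; have [rh r1] := andP r01.
have r0 : 0 < r by lra.
apply: (@le_trans _ _ (\sum_(0 <= k < B.*2.+1) (gpart delta nu kappa r N 0 (int_enum k) +
    gpart delta nu kappa r N 1 (int_enum k)))); last first.
  apply: ler_sum => k _; apply: lerD.
    by have [_ _] := green_spec nu kappa delta01 r01 0 (int_enum k).
  by have [_ _] := green_spec nu kappa delta01 r01 1 (int_enum k).
rewrite big_split /= /gpart exchange_big /= [X in _ + X]exchange_big /= -big_split /=.
have -> : N%:R * r ^+ N * q = \sum_(0 <= i < N) r ^+ N * q.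
  by rewrite sumr_const_nat subn0 -[RHS]mulr_natl mulrA.
rewrite !big_nat; apply: ler_sum => i /andP[_ iN].
rewrite !T_translates//.
pose f j (y : int) := evw r j (inside B y).
have e j : T i (fun j y => r ^+ j * ((~~ odd j)%:R *
    \sum_(0 <= k < B.*2.+1) (y + int_enum k == 0)%:R)) j 0 = T i f j 0.
  congr (vopn _ _ _ _ _ _); apply/funext => a; apply/funext => y.
  by rewrite sum_window.
rewrite !e; have -> : T i f 1 0 = T i (fun j y => f j.+1 (kappa * y)) 0 0.
  by rewrite vopn_flip mulr0.
have bf : bd2 f by apply: bd2_evw.
have bf' : bd2 (fun j y => f j.+1 (kappa * y)).
  by have [K hK] := bf; exists K => j y; exact: hK.
have bw : bd2 (fun _ y => (inside B y)%:R : R).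
  by exists 1 => j y; case: inside; rewrite ?normr1 ?normr0.
have brw : bd2 (fun j y => r ^+ j * (inside B y)%:R).
  exists 1 => j y; rewrite normrM !ger0_norm ?exprn_ge0 ?ler0n ?(ltW r0)//.
  by rewrite mulr_ile1 ?exprn_ge0 ?exprn_ile1 ?(ltW r0) ?(ltW r1)//; case: inside.
rewrite -[leRHS]/((fun j y => T i f j y + T i (fun j y => f j.+1 (kappa * y)) j y) 0 0).
rewrite -vopnD//.
apply: (@le_trans _ _ (T i (fun j y => r * (r ^+ j * (inside B y)%:R)) 0 0)); last first.
  apply: le_vopn => //.
  - have [K hK] := brw; exists (r * K) => j y.
    by rewrite normrM (ger0_norm (ltW r0)) ler_wpM2l ?(ltW r0)// hK.
  - have [K hK] := bf; have [L hL] := bf'; exists (K + L) => j y.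
    by apply: (le_trans (ler_normD _ _)); exact: lerD.
  move=> j y; rewrite /f /evw.
  have -> : inside B (kappa * y) = inside B y.
    by rewrite /inside; case: kappa1 => ->; congr (_ <= _)%N; lia.
  rewrite /= negbK mulrA -exprS; case: (odd j); rewrite /= !mul1r !mul0r !mulr0 ?addr0 ?add0r//.
  by rewrite exprS -mulrA ler_piMl ?(ltW r1)// mulr_ge0 ?ler0n// exprn_ge0// ltW.
rewrite vopnZ//.
have hr : 0 <= r <= 1 by rewrite !ltW.
have := @vopn_geometric _ _ nu kappa delta01' i r _ bw hr (fun _ _ => ler0n _ _) 0%N 0.
rewrite add0n => hg.
apply: (@le_trans _ _ (r * (r ^+ i * q))).
  rewrite mulrA -exprS ler_wpM2r//; apply: ler_wiXn2l => //; exact: ltW.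
rewrite ler_wpM2l ?(ltW r0)//; apply: le_trans hg.
by rewrite ler_wpM2l ?exprn_ge0 ?(ltW r0)// hq.
Qed.

(** Bernoulli with exponent n gives 1/2, and squaring gives 1/4; this is why the time horizon is
    taken even. *)
Lemma one_minus_inv_pow (n : nat) : (0 < n)%N -> 1 / 4 <= (1 - n.*2%:R^-1) ^+ n.*2 :> R.
Proof.
move=> n0; have n20 : (0 : R) < n.*2%:R by rewrite ltr0n double_gt0.
have n0' : (0 : R) < n%:R by rewrite ltr0n.
have n1 : (1 : R) <= n.*2%:R by rewrite ler1n double_gt0.
set x := 1 - _; have x01 : 0 <= x <= 1.
  by rewrite /x subr_ge0 lerBlDr lerDl invr_ge0 (ltW n20) andbT invf_le1.
have := bernoulli_sub n x01.
have -> : n%:R * (1 - x) = 1 / 2.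
  by rewrite /x opprB addrC subrK -mul2n natrM; field; rewrite gt_eqF.
move=> h; rewrite -muln2 exprM.
have -> : 1 / 4 = (1 / 2) ^+ 2 :> R by lra.
have [x0 _] := andP x01.
by rewrite ler_pXn2r ?nnegrE ?exprn_ge0//; lra.
Qed.

Lemma green_diagonal_lower (n B : nat) (q : R) : (0 < n)%N -> 0 <= q ->
  (forall i, (i < n.*2)%N -> q <= T i (fun _ y => (inside B y)%:R) 0 0) ->
  delta ^+ 2 * q ^+ 2 / 256 * n.*2%:R <=
    B.*2.+1%:R * green delta nu kappa (1 - n.*2%:R^-1) 0 0.
Proof.
move=> n0 q0 hq; set N := n.*2 in hq *; set r := 1 - _.
have N0 : (0 : R) < N%:R by rewrite ltr0n double_gt0.
have N2 : (2 : R) <= N%:R by rewrite ler_nat /N -addnn; lia.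
have Ni : N%:R^-1 <= 2^-1 :> R by rewrite lef_pV2 ?posrE.
have Ni0 : 0 < N%:R^-1 :> R by rewrite invr_gt0.
have r01 : 1 / 2 <= r < 1 by rewrite /r; apply/andP; split; lra.
have h1 := green_window r01 q0 hq.
have h2 := green_l2_bound nu delta01 kappa1 r01 B.*2.+1.
have h3 := one_minus_inv_pow n0; rewrite -/N -/r in h3.
set W := \sum_(0 <= k < _) _ in h1 h2.
have h4 : N%:R * q / 4 <= W.
  apply: le_trans h1; have : 0 <= N%:R * q * (r ^+ N - 1 / 4).
    by rewrite mulr_ge0 ?mulr_ge0 ?(ltW N0)// subr_ge0.
  lra.
have h5 : (N%:R * q / 4) ^+ 2 <= W ^+ 2.
  have a : 0 <= N%:R * q / 4 by rewrite divr_ge0// mulr_ge0.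
  by rewrite ler_pXn2r ?nnegrE// (le_trans a).
have c0 : 0 <= delta ^+ 2 * (1 - r).
  by rewrite mulr_ge0 ?sqr_ge0// subr_ge0; have [_ /ltW] := andP r01.
have h6 := le_trans (ler_wpM2l c0 h5) h2.
have e : delta ^+ 2 * (1 - r) * (N%:R * q / 4) ^+ 2 = delta ^+ 2 * q ^+ 2 / 16 * N%:R.
  by rewrite /r; field; rewrite gt_eqF.
rewrite e in h6; lra.
Qed.

(** Comparison with the increments of u / (x + u) from u = 2 ^ i to 2 u. The constant works because
    (7/2) (u ^ 2 + x ^ 2) - (x + 2 u) (x + u) = (3/2) (u - x) ^ 2 + x ^ 2. *)
Lemma dyadic_mixture_sum (x : R) I : 0 < x ->
  \sum_(1 <= i < I) 2 ^+ i / (4 ^+ i + x ^+ 2) <= 7 / 2 / x.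
Proof.
move=> x0; pose phi (u : R) := u / (x + u).
have p2 i : 0 < 2 ^+ i :> R by exact: exprn_gt0.
have phi_le i : phi (2 ^+ i) <= 1.
  by rewrite /phi ler_pdivrMr ?addr_gt0// mul1r lerDr ltW.
have phi_ge i : 0 <= phi (2 ^+ i) by rewrite /phi divr_ge0 ?addr_ge0// ltW.
suff : forall k, \sum_(0 <= i < k) 2 ^+ i.+1 / (4 ^+ i.+1 + x ^+ 2) <=
    7 / 2 / x * (phi (2 ^+ k.+1) - phi (2 ^+ 1)).
  case: I => [_|I /(_ I) h]; first by rewrite big_geq// divr_ge0// ltW.
  rewrite big_add1 /=; apply: (le_trans h).
  rewrite ler_piMr ?divr_ge0 ?(ltW x0)//; have := phi_le I.+1; have := phi_ge 1%N; lra.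
elim=> [|k ih]; first by rewrite big_nil subrr mulr0.
rewrite big_nat_recr//=.
have -> : 7 / 2 / x * (phi (2 ^+ k.+2) - phi (2 ^+ 1)) =
  7 / 2 / x * (phi (2 ^+ k.+1) - phi (2 ^+ 1)) +
  7 / 2 / x * (phi (2 ^+ k.+2) - phi (2 ^+ k.+1)) by ring.
apply: lerD => //; have -> : 4 ^+ k.+1 = (2 ^+ k.+1) ^+ 2 :> R.
  by rewrite -exprM mulnC exprM; congr (_ ^+ _); ring.
rewrite [2 ^+ k.+2]exprS /phi; set u := 2 ^+ k.+1.
have u0 : 0 < u by exact: p2.
have -> : 7 / 2 / x * (2 * u / (x + 2 * u) - u / (x + u)) =
   7 / 2 * u / ((x + 2 * u) * (x + u)).
  by field; apply/and3P; split; rewrite gt_eqF// ?addr_gt0 ?mulr_gt0.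
rewrite ler_pdivlMr; last by rewrite mulr_gt0 ?addr_gt0 ?mulr_gt0.
rewrite mulrAC ler_pdivrMr; last by rewrite addr_gt0 ?exprn_gt0.
rewrite -subr_ge0.
have -> : 7 / 2 * u * (u ^+ 2 + x ^+ 2) - u * ((x + 2 * u) * (x + u)) =
  u * (3 / 2 * (u - x) ^+ 2 + x ^+ 2) by field.
apply: mulr_ge0; first exact: ltW.
by apply: addr_ge0; [apply: mulr_ge0; rewrite ?sqr_ge0 ?divr_ge0|exact: sqr_ge0].
Qed.

(** (1 - 4 ^ (-i)) ^ j <= 4 ^ i / (4 ^ i + j) reduces the mixture to the preceding sum with x = sqrt
    j. The factor 1/5 is small enough: (1/5) (7/2) = 7/10 <= 1 / sqrt 2, the constant in
    [srw0_lower]. *)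
Lemma srw_mixture j I :
  \sum_(1 <= i < I) 5^-1 / 2 ^+ i * evw (1 - (4 ^+ i)^-1) j true <= srw j 0 :> R.
Proof.
have [oj|ej] := boolP (odd j).
  rewrite big1 ?srw_ge0// => i _.
  by rewrite /evw oj /= mul0r !mulr0.
have p4 i : 1 <= 4 ^+ i :> R by rewrite exprn_ege1// ler1n.
have p2 i : 0 < 2 ^+ i :> R by exact: exprn_gt0.
have -> : \sum_(1 <= i < I) 5^-1 / 2 ^+ i * evw (1 - (4 ^+ i)^-1) j true =
  5^-1 * \sum_(1 <= i < I) (1 - (4 ^+ i)^-1) ^+ j / 2 ^+ i :> R.
  rewrite mulr_sumr; apply: eq_bigr => i _.
  by rewrite /evw ej /= !mulr1; ring.
have [j0|j0] := posnP j.
  rewrite j0 /=; have : forall k, \sum_(0 <= i < k) (2 ^+ i.+1)^-1 <= 1 - (2 ^+ k)^-1 :> R.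
    elim=> [|k ih]; first by rewrite big_nil expr0 invr1 subrr.
    rewrite big_nat_recr//= exprS invfM; lra.
  case: I => [_|I /(_ I) h]; first by rewrite big_geq// mulr0.
  rewrite big_add1 /=.
  under eq_bigr do rewrite expr0 mul1r.
  have : 0 < (2 ^+ I)^-1 :> R by rewrite invr_gt0.
  lra.
have x0 : 0 < Num.sqrt (j%:R : R) by rewrite sqrtr_gt0 ltr0n.
have xx : Num.sqrt (j%:R : R) ^+ 2 = j%:R by rewrite sqr_sqrtr.
apply: (@le_trans _ _ (5^-1 * (7 / 2 / Num.sqrt j%:R))).
  rewrite ler_wpM2l// ; apply: le_trans (dyadic_mixture_sum I x0).
  apply: ler_sum => i _; rewrite xx.
  have r01 : 0 <= (1 - (4 ^+ i)^-1 : R) <= 1.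
    by rewrite subr_ge0 lerBlDr lerDl invr_ge0 exprn_ge0// andbT invf_le1// exprn_gt0.
  have := bernoulli_inv j r01; rewrite subKr.
  have -> : 1 + j%:R * (4 ^+ i)^-1 = (4 ^+ i + j%:R) / 4 ^+ i :> R.
    by field; rewrite expf_neq0.
  have d0 : 0 < 4 ^+ i + j%:R :> R by rewrite ltr_wpDr// exprn_gt0.
  rewrite mulrA ler_pdivrMr ?exprn_gt0// mul1r -ler_pdivlMr// => h.
  rewrite ler_pdivrMr//; apply: (le_trans h).
  have -> : 4 ^+ i = 2 ^+ i * 2 ^+ i :> R by rewrite -exprMn; congr (_ ^+ _); ring.
  by rewrite -[leLHS]mulrA -[leRHS]mulrA ler_wpM2l ?(ltW (p2 i))// mulrC.
have jE : j = j./2.*2 by rewrite even_halfK.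
have hl := @srw0_lower R j./2; rewrite -jE in hl.
apply: le_trans (hl _); last by rewrite half_gt0; case: (j) ej j0 => [|[|]].
rewrite sqrtrM// invfM mulrA ler_wpM2r ?invr_ge0 ?sqrtr_ge0//.
have s2 : 0 < Num.sqrt (2 : R) by rewrite sqrtr_gt0.
rewrite -[leRHS]mul1r ler_pdivlMr//.
have ss : Num.sqrt (2 : R) ^+ 2 = 2 by rewrite sqr_sqrtr.
have : Num.sqrt (2 : R) <= 10 / 7.
  rewrite -(ler_pXn2r (n := 2)) ?nnegrE ?divr_ge0 ?(ltW s2)// ss; lra.
lra.
Qed.

Lemma green_le_return (C0 : R) : (forall N, \sum_(0 <= n < N) ret delta nu kappa n <= C0) ->
  forall I, \sum_(1 <= i < I) (2 ^+ i)^-1 * green delta nu kappa (1 - (4 ^+ i)^-1) 0 0 <= 5 * C0.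
Proof.
move=> hC I.
have p2 i : 0 < 2 ^+ i :> R by exact: exprn_gt0.
have r01 i : 1 / 2 <= (1 - (4 ^+ i.+1)^-1 : R) < 1.
  have p4 : 1 <= 4 ^+ i :> R by rewrite exprn_ege1// ler1n.
  have : 0 < (4 ^+ i.+1)^-1 :> R by rewrite invr_gt0 exprn_gt0.
  have : (4 ^+ i.+1)^-1 <= 2^-1 :> R.
    by rewrite lef_pV2 ?posrE ?exprn_gt0// exprS; lra.
  by move=> h1 h2; apply/andP; split; lra.
pose rr i : R := 1 - (4 ^+ i)^-1.
have part N : \sum_(0 <= i < I) (2 ^+ i.+1)^-1 * gpart delta nu kappa (rr i.+1) N 0 0 <= 5 * C0.
  apply: (@le_trans _ _ (5 * \sum_(0 <= n < N) ret delta nu kappa n)); last first.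
    by rewrite ler_wpM2l.
  rewrite /gpart.
  under eq_bigr do rewrite mulr_sumr.
  rewrite exchange_big mulr_sumr; apply: ler_sum => n _.
  have bi i : bd2 (fun j y => (2 ^+ i.+1)^-1 * evw (rr i.+1) j (y == 0)).
    have [K hK] := bd2_evw (r01 i) (fun y => y == 0); exists ((2 ^+ i.+1)^-1 * K) => j y.
    by rewrite normrM ger0_norm ?invr_ge0 ?(ltW (p2 _))// ler_wpM2l ?invr_ge0 ?(ltW (p2 _))// hK.
  have -> : \sum_(0 <= i < I) (2 ^+ i.+1)^-1 * T n (fun j y => evw (rr i.+1) j (y == 0)) 0 0 =
     T n (fun j y => \sum_(i <- index_iota 0 I) (2 ^+ i.+1)^-1 * evw (rr i.+1) j (y == 0)) 0 0.
    rewrite vopn_sum//; apply: eq_bigr => i _; rewrite vopnZ//.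
    exact: (bd2_evw (r01 i) (fun y => y == 0)).
  rewrite /ret.
  have bs : bd2 (fun j (y : int) => srw j 0 * (y == 0)%:R : R).
    exists 1 => j y; rewrite ger0_norm ?mulr_ge0 ?srw_ge0 ?ler0n//.
    by rewrite mulr_ile1 ?srw_ge0 ?srw_le1//; case: eqP.
  rewrite -[leRHS]/((fun j y => 5 * T n (fun j y => srw j 0 * (y == 0)%:R) j y) 0%N 0).
  rewrite -vopnZ//; apply: le_vopn => //; first exact: bd2_sum.
    have [K hK] := bs; exists (5 * K) => j y.
    by rewrite normrM ger0_norm// ler_wpM2l.
  move=> j y; have := @srw_mixture j I.+1; rewrite big_add1 /= => h.
  case: eqP => _; last by rewrite /= mulr0 mulr0 big1// => i _; rewrite /evw /= !mulr0.
  rewrite mulr1; apply: le_trans (ler_wpM2l (ler0n R 5) h); rewrite mulr_sumr.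
  by apply: ler_sum => i _; rewrite !mulrA divff ?mul1r ?pnatr_eq0.
case: I part => [|I] part; first by rewrite big_geq//; have := part 0%N; rewrite big_nil.
rewrite big_add1 /=.
have part' N : \sum_(0 <= i < I) (2 ^+ i.+1)^-1 * gpart delta nu kappa (rr i.+1) N 0 0 <= 5 * C0.
  apply: le_trans (part N); rewrite big_nat_recr//= lerDl mulr_ge0 ?invr_ge0 ?(ltW (p2 _))//.
  exact: (gpart_ge0 nu kappa delta01 (r01 _)).
have h : (fun N => \sum_(0 <= i < I) (2 ^+ i.+1)^-1 * gpart delta nu kappa (rr i.+1) N 0 0) @ \oo -->
   \sum_(0 <= i < I) (2 ^+ i.+1)^-1 * green delta nu kappa (rr i.+1) 0 0.
  apply: cvg_sum_nat => i; apply: cvgMr.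
  by have [] := green_spec nu kappa delta01 (r01 i) 0 0.
rewrite -(cvg_lim _ h)//; apply: limr_le; first by apply/cvg_ex; eexists; exact: h.
exact: nearW.
Qed.

End green_lower_bound.

(** * Tightness of the heights *)

Section tightness_of_heights.
Context {R : realType}.
Variables (delta : R) (nu : probability int R).
Hypothesis delta01 : 0 < delta < 1.

Let delta01' : 0 <= delta <= 1.
Proof. by case/andP: delta01 => d0 d1; rewrite !ltW. Qed.

Let d0 : 0 < delta. Proof. by case/andP: delta01. Qed.
Let d1 : 0 < 1 - delta. Proof. by case/andP: delta01 => _; rewrite subr_gt0. Qed.

Let bd2_far lam : bd2 (fun _ y => far lam y : R).
Proof. by have [K hK] := @bd_far R lam; exists K => j y; exact: hK. Qed.

(** With kappa = 1 the height is a sum of as many independent variables as there were vertical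
    steps. The induction therefore starts from the law of m earlier vertical steps. *)
Lemma heights_tight_plain (N : nat) (lam q : R) :
  (forall m, (m < N)%N -> Ex (convolution_pow nu m) (far lam) <= q) ->
  forall i, (i < N)%N -> vopn delta nu 1 i (fun _ y => far lam y) 0 0 <= q.
Proof.
move=> hm; set f := fun (_ : nat) (y : int) => far lam y.
suff h : forall k m j, (k + m < N)%N ->
    Ex (convolution_pow nu m) (fun x => vopn delta nu 1 k f j x) <= q.
  by move=> i iN; have := h i 0%N 0%N; rewrite Ex_pow0 addn0; exact.
elim=> [|k ih] m j km; first by apply: hm.
have bk : bd2 (vopn delta nu 1 k f) by apply: vopn_bd => //; exact: bd2_far.
have bk' : bd (fun x => Ex nu (fun z => vopn delta nu 1 k f j (x + 1 ^+ j * z))).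
  by have [K hK] := bk; apply: (@bd_Ex _ _ _ _ K) => x z; exact: hK.
rewrite vopnS /vop ExD ?ExZ//; [|exact: (bd2_row j.+1 id bk)| |exact: bdZ]; last first.
  by apply: bdZ; exact: (bd2_row j.+1 id bk).
have -> : q = delta * q + (1 - delta) * q by ring.
apply: lerD; rewrite ler_wpM2l ?(ltW d0) ?(ltW d1)//.
  by apply: ih; lia.
under eq_Ex do under eq_Ex do rewrite expr1n mul1r.
rewrite -Ex_powS; last exact: (bd2_row j id bk).
by apply: ih; lia.
Qed.

Lemma Dif_S_l m n f : bd f -> Dif nu m.+1 n f = Dif nu m n (fun u => Ex nu (fun z => f (u + z))).
Proof.
move=> bf; have := Dif_add nu m 1 n 0 bf; rewrite addn1 addn0 => ->.
congr (Dif _ _ _ _); apply/funext => u.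
rewrite /Dif Ex_powS ?Ex_pow0; last first.
  by have [K hK] := bf; apply: (@bd_Ex _ _ _ _ K) => x z; exact: hK.
by apply: eq_Ex => z; rewrite Ex_pow0 add0r subr0.
Qed.

Lemma Dif_S_r m n f : bd f -> Dif nu m n.+1 f = Dif nu m n (fun u => Ex nu (fun z => f (u - z))).
Proof.
move=> bf; have := Dif_add nu m 0 n 1 bf; rewrite addn1 addn0 => ->.
congr (Dif _ _ _ _); apply/funext => u.
rewrite /Dif Ex_pow0 Ex_powS ?Ex_pow0; last by exact: bd_comp.
by apply: eq_Ex => z; rewrite !add0r.
Qed.

(* With D the number of upward minus the number of downward vertical steps,
   sigma the current sign and alpha = (1 - delta) / delta, the process
   D ^ 2 + alpha D sigma - alpha k is a martingale in the number k of steps. *)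
Lemma heights_tight_alternating (N : nat) (lam e c : R) : 0 <= c ->
  (forall m0 m1, (m0 + m1 < N)%N ->
     Dif nu m0 m1 (far lam) <= e + c * (m0%:R - m1%:R) ^+ 2) ->
  forall i, (i < N)%N -> vopn delta nu (-1) i (fun _ y => far lam y) 0 0 <=
    e + c * (2 * ((1 - delta) / delta) * N%:R + ((1 - delta) / delta) ^+ 2).
Proof.
move=> c0 hm; set f := fun (_ : nat) (y : int) => far lam y.
pose al := (1 - delta) / delta; rewrite -/al.
have al0 : 0 <= al by rewrite divr_ge0 ?ltW.
pose Q (k j : nat) (D : R) := D ^+ 2 + al * D * (-1) ^+ j + al * k%:R.
suff h : forall k m0 m1 j, (k + (m0 + m1) < N)%N ->
    Dif nu m0 m1 (fun x => vopn delta nu (-1) k f j x) <=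
    e + c * (2 * Q k j (m0%:R - m1%:R) + al ^+ 2).
  move=> i iN; have := h i 0%N 0%N 0%N; rewrite Dif0 !addn0 => /(_ iN) h'.
  apply: (le_trans h'); rewrite /Q subrr expr0n mulr0 mul0r !add0r.
  rewrite lerD2l ler_wpM2l// lerD2r -[2 * al * _]mulrA ler_wpM2l// ler_wpM2l//.
  by rewrite ler_nat ltnW.
elim=> [|k ih] m0 m1 j km.
  have -> : (fun x => vopn delta nu (-1) 0 f j x) = far lam by [].
  apply: (le_trans (hm m0 m1 km)); rewrite lerD2l ler_wpM2l// /Q mulr0 addr0.
  (* With k = 0 the bound 2 Q + alpha ^ 2 exceeds D ^ 2 by exactly (D + alpha sigma) ^ 2. *)
  set D := _ - _; have := sqr_ge0 (D + al * (-1) ^+ j).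
  by rewrite sqrrD exprMn sqrr_sign; lra.
have bk : bd2 (vopn delta nu (-1) k f) by apply: vopn_bd => //; exact: bd2_far.
have bk' : bd (fun x => Ex nu (fun z => vopn delta nu (-1) k f j (x + (-1) ^+ j * z))).
  by have [K hK] := bk; apply: (@bd_Ex _ _ _ _ K) => x z; exact: hK.
have bj i : bd (fun x => vopn delta nu (-1) k f i x) by exact: (bd2_row i id bk).
rewrite vopnS /vop DifD ?DifZ//; [|by apply: bdZ..].
have ih1 := ih m0 m1 j.+1 (ltn_trans (ltnSn _) km).
have hs : Dif nu m0 m1 (fun x => Ex nu (fun z => vopn delta nu (-1) k f j (x + (-1) ^+ j * z))) <=
    e + c * (2 * Q k j (m0%:R - m1%:R + (-1) ^+ j) + al ^+ 2).
  have [oj|oj] := boolP (odd j).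
    have [sR sZ] : (-1) ^+ j = -1 :> R /\ (-1) ^+ j = -1 :> int.
      by rewrite -signr_odd -[in X in _ /\ X]signr_odd oj !expr1.
    under [X in Dif _ _ _ X]eq_fun do under eq_Ex do rewrite sZ mulN1r.
    rewrite sR -Dif_S_r//; have := ih m0 m1.+1 j; rewrite -(natr1 m1) opprD addrA; apply.
    by rewrite addnS addnS; exact: km.
  have [sR sZ] : (-1) ^+ j = 1 :> R /\ (-1) ^+ j = 1 :> int.
    by rewrite -signr_odd -[in X in _ /\ X]signr_odd (negbTE oj) !expr0.
  under [X in Dif _ _ _ X]eq_fun do under eq_Ex do rewrite sZ mul1r.
  rewrite sR -Dif_S_l//; have := ih m0.+1 m1 j; rewrite -(natr1 m0) addrAC; apply.
  by rewrite addSn addnS; exact: km.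
apply: (le_trans (lerD (ler_wpM2l (ltW d0) ih1) (ler_wpM2l (ltW d1) hs))).
set D := m0%:R - m1%:R; rewrite le_eqVlt; apply/orP; left; apply/eqP.
rewrite /Q -(natr1 k) [(-1) ^+ j.+1]exprS.
have ss : (-1) ^+ j * (-1) ^+ j = 1 :> R by rewrite -expr2 sqrr_sign.
move: ss; set s := (-1) ^+ j => ss.
have -> : (D + s) ^+ 2 + al * (D + s) * s + al * k%:R =
   D ^+ 2 + 2 * D * s + s * s + al * D * s + al * (s * s) + al * k%:R by ring.
rewrite ss /al; field; exact: lt0r_neq0.
Qed.

(** z -> min (|z|, L) is subadditive, so it obeys the same linear bound as |z| while staying a
    bounded test function. *)
Lemma truncated_moment_pow (mu1 L : R) d : 0 <= L ->
  Ex nu (fun z => Num.min `|z%:~R| L) <= mu1 ->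
  Ex (convolution_pow nu d) (fun z => Num.min `|z%:~R| L) <= d%:R * mu1.
Proof.
move=> L0 h.
have bm : bd (fun z : int => Num.min `|z%:~R| L : R).
  exists L => z; rewrite ger0_norm ?le_min ?normr_ge0//.
  by rewrite ge_min lexx orbT.
elim: d => [|d ih]; first by rewrite Ex_pow0 mul0r normr0 ge_min lexx.
rewrite Ex_powS// -natr1 mulrDl mul1r.
apply: (@le_trans _ _ (Ex (convolution_pow nu d) (fun z => Num.min `|z%:~R| L + mu1))).
  have [K hK] := bm.
  apply: le_Ex; [by apply: (@bd_Ex _ _ _ _ K) => x z; exact: hK|exact: bdD|move=> x].
  apply: le_trans (lerD (lexx _) h).
  rewrite -[X in _ <= X + _](Ex_cst nu) -ExD//.
  apply: le_Ex; [exact: (bd_comp _ bm)|exact: bdD|move=> z].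
  rewrite intrD; have := ler_normD (x%:~R : R) z%:~R.
  set a := `|x%:~R|; set b := `|z%:~R|; set t := `|_ + _| => tab.
  have a0 : 0 <= a by exact: normr_ge0.
  have b0 : 0 <= b by exact: normr_ge0.
  by case: (leP t L); case: (leP a L); case: (leP b L) => *; lra.
by rewrite ExD// Ex_cst lerD2r.
Qed.

Lemma far_moment (mu1 L : R) d : 0 < L ->
  Ex nu (fun z => Num.min `|z%:~R| L) <= mu1 ->
  Ex (convolution_pow nu d) (far L) <= d%:R * mu1 / L.
Proof.
move=> L0 h; rewrite ler_pdivlMr// mulrC -ExZ; last exact: bd_far.
apply: le_trans (truncated_moment_pow d (ltW L0) h).
apply: le_Ex.
- by apply: bdZ; exact: bd_far.
- exists L => z; rewrite ger0_norm ?le_min ?normr_ge0 ?(ltW L0)//.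
  by rewrite ge_min lexx orbT.
move=> z; rewrite /far; have [hz|hz] := ltP L `|z%:~R|; first by rewrite mulr1.
by rewrite mulr0.
Qed.

(** Pair off equally many upward and downward steps, whose difference is tight; the |m0 - m1|
    unpaired ones are handled by the first moment. Each part gets a threshold L. *)
Lemma far_Dif_moment (mu1 L e : R) m0 m1 : 0 < L -> 0 <= mu1 ->
  Ex nu (fun z => Num.min `|z%:~R| L) <= mu1 ->
  (forall m, (m <= m0 + m1)%N -> Dif nu m m (far L) <= e) ->
  Dif nu m0 m1 (far (L + L)) <= e + `|m0%:R - m1%:R| * mu1 / L.
Proof.
move=> L0 mu0 h1 hD; case: (leqP m1 m0) => m01.
  have e1 := far_Dif_add nu m1 (m0 - m1) m1 0 L L; rewrite subnKC// addn0 in e1.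
  apply: (le_trans e1); apply: lerD; first by apply: hD; exact: leq_addl.
  rewrite -natrB// ger0_norm//; apply: le_trans (far_moment _ L0 h1).
  by rewrite /Dif le_eqVlt; apply/orP; left; apply/eqP; apply: eq_Ex => x; rewrite Ex_pow0 subr0.
have e1 := far_Dif_add nu m0 0 m0 (m1 - m0) L L; rewrite subnKC ?addn0 ?(ltnW m01)// in e1.
apply: (le_trans e1); apply: lerD; first by apply: hD; exact: leq_addr.
rewrite distrC -natrB ?(ltnW m01)// ger0_norm//; apply: le_trans (far_moment _ L0 h1).
rewrite /Dif Ex_pow0 le_eqVlt; apply/orP; left; apply/eqP; apply: eq_Ex => x.
by rewrite add0r far_opp.
Qed.

(** Large m use A_m <= A_N; the finitely many small m share a constant threshold K', which is at
    most (K' / A_1) A_N. *)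
Lemma uniform_tight (D : nat -> R -> R) (A : R^nat) (e : R) :
  (forall n, (0 < n)%N -> 0 < A n) ->
  (forall m n, (0 < m)%N -> (m <= n)%N -> A m <= A n) ->
  (forall m l l', l <= l' -> D m l' <= D m l) ->
  (forall m, exists2 K, 0 < K & D m K <= e) ->
  (exists2 K, 0 < K & exists n0, forall n, (n0 <= n)%N -> D n (K * A n) <= e) ->
  exists2 K, 0 < K & forall N m, (0 < N)%N -> (m <= N)%N -> D m (K * A N) <= e.
Proof.
move=> A0 Ai Dm Ds [K K0 [n0 hK]].
have [K' K'0 hK'] : exists2 K', 0 < K' & forall m, (m <= n0)%N -> D m K' <= e.
  elim: n0 {hK} => [|n [K1 K10 h1]].
    by have [K1 K10 h1] := Ds 0%N; exists K1 => // m; rewrite leqn0 => /eqP ->.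
  have [K2 K20 h2] := Ds n.+1; exists (K1 + K2); first exact: addr_gt0.
  move=> m; rewrite leq_eqVlt => /orP[/eqP ->|mn].
    by apply: le_trans (Dm _ _ _ _) h2; rewrite lerDr ltW.
  by apply: le_trans (Dm _ _ _ _) (h1 m mn); rewrite lerDl ltW.
have A1 := A0 1%N isT.
have K'A : 0 < K' / A 1%N by exact: divr_gt0.
exists (K + K' / A 1%N); first exact: addr_gt0.
move=> N m N0 mN; have AN := A0 N N0.
have [mn|mn] := leqP m n0.
  apply: le_trans (Dm _ _ _ _) (hK' m mn).
  rewrite mulrDl -[leLHS]add0r; apply: lerD; first by rewrite mulr_ge0 ?ltW.
  rewrite mulrAC ler_pdivlMr// ler_wpM2l ?(ltW K'0)//; exact: Ai.
apply: le_trans (Dm _ _ _ _) (hK m (ltnW mn)).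
apply: (@le_trans _ _ (K * A N)).
  by rewrite ler_wpM2l ?(ltW K0)// Ai// (leq_trans _ mn).
by rewrite ler_wpM2r ?(ltW AN)// lerDl ltW.
Qed.

End tightness_of_heights.

Section dyadic_lower_bound.
Context {R : realType}.
Variables (delta : R) (nu : probability int R) (A : R^nat).
Hypothesis delta01 : 0 < delta < 1.
Hypothesis A_gt0 : forall n, (0 < n)%N -> 0 < A n.
Hypothesis A_incr : forall m n, (0 < m)%N -> (m <= n)%N -> A m <= A n.

Definition heights_tight (kappa : int) := exists2 K : R, 0 < K & exists n0,
  forall N, (n0 <= N)%N -> forall i, (i < N)%N ->
    vopn delta nu kappa i (fun _ y => far (K * A N) y) 0 0 <= 1 / 2.

Lemma Ex_far_mono m (l l' : R) : l <= l' ->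
  Ex (convolution_pow nu m) (far l') <= Ex (convolution_pow nu m) (far l).
Proof. by move=> ll; apply: le_Ex => [||x]; [exact: bd_far..|exact: far_mono]. Qed.

Lemma heights_tight_of_tight :
  (exists2 K : R, 0 < K & exists n0, forall n, (n0 <= n)%N ->
     Ex (convolution_pow nu n) (far (K * A n)) <= 1 / 2) -> heights_tight 1.
Proof.
move=> h; have e0 : (0 : R) < 1 / 2 by lra.
have [K K0 hK] := @uniform_tight R (fun m l => Ex (convolution_pow nu m) (far l)) A (1 / 2)
  A_gt0 A_incr Ex_far_mono (fun m => Ex_far_small nu m e0) h.
exists K => //; exists 1%N => N N0 i iN.
apply: (heights_tight_plain delta01 (N := N)) iN => m mN.
by apply: hK => //; exact: ltnW.
Qed.

Lemma heights_tight_of_moment (mu1 : R) : 0 <= mu1 ->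
  (forall L, 0 <= L -> Ex nu (fun z => Num.min `|z%:~R| L) <= mu1) ->
  difference_tight nu A -> difference_spread nu A -> heights_tight (-1).
Proof.
move=> mu0 hmu hT hN; have [d0 d1] := andP delta01.
have e0 : (0 : R) < 1 / 4 by lra.
have [c c0 [n1 hc]] := diffusive_growth A_gt0 A_incr hT hN.
have [K K0 hK] := @uniform_tight R (fun m l => Dif nu m m (far l)) A (1 / 4)
  A_gt0 A_incr (fun m l l' => @far_Dif_mono R nu m m l l')
  (fun m => Dif_far_small nu m e0) (hT _ e0).
pose al := (1 - delta) / delta.
have al0 : 0 <= al by rewrite divr_ge0 ?subr_ge0 ?ltW.
(* Makes the contribution of the unpaired steps, bounded by eta (1 + 2 alpha + alpha ^ 2), equal to
   1/4. *)
pose eta := (4 * (1 + 2 * al + al ^+ 2))^-1.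
have den0 : 0 < 4 * (1 + 2 * al + al ^+ 2).
  by rewrite mulr_gt0// ltr_wpDr ?sqr_ge0// ltr_wpDr// mulr_ge0.
have eta0 : 0 < eta by rewrite invr_gt0.
have sc : 0 < Num.sqrt c by rewrite sqrtr_gt0.
(* K' is chosen so that mu1 / (K' A_N) <= eta / sqrt N *)
pose K' := K + mu1 / (Num.sqrt c * eta).
have K'K : K <= K' by rewrite /K' lerDl divr_ge0// mulr_ge0 ?ltW.
have K'0 : 0 < K' by apply: lt_le_trans K'K.
exists (K' + K'); first by rewrite addr_gt0.
exists n1.+1 => N nN i iN; have N0 : (0 < N)%N by exact: leq_ltn_trans nN.
have AN := A_gt0 N0.
have N0' : (0 : R) < N%:R by rewrite ltr0n.
have sN : 0 < Num.sqrt (N%:R : R) by rewrite sqrtr_gt0.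
have sA : Num.sqrt c * Num.sqrt N%:R <= A N.
  rewrite -sqrtrM ?(ltW c0)// -[leRHS]ger0_norm ?(ltW AN)// -sqrtr_sqr.
  by apply: ler_wsqrtr; apply: hc; exact: ltnW.
have KA : 0 < K' * A N by exact: mulr_gt0.
have muK : mu1 / (K' * A N) <= eta / Num.sqrt N%:R.
  rewrite ler_pdivrMr// mulrAC ler_pdivlMr//.
  apply: (@le_trans _ _ (eta * (mu1 / (Num.sqrt c * eta) * (Num.sqrt c * Num.sqrt N%:R)))).
    rewrite le_eqVlt; apply/orP; left; apply/eqP; field.
    by rewrite !gt_eqF.
  rewrite ler_wpM2l ?(ltW eta0)//; apply: ler_pM; [|by rewrite mulr_ge0 ?ltW|by rewrite /K' lerDr ltW|by []].
  by rewrite divr_ge0// mulr_ge0 ?ltW.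
rewrite mulrDl.
have hD m0 m1 : (m0 + m1 < N)%N -> Dif nu m0 m1 (far (K' * A N + K' * A N)) <=
    (1 / 4 + eta / 2) + eta / (2 * N%:R) * (m0%:R - m1%:R) ^+ 2.
  move=> mN; apply: (le_trans (@far_Dif_moment R nu mu1 (K' * A N) (1 / 4) m0 m1 KA mu0 (hmu _ (ltW KA)) _)).
    move=> m mm; apply: le_trans (hK N m N0 (leq_trans mm (ltnW mN))).
    by apply: far_Dif_mono; rewrite ler_wpM2r ?(ltW AN).
  rewrite -addrA lerD2l -mulrA.
  (* |D| / sqrt N <= 1/2 + D ^ 2 / (2 N) turns the linear term into the quadratic one that
     [heights_tight_alternating] can average. *)
  set D := m0%:R - m1%:R; apply: (@le_trans _ _ (`|D| * (eta / Num.sqrt N%:R))).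
    by rewrite ler_wpM2l.
  rewrite -(real_normK (num_real D)); move: (normr_ge0 D); set x := `|D| => x0.
  set s := Num.sqrt _; have ss : s ^+ 2 = N%:R by rewrite /s sqr_sqrtr.
  rewrite -ss -subr_ge0.
  have -> : eta / 2 + eta / (2 * s ^+ 2) * x ^+ 2 - x * (eta / s) = eta / 2 * (1 - x / s) ^+ 2.
    by field; rewrite gt_eqF.
  by rewrite mulr_ge0 ?sqr_ge0 ?divr_ge0 ?ltW.
have cN : 0 <= eta / (2 * N%:R) by rewrite divr_ge0 ?mulr_ge0 ?ltW.
apply: (le_trans (heights_tight_alternating delta01 cN hD iN)); rewrite -/al.
have N1 : (1 : R) <= N%:R by rewrite ler1n.
apply: (@le_trans _ _ (1 / 4 + eta * (1 + 2 * al + al ^+ 2))).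
  rewrite -addrA lerD2l -subr_ge0.
  have -> : eta * (1 + 2 * al + al ^+ 2) - (eta / 2 + eta / (2 * N%:R) * (2 * al * N%:R + al ^+ 2)) =
     eta * (1 / 2 + al + al ^+ 2 * (1 - N%:R^-1 / 2)).
    by field; rewrite gt_eqF.
  rewrite mulr_ge0 ?(ltW eta0)// !addr_ge0//.
  rewrite mulr_ge0 ?sqr_ge0// subr_ge0 ler_pdivrMr// mul1r.
  by apply: (@le_trans _ _ 1); rewrite ?invf_le1// ler1n.
suff -> : eta * (1 + 2 * al + al ^+ 2) = 1 / 4 by lra.
by rewrite /eta invfM -mulrA mulVf ?mulr1 ?mul1r// gt_eqF// -(pmulr_rgt0 _ (ltr0n R 4)).
Qed.

Lemma green_dyadic_lower (kappa : int) : kappa = 1 \/ kappa = -1 -> heights_tight kappa ->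
  exists2 c : R, 0 < c & exists i0, forall i, (i0 <= i)%N ->
    c * (4 ^+ i / A (4 ^ i)%N) <= green delta nu kappa (1 - (4 ^+ i)^-1) 0 0.
Proof.
move=> k1 [K K0 [n0 hK]]; have [d0 d1] := andP delta01.
have A1 := A_gt0 (ltn0Sn 0).
(* The window has B <= K A_N + 1, so 2 B + 1 <= 2 K A_N + 3, and 3 <= (3 / A_1) A_N. *)
pose C := 2 * K + 3 / A 1%N.
have C0 : 0 < C by rewrite addr_gt0 ?mulr_gt0 ?invr_gt0.
exists (delta ^+ 2 * (1 / 2) ^+ 2 / 256 / C).
  have h2 : (0 : R) < 1 / 2 by lra.
  by rewrite (divr_gt0 _ C0)// mulr_gt0 ?invr_gt0 ?ltr0n// mulr_gt0 ?exprn_gt0.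
exists n0.+1 => i ni.
have ii : (0 < i)%N by exact: leq_ltn_trans ni.
pose n := (2 * 4 ^ i.-1)%N.
have nE : (4 ^ i = n.*2)%N by rewrite /n -mul2n mulnA -expnS prednK.
have np : (0 < n)%N by rewrite muln_gt0 expn_gt0.
have nn0 : (n0 <= 4 ^ i)%N.
  by rewrite (leq_trans (ltnW ni))// ltnW// ltn_expl.
have AN : 0 < A (4 ^ i)%N by apply: A_gt0; rewrite expn_gt0.
pose B := (Num.truncn (K * A (4 ^ i)%N)).+1.
have hB : K * A (4 ^ i)%N <= B%:R by rewrite ltW// truncnS_gt.
have hB2 : B%:R <= K * A (4 ^ i)%N + 1.
  by rewrite /B -natr1 lerD2r truncn_le mulr_ge0 ?ltW.
have := @green_diagonal_lower R delta nu kappa delta01 k1 n B (1 / 2) np _ _.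
rewrite -nE natrX => /(_ _ _); set G := green _ _ _ _ _ _ => hG.
have G0 : 0 <= G.
  have p4 : (1 : R) <= 4 ^+ i.-1 by rewrite exprn_ege1// ler1n.
  apply: (green_ge0 nu kappa delta01); have -> : 4 ^+ i = 4 * 4 ^+ i.-1 :> R by rewrite -exprS prednK.
  have : 0 < (4 * 4 ^+ i.-1)^-1 :> R by rewrite invr_gt0 mulr_gt0// exprn_gt0.
  have : (4 * 4 ^+ i.-1)^-1 <= 2^-1 :> R.
    by rewrite lef_pV2 ?posrE ?mulr_gt0 ?exprn_gt0//; lra.
  by move=> h1 h2; apply/andP; split; lra.
have hw : delta ^+ 2 * (1 / 2) ^+ 2 / 256 * 4 ^+ i <= B.*2.+1%:R * G.
  apply: hG; first by lra.
  move=> j jN.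
  have hj := hK _ nn0 j jN.
  have bf : bd2 (fun _ y => far (K * A (4 ^ i)%N) y : R).
    by have [M hM] := @bd_far R (K * A (4 ^ i)%N); exists M => a y; exact: hM.
  have d01 : 0 <= delta <= 1 by rewrite !ltW.
  have -> : 1 / 2 = 1 + -1 * (1 / 2) :> R by lra.
  apply: (@le_trans _ _ (1 + -1 * vopn delta nu kappa j (fun _ y => far (K * A (4 ^ i)%N) y) 0 0)).
    by rewrite lerD2l !mulN1r lerN2.
  have b1 : bd2 (fun (_ : nat) (_ : int) => 1 : R) by exists 1 => a y; rewrite normr1.
  have b2 : bd2 (fun (_ : nat) y => -1 * far (K * A (4 ^ i)%N) y : R).
    by have [M hM] := bf; exists M => a y; rewrite mulN1r normrN; exact: (hM a).
  have -> : 1 + -1 * vopn delta nu kappa j (fun _ y => far (K * A (4 ^ i)%N) y) 0 0 =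
      vopn delta nu kappa j (fun _ y => 1 + -1 * far (K * A (4 ^ i)%N) y) 0 0.
    by rewrite (vopnD nu kappa d01 j b1 b2) vopn_cst (vopnZ nu kappa d01).
  apply: (le_vopn nu kappa d01) => //.
  - have [M hM] := bf; exists (1 + M) => a y.
    by apply: (le_trans (ler_normD _ _)); rewrite mulN1r normrN normr1 lerD2l; exact: (hM a).
  - by exists 1 => a y; case: inside; rewrite ?normr1 ?normr0.
  move=> _ y; rewrite /far /inside; case: (leqP `|y|%N B) => hy.
    by rewrite mulN1r gerDl oppr_le0 ler0n.
  rewrite (_ : (_ < `|y%:~R|)%R = true) ?mulr1 ?subrr//.
  by apply: (le_lt_trans hB); rewrite -intr_norm pmulrn ltr_int -abszE ltz_nat.
rewrite mulrA ler_pdivrMr//.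
have hC : B.*2.+1%:R <= C * A (4 ^ i)%N.
  have -> : B.*2.+1%:R = 2 * B%:R + 1 :> R by rewrite -(natr1 B.*2) -mul2n natrM.
  have -> : C * A (4 ^ i)%N = 2 * (K * A (4 ^ i)%N) + 3 / A 1%N * A (4 ^ i)%N.
    by rewrite /C; ring.
  have h3 : 3 <= 3 / A 1%N * A (4 ^ i)%N.
    by rewrite mulrAC ler_pdivlMr// ler_wpM2l// A_incr// expn_gt0.
  apply: (@le_trans _ _ (2 * (K * A (4 ^ i)%N + 1) + 1)).
    by rewrite lerD2r ler_wpM2l.
  apply: le_trans (lerD (lexx _) h3); rewrite mulrDr -addrA lerD2l.
  by rewrite mulr1 natr1.
rewrite [leLHS]mulrAC.
rewrite ler_pdivrMr//; apply: (le_trans hw).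
by rewrite mulrC -mulrA ler_wpM2l// [leRHS]mulrC.
Qed.

Lemma dyadic_sum_bounded (kappa : int) : kappa = 1 \/ kappa = -1 -> heights_tight kappa ->
  (exists C0 : R, forall N, \sum_(0 <= n < N) ret delta nu kappa n <= C0) ->
  exists C : R, forall I, \sum_(0 <= i < I) 2 ^+ i / A (4 ^ i)%N <= C.
Proof.
move=> k1 ht [C0 hC0].
have [c c0 [i0 hc]] := green_dyadic_lower k1 ht.
have hg := @green_le_return R delta nu kappa delta01 C0 hC0.
pose b i := 2 ^+ i / A (4 ^ i)%N.
have b0 i : 0 <= b i by rewrite divr_ge0 ?exprn_ge0// ltW// A_gt0// expn_gt0.
pose S0 := \sum_(0 <= i < i0.+1) b i.
exists (S0 + c^-1 * (5 * C0)) => I; rewrite -/(b _).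
apply: (@le_trans _ _ (\sum_(0 <= i < i0.+1 + I) b i)).
  rewrite [leRHS](big_cat_nat (n := I))//= ?leq_addl// lerDl.
  by apply: sumr_ge0 => i _; exact: b0.
rewrite (big_cat_nat (n := i0.+1))//= ?leq_addr// lerD2l.
rewrite -ler_pdivrMl ?invr_gt0// invrK mulr_sumr.
apply: le_trans (hg (i0.+1 + I)%N).
rewrite [leRHS](big_cat_nat (n := i0.+1))//= ?leq_addr//.
have g0 i : (0 < i)%N -> 0 <= green delta nu kappa (1 - (4 ^+ i)^-1) 0 0.
  move=> ii; apply: (green_ge0 nu kappa delta01).
  have p4 : (1 : R) <= 4 ^+ i.-1 by rewrite exprn_ege1// ler1n.
  have -> : 4 ^+ i = 4 * 4 ^+ i.-1 :> R by rewrite -exprS prednK.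
  have : 0 < (4 * 4 ^+ i.-1)^-1 :> R by rewrite invr_gt0 mulr_gt0// exprn_gt0.
  have : (4 * 4 ^+ i.-1)^-1 <= 2^-1 :> R.
    by rewrite lef_pV2 ?posrE ?mulr_gt0 ?exprn_gt0//; lra.
  by move=> h1 h2; apply/andP; split; lra.
apply: (@le_trans _ _ (\sum_(i0.+1 <= i < i0.+1 + I) (2 ^+ i)^-1 *
    green delta nu kappa (1 - (4 ^+ i)^-1) 0 0)); last first.
  rewrite lerDr big_nat; apply: sumr_ge0 => i /andP[i1 _].
  by rewrite mulr_ge0 ?invr_ge0 ?exprn_ge0// g0.
rewrite !big_nat; apply: ler_sum => i /andP[ii _].
apply: (@le_trans _ _ ((2 ^+ i)^-1 * (c * (4 ^+ i / A (4 ^ i)%N)))); last first.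
  by rewrite ler_wpM2l ?invr_ge0 ?exprn_ge0// hc// ltnW.
rewrite /b le_eqVlt; apply/orP; left; apply/eqP.
have -> : 4 ^+ i = 2 ^+ i * 2 ^+ i :> R by rewrite -exprMn; congr (_ ^+ _); ring.
have AN : 0 < A (4 ^ i)%N by apply: A_gt0; rewrite expn_gt0.
by field; rewrite expf_neq0//= gt_eqF.
Qed.

End dyadic_lower_bound.

(** * Recurrence criterion *)

Section countable_disintegration.
Context {R : realType} {d : measure_display} {T : measurableType d}.
Variable mu : {measure set T -> \bar R}.
Local Open Scope ereal_scope.

Lemma esum_single (I : choiceType) (i : I) (a : I -> \bar R) : 0 <= a i ->
  (forall j, j != i -> a j = 0) -> \esum_(j in [set: I]) a j = a i.
Proof.
move=> ai h; rewrite -[RHS](esum_set1 (t := i))//.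
rewrite [RHS]esum_mkcond; apply: eq_esum => j _.
by rewrite in_set1; case: eqVneq => [->//|/h].
Qed.

(** The fibres of X are indexed by [pickle], so that sigma-additivity over nat applies; codes that
    are not attained give empty fibres. *)
Lemma integral_countable (U : countType) (X : T -> U) (D : set T) (g : T -> \bar R) :
  measurable D -> (forall u, measurable [set w | X w = u]) ->
  measurable_fun D g -> (forall w, D w -> 0 <= g w) ->
  \int[mu]_(w in D) g w = \esum_(u in [set: U]) \int[mu]_(w in D `&` [set w | X w = u]) g w.
Proof.
move=> mD mX mg g0; pose F k := D `&` [set w | pickle (X w) = k].
have mF k : measurable (F k).
  apply: measurableI => //; case E : (@pickle_inv U k) => [u|].
    have /eqP := @pickle_invK U k; rewrite E /= => /eqP e.
    rewrite (_ : [set w | _] = [set w | X w = u])//; apply/seteqP; split => w /=.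
      by rewrite -e => /(pcan_inj pickleK).
    by move=> ->.
  rewrite (_ : [set w | _] = set0)//; apply/seteqP; split => w //= h.
  by move: E; rewrite -h pickleK_inv.
have DE : D = \bigcup_k F k.
  apply/seteqP; split => w /=; first by move=> Dw; exists (pickle (X w)).
  by case=> k _ [].
have tF : trivIset setT F.
  by move=> i j _ _ [w [[_ /= <-] [_ /= <-]]].
rewrite [in LHS]DE ge0_integral_bigcup//; [|by rewrite -DE..].
have a0 k : 0 <= \int[mu]_(w in F k) g w.
  by apply: integral_ge0 => w [Dw _]; exact: g0.
rewrite nneseries_esumT//.
rewrite (esumID (range (@pickle U)))//.
rewrite [X in _ + X]esum1 ?adde0; last first.
  move=> k [_ /= nk]; rewrite (_ : F k = set0) ?integral_set0//.
  apply/seteqP; split => w //= [_ /= h]; apply: nk; by exists (X w).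
rewrite setTI esum_image; last by move=> a b _ _; exact: (pcan_inj pickleK).
apply: eq_esum => u _; congr integral; rewrite /F; congr (_ `&` _).
by apply/seteqP; split => w /=; [exact: (pcan_inj pickleK)|move=> ->].
Qed.

Lemma integral_countable_fun (U : countType) (X : T -> U) (D : set T) (f : U -> \bar R) :
  measurable D -> (forall u, measurable [set w | X w = u]) ->
  measurable_fun D (f \o X) -> (forall u, 0 <= f u) ->
  \int[mu]_(w in D) f (X w) = \esum_(u in [set: U]) (f u * mu (D `&` [set w | X w = u])).
Proof.
move=> mD mX mf f0; rewrite (integral_countable mD mX mf); last by move=> w _; exact: f0.
apply: eq_esum => u _.
transitivity (\int[mu]_(w in D `&` [set w | X w = u]) f u).
  by apply: eq_integral => w; rewrite inE => -[_ /= ->].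
by rewrite integral_cst//; exact: measurableI.
Qed.

End countable_disintegration.

(** * Transition operator on Z^2 and reduction to horizontal step counts *)

Section transition.
Context {R : realType}.
Variables (delta : R) (nu : probability int R) (kappa : int).
Hypothesis delta01 : 0 < delta < 1.
Hypothesis kappa1 : kappa = 1 \/ kappa = -1.

Local Notation state := (int * int)%type.
Implicit Types f g : state -> R.

Let delta01' : 0 <= delta <= 1.
Proof. by case/andP: delta01 => d0 d1; rewrite !ltW. Qed.

Definition transition (s t : state) : \bar R :=
  let: (x, y) := s in let: (x', y') := t in
  if (y' == y) && ((x' == x + 1) || (x' == x - 1)) then (delta / 2)%:E
  else if x' == x then ((1 - delta)%:E * nu [set (kappa ^ x * (y' - y))%R])%E
  else 0%E.

Lemma transition_bE : kappa = -1 -> transition_b delta nu = transition.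
Proof. by move=> k; apply/funext => -[x y]; apply/funext => -[x' y']; rewrite /transition k. Qed.

Lemma transition_aE : kappa = 1 -> transition_a delta nu = transition.
Proof.
move=> k; apply/funext => -[x y]; apply/funext => -[x' y'].
by rewrite /transition k exp1rz mul1r.
Qed.

Definition pop f : state -> R := fun s =>
  delta * ((f (s.1 + 1, s.2) + f (s.1 - 1, s.2)) / 2) +
  (1 - delta) * Ex nu (fun z => f (s.1, s.2 + kappa ^ s.1 * z)).

Lemma kappa_pow_sqr (x : int) : kappa ^ x * kappa ^ x = 1.
Proof.
case: kappa1 => ->; first by rewrite exp1rz mulr1.
case: x => n; first by rewrite -exprnP -expr2 sqrr_sign.
by rewrite /exprz -exprVn invrN1 -expr2 sqrr_sign.
Qed.

Lemma pop_norm_le f (K : R) : (forall s, `|f s| <= K) -> forall s, `|pop f s| <= K.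
Proof.
move=> hK s; have [d0 d1] := andP delta01'; rewrite /pop.
have -> : K = delta * K + (1 - delta) * K by ring.
apply: (le_trans (ler_normD _ _)); rewrite !normrM (ger0_norm d0).
rewrite (@ger0_norm _ (1 - delta)) ?subr_ge0//.
apply: lerD; apply: ler_wpM2l => //; rewrite ?subr_ge0//; last exact: Ex_norm_le.
rewrite (@ger0_norm _ 2^-1)// ler_pdivrMr//.
apply: (le_trans (ler_normD _ _)); rewrite mulr_natr mulr2n; exact: lerD.
Qed.

Lemma pop_ge0 f : (forall s, 0 <= f s) -> forall s, 0 <= pop f s.
Proof.
move=> f0 s; have [d0 d1] := andP delta01'.
by rewrite addr_ge0// mulr_ge0 ?subr_ge0 ?divr_ge0 ?addr_ge0//; exact: Ex_ge0.
Qed.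

(** The kernel splits into the right neighbour, the left neighbour and the vertical line. On the
    line, y' = y + kappa ^ x z is a bijective change of variable because kappa ^ x is its own
    inverse. *)
Lemma transition_sum f (s : state) : bd f -> (forall t, 0 <= f t) ->
  (\esum_(t in [set: state]) ((f t)%:E * transition s t) = (pop f s)%:E)%E.
Proof.
move=> bf f0; have [d0 d1] := andP delta01'; case: s => x y.
have d2 : 0 <= delta / 2 by rewrite divr_ge0.
have d1' : 0 <= 1 - delta by rewrite subr_ge0.
pose g1 (t : state) : \bar R := if t == (x + 1, y) then ((f t)%:E * (delta / 2)%:E)%E else 0%E.
pose g2 (t : state) : \bar R := if t == (x - 1, y) then ((f t)%:E * (delta / 2)%:E)%E else 0%E.
pose g3 (t : state) : \bar R := if t.1 == x then
   ((f t)%:E * ((1 - delta)%:E * nu [set (kappa ^ x * (t.2 - y))%R]))%E else 0%E.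
have g10 t : (0 <= g1 t)%E by rewrite /g1; case: eqP => // _; rewrite mule_ge0 ?lee_fin.
have g20 t : (0 <= g2 t)%E by rewrite /g2; case: eqP => // _; rewrite mule_ge0 ?lee_fin.
have g30 t : (0 <= g3 t)%E.
  by rewrite /g3; case: eqP => // _; rewrite !mule_ge0 ?lee_fin.
have -> : (\esum_(t in [set: state]) ((f t)%:E * transition (x, y) t) =
    \esum_(t in [set: state]) (g1 t + (g2 t + g3 t)))%E.
  apply: eq_esum => -[x' y'] _; rewrite /transition /g1 /g2 /g3 !xpair_eqE /=.
  have [->|yy] := eqVneq y' y; rewrite ?andbT ?andbF /=; last first.
    by rewrite !add0e; case: eqP => // _; rewrite mule0.
  have [->|x1] := eqVneq x' (x + 1); rewrite /=.
    have -> : (x + 1 == x - 1) = false by lia.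
    have -> : (x + 1 == x) = false by lia.
    by rewrite !adde0.
  have [->|x2] := eqVneq x' (x - 1); rewrite /=.
    have -> : (x - 1 == x) = false by lia.
    by rewrite add0e adde0.
  by rewrite !add0e; case: eqP => // _; rewrite mule0.
rewrite !esumD//; last by move=> t _; rewrite adde_ge0.
rewrite (@esum_single _ _ (x + 1, y))//; last by move=> j /negbTE h; rewrite /g1 h.
rewrite (@esum_single _ _ (x - 1, y))//; last by move=> j /negbTE h; rewrite /g2 h.
have -> : (\esum_(t in [set: state]) g3 t = \esum_(t in [set t | t.1 == x]) g3 t)%E.
  rewrite [RHS]esum_mkcond; apply: eq_esum => t _.
  by case: ifPn => //; rewrite notin_setE /= /g3 => /negP/negbTE ->.
rewrite (reindex_esum [set: int] _ (fun z => (x, y + kappa ^ x * z))); last first.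
  split=> [z _ //=|z z' _ _ [] /addrI h|[x' y'] /= /eqP ->].
    by rewrite -(mul1r z) -(mul1r z') -(kappa_pow_sqr x) -!mulrA h.
  exists (kappa ^ x * (y' - y)) => //; rewrite mulrA kappa_pow_sqr mul1r.
  by congr pair; ring.
have -> : (\esum_(z in [set: int]) g3 (x, (y + kappa ^ x * z)%R) =
    \esum_(z in [set: int]) ((((1 - delta) * f (x, y + kappa ^ x * z))%R%:E) * nu ([set: int] `&` [set w | w = z])))%E.
  apply: eq_esum => z _; rewrite /g3 /= eqxx setTI EFinM [(_%:E * (f _)%:E)%E]muleC -muleA.
  congr (_ * (_ * nu _))%E; apply/seteqP.
  have -> : kappa ^ x * (y + kappa ^ x * z - y) = z.
    by rewrite addrAC subrr add0r mulrA kappa_pow_sqr mul1r.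
  by split.
rewrite -(@integral_countable_fun _ _ _ nu int (fun z => z) setT
  (fun z => ((1 - delta) * f (x, y + kappa ^ x * z))%:E))//; last first.
  by move=> z; rewrite lee_fin mulr_ge0.
rewrite Ex_EFin//; last by apply: bdZ; exact: bd_comp.
rewrite ExZ; last exact: bd_comp.
by rewrite /g1 /g2 !eqxx /pop /= -!EFinM -!EFinD; congr EFin; field.
Qed.

Lemma pop_bd f : bd f -> bd (pop f).
Proof. by case=> K hK; exists K; exact: pop_norm_le. Qed.

Section srw_average.

Definition srw_step (g : int -> R) (x : int) : R := (g (x - 1) + g (x + 1)) / 2.

Lemma srw_iter j x : iter j srw_step (fun x => (x == 0)%:R) x = srw j x.
Proof. by elim: j x => [//|j ih] x /=; rewrite /srw_step !ih. Qed.

Lemma srw_step_parity j (g g' : int -> R) x :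
  (forall x', odd `|x'| = odd (`|x| + j) -> g x' = g' x') ->
  iter j srw_step g x = iter j srw_step g' x.
Proof.
elim: j x => [|j ih] x gg; first by apply: gg; rewrite addn0.
rewrite /= /srw_step !(ih (x - 1), ih (x + 1))// => x' h; apply: gg; rewrite h; lia.
Qed.

Lemma srw_step_bd j (F : int -> int -> R) (K : R) x : (forall x z, `|F x z| <= K) ->
  forall z, `|iter j srw_step (F^~ z) x| <= K.
Proof.
move=> hK z; elim: j x => [|j ih] x //=.
rewrite /srw_step normrM (@ger0_norm _ 2^-1)// ler_pdivrMr//.
apply: (le_trans (ler_normD _ _)); rewrite mulr_natr mulr2n; exact: lerD.
Qed.

Lemma srw_step_Ex j (F : int -> int -> R) (K : R) x : (forall x z, `|F x z| <= K) ->
  iter j srw_step (fun x => Ex nu (F x)) x = Ex nu (fun z => iter j srw_step (F^~ z) x).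
Proof.
move=> hK; elim: j x => [|j ih] x //=.
rewrite /srw_step !ih -ExD; [|by exists K; exact: srw_step_bd..].
rewrite mulrC -ExZ; first by apply: eq_Ex => z; rewrite mulrC.
by apply: bdD; exists K; exact: srw_step_bd.
Qed.

Lemma srw_step_lin j (a b : R) (g g' : int -> R) x :
  iter j srw_step (fun x => a * g x + b * g' x) x =
  a * iter j srw_step g x + b * iter j srw_step g' x.
Proof. by elim: j x => [//|j ih] x /=; rewrite /srw_step !ih; ring. Qed.

(** Mean of f (X_j, y) over a simple random walk X started at 0. *)
Definition srw_avg f (j : nat) (y : int) : R := iter j srw_step (fun x => f (x, y)) 0.

(** Intertwining of the two operators. After j steps the walk sits at a site x of the parity of j,
    where kappa ^ x = kappa ^ j, so the sign of a vertical step comes out of the average. *)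
Lemma srw_avg_pop f : bd f -> srw_avg (pop f) = vop delta nu kappa (srw_avg f).
Proof.
move=> [K hK]; apply/funext => j; apply/funext => y; rewrite /srw_avg /pop /vop /=.
rewrite srw_step_lin; congr (_ * _ + _ * _).
  rewrite -iterS iterSr; congr (iter _ _ _ _); apply/funext => x.
  by rewrite /srw_step addrC.
rewrite (@srw_step_Ex _ (fun x z => f (x, y + kappa ^ x * z)) K)//.
apply: eq_Ex => z; apply: srw_step_parity => x'; rewrite absz0 add0n => h.
congr f; congr pair; congr (_ + _ * _).
case: kappa1 => ->; first by rewrite exp1rz expr1n.
rewrite -[RHS]signr_odd -h signr_odd; case: x' {h} => n; first by rewrite -exprnP.
by rewrite /exprz -exprVn invrN1.
Qed.

Lemma srw_avg_popn n f : bd f -> srw_avg (iter n pop f) = vopn delta nu kappa n (srw_avg f).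
Proof.
move=> bf; elim: n => [//|n ih]; rewrite iterS srw_avg_pop ?ih//.
by elim: n {ih} => [//|n ih]; rewrite iterS; exact: pop_bd.
Qed.

Lemma ret_popn n : ret delta nu kappa n =
  iter n pop (fun s => (s == (0, 0))%:R) (0, 0).
Proof.
have bf : bd (fun s : state => (s == (0, 0))%:R : R) by exact: bd_indic.
have := congr1 (fun h => h 0%N (0 : int)) (srw_avg_popn n bf).
rewrite {1}/srw_avg /= => ->; rewrite /ret.
congr (vopn _ _ _ _ _ _); apply/funext => j; apply/funext => y.
rewrite /srw_avg -srw_iter.
have -> : (fun x : int => ((x, y) == (0, 0))%:R) =
   (fun x : int => (y == 0)%:R * (x == 0)%:R + 0 * 0 : R).
  by apply/funext => x; rewrite xpair_eqE mulr0 addr0 andbC; case: (y == 0); rewrite ?mul1r ?mul0r.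
by rewrite (srw_step_lin j _ _ _ (fun=> 0)) mul0r addr0 mulrC.
Qed.

End srw_average.

End transition.

(** * Markov property and last visits to the origin *)

Section markov_property.
Context {R : realType}.
Variables (delta : R) (nu : probability int R) (kappa : int).
Hypothesis delta01 : 0 < delta < 1.
Hypothesis kappa1 : kappa = 1 \/ kappa = -1.
Context {d : measure_display} {Omega : measurableType d}.
Variables (P : probability Omega R) (M : nat -> {RV P >-> (int * int)%type}).
Hypothesis hM : markov_chain M (0, 0) (transition delta nu kappa).

Local Notation state := (int * int)%type.
Implicit Types f g : state -> R.
Local Notation pop := (pop delta nu kappa).

(** The past takes values in a countable type, so every set of pasts is measurable and can be split
    into cylinders. *)
Definition path n w : seq state := [seq M k w | k <- iota 0 n.+1].

Lemma size_path n w : size (path n w) = n.+1.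
Proof. by rewrite size_map size_iota. Qed.

Lemma nth_path n w k z : (k <= n)%N -> nth z (path n w) k = M k w.
Proof. by move=> kn; rewrite (nth_map 0%N) ?size_iota// nth_iota. Qed.

Definition cylinder n (x : nat -> state) : set Omega :=
  [set w | forall k, (k <= n)%N -> M k w = x k].

Lemma measurable_preim n (B : set state) : measurable [set w | B (M n w)].
Proof.
have mfn := @measurable_funPT _ _ _ _ (M n).
by rewrite -[X in measurable X]setTI; apply: mfn => //; exact: measurable_int_prod.
Qed.

Lemma measurable_cylinder n x : measurable (cylinder n x).
Proof.
rewrite (_ : cylinder n x = \bigcap_(k in [set k | (k <= n)%N]) [set w | M k w = x k]).
  apply: bigcap_measurableType => k _; exact: (measurable_preim k [set y | y = x k]).
by apply/seteqP; split => w.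
Qed.

Lemma path_eq n (s : seq state) : [set w | path n w = s] =
  if size s == n.+1 then cylinder n (nth (0, 0) s) else set0.
Proof.
apply/seteqP; split=> w /=.
  move=> <-; rewrite size_path eqxx => k kn; by rewrite nth_path.
case: eqP => // ss h; apply: (@eq_from_nth _ (0, 0)); first by rewrite size_path ss.
by move=> k; rewrite size_path ltnS => kn; rewrite nth_path// h.
Qed.

Lemma measurable_path n s : measurable [set w | path n w = s].
Proof. by rewrite path_eq; case: ifP => // _; exact: measurable_cylinder. Qed.

Lemma measurable_past n (Q : set (seq state)) : measurable [set w | Q (path n w)].
Proof.
rewrite (_ : [set w | _] = \bigcup_(s in [set: seq state]) (if `[< Q s >] then [set w | path n w = s] else set0)).
  apply: countable_bigcupT_measurable; first exact: countableP.
  by move=> s; case: ifP => // _; exact: measurable_path.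
apply/seteqP; split => w /=; first by move=> Qw; exists (path n w) => //; rewrite asboolT.
by case=> s _; case: asboolP => // Qs /= ->.
Qed.

Lemma measurable_EFin_M n f : measurable_fun setT (fun w => (f (M n w))%:E).
Proof.
apply/measurable_EFinP.
apply: (@measurableT_comp _ _ _ _ _ _ f); last exact: measurable_funPT.
exact: measurable_fun_int_prod.
Qed.

Lemma cylinder_step n x f : bd f -> (forall s, 0 <= f s) ->
  (\int[P]_(w in cylinder n x) (f (M n.+1 w))%:E =
   \int[P]_(w in cylinder n x) (pop f (M n w))%:E)%E.
Proof.
move=> bf f0; have mc := measurable_cylinder n x.
have Pf : P (cylinder n x) \is a fin_num by rewrite fin_num_measure.
pose c := fine (P (cylinder n x)).
have cE : P (cylinder n x) = c%:E by rewrite fineK.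
have c0 : 0 <= c by rewrite fine_ge0.
transitivity (\int[P]_(w in cylinder n x) (pop f (x n))%:E)%E; last first.
  by apply: eq_integral => w; rewrite inE => h; rewrite (h n (leqnn n)).
transitivity ((pop f (x n))%:E * c%:E)%E; last first.
  by rewrite [RHS]integral_cst//; congr (_ * _)%E; exact/esym/cE.
rewrite (@integral_countable_fun _ _ _ P state (M n.+1) (cylinder n x) (fun t => (f t)%:E))//.
- have -> : ((pop f (x n))%:E * c%:E = (pop (fun s => c * f s)%R (x n))%:E)%E.
    rewrite -EFinM /pop ExZ; last exact: bd_comp.
    congr EFin; ring.
  rewrite -(transition_sum nu delta01 kappa1)//; first last.
  + by move=> t; rewrite mulr_ge0.
  + exact: bdZ.
  apply: eq_esum => t _.
  pose x' k := if k == n.+1 then t else x k.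
  have -> : cylinder n x `&` [set w | M n.+1 w = t] = cylinder n.+1 x'.
    apply/seteqP; split => w /=.
      move=> [h1 h2] k; rewrite leq_eqVlt => /orP[/eqP ->|kn]; rewrite /x' ?eqxx//.
      by rewrite ltn_eqF// h1.
    move=> h; split; last by rewrite h// /x' eqxx.
    by move=> k kn; rewrite h ?(leqW kn)// /x' ltn_eqF.
  have step : P (cylinder n.+1 x') = (c%:E * transition delta nu kappa (x n) t)%E.
    have [_ /(_ n x')] := hM; rewrite /x' eqxx ltn_eqF// -cE => e; apply: etrans e _.
    congr (_ * _)%E; congr (P _).
    by apply/seteqP; split => w h k kn; have := h k kn; rewrite ltn_eqF.
  transitivity ((f t)%:E * (c%:E * transition delta nu kappa (x n) t))%E; last first.
    by rewrite [(c * f t)%:E]EFinM muleA; congr (_ * _)%E; rewrite muleC.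
  by congr (_ * _)%E; exact: step.
- by move=> t; exact: (measurable_preim n.+1 [set y | y = t]).
- by apply: measurable_funTS; exact: measurable_EFin_M.
Qed.

Lemma markov_step n (Q : set (seq state)) f : bd f -> (forall s, 0 <= f s) ->
  (\int[P]_(w in [set w | Q (path n w)]) (f (M n.+1 w))%:E =
   \int[P]_(w in [set w | Q (path n w)]) (pop f (M n w))%:E)%E.
Proof.
move=> bf f0; have mQ := measurable_past n Q.
have pf0 := pop_ge0 nu kappa delta01 f0.
rewrite (integral_countable P mQ (measurable_path n)); first last.
- by move=> w _; rewrite lee_fin.
- by apply: measurable_funTS; exact: measurable_EFin_M.
rewrite (integral_countable P mQ (measurable_path n)); first last.
- by move=> w _; rewrite lee_fin.
- by apply: measurable_funTS; exact: measurable_EFin_M.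
apply: eq_esum => s _.
have [Qs|Qs] := pselect (Q s); last first.
  rewrite (_ : _ `&` _ = set0) ?integral_set0//.
  by apply/seteqP; split => w //= [h e]; apply: Qs; rewrite -e.
have -> : [set w | Q (path n w)] `&` [set w | path n w = s] = [set w | path n w = s].
  by apply/seteqP; split => w /=; [case|move=> e; split => //; rewrite e].
by rewrite path_eq; case: ifP => _; [exact: cylinder_step|rewrite !integral_set0].
Qed.

Lemma P_M0 : P [set w | M 0%N w = (0, 0)] = 1%E.
Proof. by have [] := hM. Qed.

Lemma expectation_M0 f : (forall s, 0 <= f s) ->
  (\int[P]_w (f (M 0%N w))%:E = (f (0, 0))%:E)%E.
Proof.
move=> f0; rewrite (@integral_countable_fun _ _ _ P state (M 0%N) setT (fun t => (f t)%:E))//.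
- rewrite (@esum_single _ _ (0, 0)).
  + by rewrite setTI [X in (_ * X)%E](_ : _ = 1%E) ?mule1//; exact: P_M0.
  + by rewrite mule_ge0// lee_fin.
  + move=> t t0; rewrite setTI [X in (_ * X)%E](_ : _ = 0%E) ?mule0//.
    apply/eqP; rewrite -measure_le0.
    have <- : P (~` [set w | M 0%N w = (0, 0)]) = 0%E.
      rewrite probability_setC; last exact: (measurable_preim 0 [set y | y = (0, 0)]).
      by rewrite [X in (1 - X)%E](_ : _ = 1%E) ?subee//; exact: P_M0.
    apply: le_measure; rewrite ?inE.
    * exact: (measurable_preim 0 [set y | y = t]).
    * by apply: measurableC; exact: (measurable_preim 0 [set y | y = (0, 0)]).
    * by move=> w /= -> h; move: t0; rewrite h eqxx.
- by move=> t; exact: (measurable_preim 0 [set y | y = t]).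
- exact: measurable_EFin_M.
Qed.

Lemma law_popn n f : bd f -> (forall s, 0 <= f s) ->
  (\int[P]_w (f (M n w))%:E = (iter n pop f (0, 0))%:E)%E.
Proof.
elim: n f => [|n ih] f bf f0; first exact: expectation_M0.
rewrite iterSr -ih; [|exact: pop_bd|exact: (pop_ge0 nu kappa delta01)].
by have := markov_step n [set: seq state] bf f0.
Qed.

Definition at_origin n : set Omega := [set w | M n w = (0, 0)].

Lemma measurable_at_origin n : measurable (at_origin n).
Proof. exact: (measurable_preim n [set y | y = (0, 0)]). Qed.

Lemma P_at_origin n : P (at_origin n) = (ret delta nu kappa n)%:E.
Proof.
rewrite (ret_popn nu delta01 kappa1) -law_popn//.
transitivity (\int[P]_w (\1_(at_origin n) w)%:E)%E.
  by rewrite integral_indic ?setIT//; exact: measurable_at_origin.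
apply: eq_integral => w _; rewrite indicE; congr (_%:R)%:E; congr nat_of_bool.
by apply/idP/idP; rewrite inE => /eqP.
Qed.

Definition last_visit n k : set Omega :=
  [set w | M n w = (0, 0) /\ forall i, (0 < i <= k)%N -> M (n + i) w <> (0, 0)].

(** One step killed upon entering the origin. *)
Definition taboo g : state -> R := pop (fun s => (s != (0, 0))%:R * g s).

Lemma bd_taboo_arg g : bd g -> bd (fun s : state => (s != (0, 0))%:R * g s : R).
Proof. by move=> bg; apply: bdM => //; exact: bd_indic. Qed.

Lemma last_visit_past n k : last_visit n k = [set w |
  [set s : seq state | nth (0, 0) s n = (0, 0) /\
     forall i, (0 < i <= k)%N -> nth (0, 0) s (n + i) <> (0, 0)] (path (n + k) w)].
Proof.
apply/seteqP; split => w /= [h1 h2]; split.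
- by rewrite nth_path ?leq_addr.
- by move=> i ik; rewrite nth_path ?leq_add2l; [exact: h2|case/andP: ik].
- by move: h1; rewrite nth_path ?leq_addr.
- by move=> i ik; have := h2 i ik; rewrite nth_path ?leq_add2l//; case/andP: ik.
Qed.

Lemma measurable_last_visit n k : measurable (last_visit n k).
Proof. by rewrite last_visit_past; exact: measurable_past. Qed.

Lemma taboo_popn n k g : bd g -> (forall s, 0 <= g s) ->
  (\int[P]_(w in last_visit n k) (g (M (n + k) w))%:E =
   (ret delta nu kappa n * iter k taboo g (0, 0))%:E)%E.
Proof.
elim: k g => [|k ih] g bg g0.
  transitivity (\int[P]_(w in at_origin n) (g (0, 0))%:E)%E.
    have -> : last_visit n 0 = at_origin n.
      by apply/seteqP; split => w /=; [case|move=> h; split => // i; case: i].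
    by apply: eq_integral => w; rewrite inE addn0 => ->.
  rewrite integral_cst; last exact: measurable_at_origin.
  by rewrite EFinM muleC; congr (_ * _)%E; exact: P_at_origin.
have bg' := bd_taboo_arg bg.
have g0' s : 0 <= (s != (0, 0))%:R * g s by rewrite mulr_ge0.
transitivity (\int[P]_(w in last_visit n k)
   ((fun s : state => (s != (0, 0))%:R * g s) (M (n + k).+1 w))%:E)%E.
  rewrite addnS [LHS]integral_mkcond [RHS]integral_mkcond; apply: eq_integral => w _.
  rewrite /patch; case: ifPn; rewrite ?inE ?notin_setE.
    move=> [h1 h2]; rewrite mem_set; last first.
      by split => // i /andP[i0 ik]; apply: h2; rewrite i0 leqW.
    by have /eqP := h2 k.+1 ltac:(lia); rewrite addnS => ->; rewrite mul1r.
  move=> nh; case: ifPn => //; rewrite inE => -[h1 h2].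
  case: eqP => [_|e]; first by rewrite mul0r.
  case: nh; split => // i /andP[i0]; rewrite leq_eqVlt => /orP[/eqP ->|ik].
    by rewrite addnS.
  by apply: h2; rewrite i0.
rewrite last_visit_past (markov_step (n + k) _ bg' g0') -last_visit_past.
by rewrite iterSr -ih//; [exact: pop_bd|exact: (pop_ge0 nu kappa delta01)].
Qed.

Definition escape k : R := iter k taboo (fun=> 1) (0, 0).

(** Restarting at a visit to the origin: the probability of no return within k steps is the same at
    every visit. *)
Lemma P_last_visit n k : P (last_visit n k) = (ret delta nu kappa n * escape k)%:E.
Proof.
rewrite /escape -taboo_popn//; by rewrite integral_cst ?mul1e//; exact: measurable_last_visit.
Qed.

Lemma ret_ge0 n : 0 <= ret delta nu kappa n.
Proof. by rewrite -lee_fin -P_at_origin. Qed.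

Lemma ret0 : ret delta nu kappa 0 = 1.
Proof. by apply: EFin_inj; rewrite -P_at_origin; exact: P_M0. Qed.

Lemma escape_E k : (escape k)%:E = P (last_visit 0 k).
Proof. by rewrite P_last_visit ret0 mul1r. Qed.

Lemma escape_ge0 k : 0 <= escape k.
Proof. by rewrite -lee_fin escape_E. Qed.

Lemma escape_mono k l : (k <= l)%N -> escape l <= escape k.
Proof.
move=> kl; rewrite -lee_fin !escape_E; apply: le_measure; rewrite ?inE; try exact: measurable_last_visit.
by move=> w [h1 h2]; split => // i /andP[i0 ik]; apply: h2; rewrite i0 (leq_trans ik).
Qed.

(* The last visits before time N form disjoint events. *)
Lemma escape_green N : escape N * \sum_(0 <= n < N.+1) ret delta nu kappa n <= 1.
Proof.
pose F (i : 'I_N.+1) := last_visit i (N - i).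
have tF : trivIset setT F.
  suff h (i j : 'I_N.+1) w : F i w -> F j w -> (i < j)%N -> False.
    move=> i j _ _ [w [Fi Fj]]; apply/val_inj/eqP; rewrite eqn_leq.
    by apply/andP; split; rewrite leqNgt; apply/negP => ij;
      [exact: (h _ _ _ Fj Fi ij)|exact: (h _ _ _ Fi Fj ij)].
  move=> [_ h2] [h3 _] ij; have := h2 (j - i)%N; rewrite subnKC ?(ltnW ij)//.
  by apply; rewrite // subn_gt0 ij leq_sub2r// -ltnS.
have mF i : measurable (F i) by exact: measurable_last_visit.
have sumE : P (\big[setU/set0]_(i < N.+1) F i) =
    (\sum_(i < N.+1) ret delta nu kappa i * escape (N - i))%R%:E.
  rewrite -sumEFin; rewrite (eq_bigr (fun i => P (F i))).
    exact: (measure_bigsetU_ord P xpredT mF tF).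
  by move=> i _; exact/esym/P_last_visit.
have h : \sum_(i < N.+1) ret delta nu kappa i * escape (N - i) <= 1.
  rewrite -lee_fin -sumE; apply: probability_le1.
  by apply: bigsetU_measurable => i _; exact: mF.
apply: le_trans h.
rewrite big_mkord mulr_sumr; apply: ler_sum => i _.
by rewrite mulrC ler_wpM2l ?ret_ge0// escape_mono// leq_subr.
Qed.

(** Borel-Cantelli. *)
Lemma transient_of_bounded : (exists C : R, forall N, \sum_(0 <= n < N) ret delta nu kappa n <= C) ->
  transient M.
Proof.
move=> [C hC]; exists (lim_sup_set at_origin); split.
- apply: bigcap_measurableType => k _; apply: bigcup_measurable => j _.
  exact: measurable_at_origin.
- apply: lim_sup_set_cvg0; first exact: measurable_at_origin.
  apply: (@le_lt_trans _ _ C%:E); last exact: ltry.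
  apply: lime_le; first by apply: is_cvg_nneseries => n _ _.
  apply: nearW => N; rewrite (eq_bigr (fun n => (ret delta nu kappa n)%:E)); last first.
    by move=> n _; exact: P_at_origin.
  by rewrite sumEFin lee_fin.
move=> w /= nfin k _; apply: contrapT => h; apply: nfin.
apply: (@sub_finite_set _ _ [set n | (n < k)%N]); last exact: finite_II.
move=> n /= nw; rewrite ltnNge; apply/negP => kn; apply: h; by exists n.
Qed.

(** By [escape_green] the probabilities [escape k] tend to 0, so for each n it is negligible that n
    is the last visit. Finitely many visits, one of them at time 0, would leave a last one. *)
Lemma recurrent_of_unbounded :
  ~ (exists C : R, forall N, \sum_(0 <= n < N) ret delta nu kappa n <= C) -> recurrent M.
Proof.
move=> hC.
have esc0 (e : R) : 0 < e -> exists k, escape k <= e.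
  move=> e0; apply: contrapT => h; apply: hC; exists e^-1 => N.
  have hN : e < escape N by rewrite ltNge; apply/negP => hh; apply: h; exists N.
  have := escape_green N; rewrite big_nat_recr//= => hh.
  rewrite -[leRHS]mul1r ler_pdivlMr// mulrC; apply: le_trans hh.
  apply: ler_pM; rewrite ?(ltW e0) ?(ltW hN)//; first by apply: sumr_ge0 => n _; exact: ret_ge0.
  by rewrite lerDl ret_ge0.
pose E n := \bigcap_k last_visit n k.
have PE n : P.-negligible (E n).
  exists (E n); split => //; first by apply: bigcap_measurableType => k _; exact: measurable_last_visit.
  apply/eqP; rewrite -measure_le0; apply/lee_addgt0Pr => e e0; rewrite add0e.
  have [k hk] := esc0 e e0.
  apply: (@le_trans _ _ (P (last_visit n k))).
    apply: le_measure; rewrite ?inE; [|exact: measurable_last_visit|by move=> w; apply].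
    by apply: bigcap_measurableType => i _; exact: measurable_last_visit.
  rewrite P_last_visit lee_fin; apply: le_trans hk.
  rewrite ler_piMl ?escape_ge0// -lee_fin -P_at_origin.
  exact/probability_le1/measurable_at_origin.
have P0 : P.-negligible (~` at_origin 0).
  exists (~` at_origin 0); split => //; first exact/measurableC/measurable_at_origin.
  by rewrite probability_setC ?[X in (1 - X)%E]P_M0 ?subee//; exact: measurable_at_origin.
have := negligibleU P0 (negligible_bigcup PE); apply: negligibleS => w /= nfin.
have fin : finite_set [set n | M n w = (0, 0)] by apply: contrapT.
have [h0|h0] := pselect (M 0%N w = (0, 0)); last by left.
right; have [n [nw hn]] : exists n, M n w = (0, 0) /\ forall m, (n < m)%N -> M m w <> (0, 0).
  have [B hB] : exists B, forall n, M n w = (0, 0) -> (n <= B)%N.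
    have /finite_seqP[s hs] := fin; exists (\max_(i <- s) i)%N => n nw.
    have ns : n \in s by have : [set n | M n w = (0, 0)] n by []; rewrite hs.
    exact: (@leq_bigmax_seq _ s predT id).
  have [n /eqP nw nmax] := @ex_maxnP (fun n => M n w == (0, 0)) B
    (ex_intro _ 0%N (introT eqP h0)) (fun n h => hB n (elimT eqP h)).
  exists n; split => // m nm mw; have := nmax m (introT eqP mw); lia.
exists n => // k _; split => // i /andP[i0 _]; apply: hn; lia.
Qed.

Lemma not_recurrent_transient : transient M -> ~ recurrent M.
Proof.
move=> ht hr; have : {ae P, forall w, False}.
  by apply: filterS2 ht hr => w fin inf; exact: inf.
move=> [N [mN PN h]].
have : P [set: Omega] = 0%E.
  apply/eqP; rewrite -measure_le0 -PN; apply: le_measure; rewrite ?inE//.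
  by move=> w _; apply: h => /= f.
by rewrite probability_setT => /eqP; rewrite onee_eq0.
Qed.

End markov_property.

(** * Consequences of weak convergence *)

Section test_functions.
Context {R : realType}.

Lemma lipschitz1_continuous (f : R -> R) :
  (forall x y, `|f x - f y| <= `|x - y|) -> continuous f.
Proof.
move=> lf x; apply/cvgrPdist_le => e e0; near=> y.
apply: le_trans (lf x y) _; near: y.
have h : (y : R) @[y --> x] --> x by exact: cvg_id.
by have /cvgrPdist_le /(_ e e0) := h.
Unshelve. all: by end_near. Qed.

Lemma continuous_measurable (f : R -> R) : continuous f -> measurable_fun setT f.
Proof. by move=> /continuous_subspaceT/subspace_continuous_measurable_fun; apply. Qed.

Definition capped (c u : R) : R := Num.min 1 (c * `|u|).

Lemma continuous_capped c : continuous (capped c).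
Proof.
move=> x; apply: (@continuous_min R R (fun=> 1) (fun u => c * `|u|)).
  exact: cst_continuous.
by apply: continuousM; [exact: cst_continuous|exact: norm_continuous].
Qed.

Lemma capped01 c u : 0 <= c -> 0 <= capped c u <= 1.
Proof. by move=> c0; rewrite /capped le_min ler01 mulr_ge0//= ge_min lexx. Qed.

Lemma bd_capped c : 0 <= c -> bd (capped c).
Proof. by move=> c0; exists 1 => u; have /andP[h1 h2] := capped01 u c0; rewrite ger0_norm. Qed.

(** A bounded, injective, 1-Lipschitz substitute for the identity: it has a variance even when the
    limit law has none, and this variance detects degeneracy. *)
Definition squash (u : R) : R := u / (1 + `|u|).

Lemma squash_norm_le1 u : `|squash u| <= 1.
Proof.
have h : 0 < 1 + `|u| by rewrite ltr_pwDl.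
by rewrite normrM normfV (gtr0_norm h) ler_pdivrMr// mul1r lerDr.
Qed.

Lemma squash_inj : injective squash.
Proof.
move=> u v; rewrite /squash => /eqP.
have hu : 0 < 1 + `|u| by rewrite ltr_pwDl.
have hv : 0 < 1 + `|v| by rewrite ltr_pwDl.
rewrite eqr_div; [move=> /eqP|by rewrite gt_eqF..].
by have [u0|u0] := ger0P u; have [v0|v0] := ger0P v => h; nra.
Qed.

Lemma squash_lipschitz u v : `|squash u - squash v| <= `|u - v|.
Proof.
have hu : 0 < 1 + `|u| by rewrite ltr_pwDl.
have hv : 0 < 1 + `|v| by rewrite ltr_pwDl.
have -> : squash u - squash v = (u - v + (u * `|v| - v * `|u|)) / ((1 + `|u|) * (1 + `|v|)).
  by rewrite /squash; field; rewrite !gt_eqF.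
rewrite normrM normfV (gtr0_norm (mulr_gt0 hu hv)) ler_pdivrMr ?mulr_gt0//.
have [u0|u0] := ger0P u; have [v0|v0] := ger0P v.
- rewrite [v * u]mulrC subrr addr0 ler_peMr//.
  by have := mulr_ge0 u0 v0; nra.
- rewrite !ger0_norm; nra.
- rewrite !ler0_norm; nra.
- have -> : u - v + (u * - v - v * - u) = u - v by ring.
  rewrite ler_peMr//; nra.
Qed.

End test_functions.

Section weak_limits.
Context {R : realType}.
Variables (rho : probability int R) (A : R^nat) (mu : probability R R).
Hypothesis A_gt0 : forall n, (0 < n)%N -> 0 < A n.
Hypothesis rho_mu : weakly_converges (rescaled_pow rho A) mu.

Lemma weak_Ex f : continuous f -> bd f ->
  (fun n => Ex (convolution_pow rho n) (fun x => f (x%:~R / A n))) @ \oo --> Ex mu f.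
Proof.
move=> cf bf; have mf := continuous_measurable cf.
have := rho_mu cf bf; rewrite Ex_EFin// => /fine_cvg.
apply: cvg_trans; apply: near_eq_cvg; apply: nearW => n /=.
by rewrite Ex_EFin// Ex_rescaled.
Qed.

Lemma weak_le f (a b : R) : continuous f -> bd f -> Ex mu f < b ->
  exists n0, forall n, (n0 <= n)%N ->
    Ex (convolution_pow rho n) (fun x => f (x%:~R / A n)) <= b.
Proof.
move=> cf bf h; have e0 : 0 < b - Ex mu f by rewrite subr_gt0.
have /cvgrPdist_le /(_ _ e0) [n0 _ hn] := weak_Ex cf bf.
exists n0 => n /hn /=; rewrite ler_distl => /andP[+ _]; lra.
Qed.

Lemma weak_tight (eps : R) : 0 < eps -> exists2 K : R, 0 < K &
  exists n0, forall n, (n0 <= n)%N ->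
    Ex (convolution_pow rho n) (far (K * A n)) <= eps.
Proof.
move=> e0; have e4 : 0 < eps / 4 by lra.
have [L L0 hL] := @Ex_tail_small R _ _ mu (fun u => u) _ (@measurable_id _ _ _) e4.
(* Small enough that [capped c] is at most eps / 4 on [-L, L]; it equals 1 beyond 1 / c, the
   threshold K. *)
pose c := eps / (4 * L).
have c0 : 0 < c by rewrite divr_gt0// mulr_gt0.
have cL : c * L = eps / 4 by rewrite /c; field; rewrite gt_eqF.
have mc := continuous_measurable (@continuous_capped R c).
have h : Ex mu (capped c) < eps.
  apply: (@le_lt_trans _ _ (Ex mu (fun u => (L < `|u|)%R%:R + c * L))).
    apply: le_Ex_meas => //.
    - by apply: measurable_funD => //; exact: (measurable_exceeds (f := id)).
    - exact/bd_capped/ltW.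
    - exact: bdD.
    - move=> u; rewrite /capped ge_min; case: ltP => h.
        by rewrite lerDl mulr_ge0// ltW.
      by rewrite add0r ler_wpM2l ?orbT// ltW.
  rewrite ExD_meas//; last exact: (measurable_exceeds (f := id)).
  rewrite Ex_cst cL; lra.
have [n1 hn] := weak_le 0 (@continuous_capped R c) (bd_capped (ltW c0)) h.
exists c^-1; first by rewrite invr_gt0.
exists n1.+1 => n nn; have An : 0 < A n by apply: A_gt0; exact: leq_ltn_trans nn.
apply: le_trans (hn n (ltnW nn)); apply: le_Ex => [||x]; first exact: bd_far.
  exact/bd_comp/bd_capped/ltW.
rewrite /far; case: ltP => hx; last by have /andP[] := capped01 (x%:~R / A n) (ltW c0).
rewrite /capped le_min lexx /= normrM normfV (gtr0_norm An) mulrA ler_pdivlMr// mul1r.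
by rewrite -ler_pdivrMl// ltW.
Qed.

Lemma Ex_eq0 f : measurable_fun setT f -> bd f -> (forall u, 0 <= f u) ->
  Ex mu f = 0 -> mu [set u | f u = 0] = 1%E.
Proof.
move=> mf bf f0 h.
have mE : measurable_fun setT (EFin \o f) by exact/measurable_EFinP.
have : (\int[mu]_u `|(EFin \o f) u|)%E = 0%E.
  rewrite -[RHS]/(0%:E) -h -Ex_EFin//; apply: eq_integral => u _ /=.
  by rewrite ger0_norm.
move/(ae_eq_integral_abs mu measurableT mE) => [N [mN N0 hN]].
have mS : measurable [set u | f u = 0].
  by rewrite -[X in measurable X]setTI; exact: (mf measurableT [set 0]).
apply/eqP; rewrite eq_le probability_le1//=.
have := probability_setC mu mS.
have -> : mu (~` [set u | f u = 0]) = 0%E.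
  apply/eqP; rewrite -measure_le0 -N0; apply: le_measure; rewrite ?inE//.
    exact: measurableC.
  move=> u hu; apply: hN => /= hh; apply: hu.
  by have := hh I => -[].
have Sf : mu [set u | f u = 0] \is a fin_num by exact: fin_num_measure.
rewrite -(fineK Sf); move: (fine _) => r /(congr1 fine) /= r1.
by rewrite lee_fin; lra.
Qed.

Hypothesis mu_nondegenerate : forall x : R, mu [set x] <> 1%E.

Lemma mu_probability0 : mu set0 <> 1%E.
Proof. by rewrite measure0 => /eqP; rewrite eq_sym onee_eq0. Qed.

Lemma Ex_capped_gt0 : 0 < Ex mu (capped 1).
Proof.
have c01 u := @capped01 R 1 u ler01.
rewrite lt_neqAle Ex_ge0 ?andbT; last by move=> u; have /andP[] := c01 u.
apply/eqP => /esym/Ex_eq0 h; apply: (mu_nondegenerate (x := 0)); rewrite -h//.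
- congr (mu _); apply/seteqP; split => u /=.
    by move=> ->; rewrite /capped normr0 mulr0 min_r.
  rewrite /capped mul1r; have [hu|hu] := leP 1 `|u|; first by move=> /eqP; rewrite oner_eq0.
  exact: normr0_eq0.
- by apply: continuous_measurable; exact: continuous_capped.
- exact: bd_capped.
- by move=> u; have /andP[] := c01 u.
Qed.

Lemma bd_squash : bd (@squash R).
Proof. by exists 1; exact: squash_norm_le1. Qed.

Lemma continuous_squash : continuous (@squash R).
Proof. exact/lipschitz1_continuous/squash_lipschitz. Qed.

Lemma continuous_squash2 : continuous (fun u : R => squash u * squash u).
Proof. by move=> x; apply: continuousM; exact: continuous_squash. Qed.

Lemma variance_squash_gt0 :
  0 < Ex mu (fun u => squash u * squash u) - Ex mu (@squash R) ^+ 2.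
Proof.
have ms := continuous_measurable continuous_squash; have bs := bd_squash.
have ms2 := continuous_measurable continuous_squash2; have bs2 := bdM bs bs.
set m := Ex mu (@squash R).
have -> : Ex mu (fun u => squash u * squash u) - m ^+ 2 =
    Ex mu (fun u => (squash u - m) * (squash u - m)).
  have -> : (fun u => (squash u - m) * (squash u - m)) =
      (fun u => (squash u * squash u + (- (2 * m)) * squash u) + m ^+ 2).
    by apply/funext => u; ring.
  rewrite ExD_meas//; [|by apply: measurable_funD => //; exact: measurable_funM
    |by apply: bdD => //; exact: bdZ].
  rewrite ExD_meas//; [|exact: measurable_funM|exact: bdZ].
  by rewrite ExZ_meas// Ex_cst -/m; ring.
rewrite lt_neqAle Ex_ge0 ?andbT; last by move=> u; rewrite -expr2 sqr_ge0.
apply/eqP => /esym/Ex_eq0 h.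
have {h} h : mu [set u | squash u = m] = 1%E.
  rewrite -h.
  - congr (mu _); apply/seteqP; split => u /=; first by move=> ->; rewrite subrr mul0r.
    by move=> /eqP; rewrite -expr2 sqrf_eq0 subr_eq0 => /eqP.
  - by apply: measurable_funM; apply: measurable_funB.
  - by apply: bdM; apply: bdB.
  - by move=> u; rewrite -expr2 sqr_ge0.
have [[u0 hu0]|hn] := pselect (exists u, squash u = m).
  apply: (mu_nondegenerate (x := u0)); rewrite -h; congr (mu _).
  by apply/seteqP; split => u /=; [move=> ->|rewrite -hu0; exact: squash_inj].
apply: mu_probability0; rewrite -h; congr (mu _).
by apply/seteqP; split => u //= hu; apply: hn; exists u.
Qed.

End weak_limits.

Lemma variance_difference {R : realType} (p : probability int R) (F : int -> R) : bd F ->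
  2 * (Ex p (fun x => F x * F x) - Ex p F ^+ 2) =
  Ex p (fun x => Ex p (fun y => (F x - F y) * (F x - F y))).
Proof.
move=> bF; have bF2 := bdM bF bF.
transitivity (Ex p (fun x => F x * F x + ((- 2 * Ex p F) * F x + Ex p (fun y => F y * F y)))).
  rewrite ExD//; last by apply: bdD => //; exact: bdZ.
  by rewrite ExD ?ExZ ?Ex_cst//; [ring|exact: bdZ].
apply: eq_Ex => x.
have -> : (fun y => (F x - F y) * (F x - F y)) =
    (fun y => F x * F x + ((- 2 * F x) * F y + F y * F y)).
  by apply/funext => y; ring.
rewrite ExD//; last by apply: bdD => //; exact: bdZ.
by rewrite ExD ?ExZ ?Ex_cst//; [ring|exact: bdZ].
Qed.

Section weak_limits_plain.
Context {R : realType}.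
Variables (nu : probability int R) (A : R^nat) (mu : probability R R).
Hypothesis A_gt0 : forall n, (0 < n)%N -> 0 < A n.
Hypothesis nu_mu : weakly_converges (rescaled_pow nu A) mu.
Hypothesis mu_nondegenerate : forall x : R, mu [set x] <> 1%E.

Lemma difference_tight_plain : difference_tight nu A.
Proof.
move=> eps e0; have e2 : 0 < eps / 2 by lra.
have [K K0 [n0 h]] := weak_tight A_gt0 nu_mu e2.
exists (K + K); first by rewrite addr_gt0.
exists n0 => n nn; rewrite mulrDl; apply: le_trans (far_Dif_le _ _ _ _ _) _.
by have -> : eps = eps / 2 + eps / 2 :> R; [field|apply: lerD; exact: h].
Qed.

(** Twice a variance is the mean squared difference of two independent copies: at most 4 when they
    are far apart, and at most a ^ 2 otherwise by the Lipschitz property. *)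
Lemma squash_difference (lam : R) (n : nat) (a : R) : 0 < a -> 0 < lam ->
  2 * (Ex (convolution_pow nu n) (fun x => squash (x%:~R / lam) * squash (x%:~R / lam)) -
       Ex (convolution_pow nu n) (fun x => squash (x%:~R / lam)) ^+ 2)
  <= 4 * Dif nu n n (far (a * lam)) + a ^+ 2.
Proof.
move=> a0 l0; pose F (x : int) := squash (x%:~R / lam); set p := convolution_pow nu n.
rewrite -[X in X ^+ 2]/(Ex p F) -[X in X - _]/(Ex p (fun x => F x * F x)).
have bF : bd F by exists 1 => x; exact: squash_norm_le1.
have bF2 := bdM bF bF.
rewrite variance_difference//.
have bf : bd (fun z : int => 4 * far (a * lam) z + a ^+ 2).
  by apply: bdD => //; apply: bdZ; exact: bd_far.
have -> : 4 * Dif nu n n (far (a * lam)) + a ^+ 2 =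
    Dif nu n n (fun z => 4 * far (a * lam) z + a ^+ 2).
  by rewrite DifD ?DifZ ?Dif_cst//; [exact: bd_far|apply: bdZ; exact: bd_far].
have hF x y : `|F x - F y| <= 2.
  apply: (le_trans (ler_normB _ _)).
  by have -> : 2 = 1 + 1 :> R by []; rewrite lerD// squash_norm_le1.
rewrite /Dif -/p; apply: le_Ex; [|exact: (@bd_Dif_inner R nu n _ bf)|move=> x].
  apply: (@bd_Ex _ _ _ _ 4) => x y; rewrite normrM.
  by have -> : 4 = 2 * 2 :> R; [ring|exact: ler_pM].
apply: le_Ex; [by apply: bdM; exact: bdB|exact: (@bd_comp R _ _ _ (fun y => x - y) bf)|move=> y].
rewrite -expr2 -(real_normK (num_real (F x - F y))) /far; case: ltP => h.
  apply: (@le_trans _ _ (2 ^+ 2)); first by rewrite ler_pXn2r ?nnegrE.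
  by have -> : 2 ^+ 2 = 4 * 1 :> R by [ring]; rewrite lerDl sqr_ge0.
rewrite mulr0 add0r ler_pXn2r ?nnegrE ?(ltW a0)//.
apply: (le_trans (squash_lipschitz _ _)).
by rewrite -mulrBl -intrB normrM normfV (gtr0_norm l0) ler_pdivrMr.
Qed.

Lemma difference_spread_plain : difference_spread nu A.
Proof.
have V0 := variance_squash_gt0 mu_nondegenerate.
set V := Ex mu _ - _ in V0.
have h1 := weak_Ex nu_mu (@continuous_squash R) (@bd_squash R).
have h2 := weak_Ex nu_mu (@continuous_squash2 R) (bdM (@bd_squash R) (@bd_squash R)).
have h3 : (fun n => Ex (convolution_pow nu n) (fun x => squash (x%:~R / A n) * squash (x%:~R / A n))
    - Ex (convolution_pow nu n) (fun x => squash (x%:~R / A n)) ^+ 2) @ \oo --> V.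
  by rewrite /V expr2; under eq_fun do rewrite expr2; apply: cvgB => //; exact: cvgM.
have V4 : 0 < V / 4 by lra.
have /cvgrPdist_le /(_ _ V4) [n0 _ hn] := h3.
(* For large n the variance is at least 3 V / 4, so 3 V / 2 <= 4 D + V / 2 and D >= V / 4. *)
pose a := Num.sqrt (V / 2).
have aE : a ^+ 2 = V / 2 by rewrite sqr_sqrtr// divr_ge0// ltW.
have a0 : 0 < a by rewrite sqrtr_gt0 divr_gt0.
exists a => //; exists (V / 4); first by [].
exists n0.+1 => n nn; have An : 0 < A n by apply: A_gt0; exact: leq_ltn_trans nn.
have := squash_difference n a0 An; rewrite aE /=; move: (hn n (ltnW nn)) => /=.
rewrite ler_distl => /andP[_ hh].
move: hh; move: (Ex _ _) => u; move: (Ex _ _) => v; move: (Dif _ _ _ _) => D.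
move: (v ^+ 2) (V) => w W; lra.
Qed.

End weak_limits_plain.

Section weak_limits_symmetrized.
Context {R : realType}.
Variables (nu : probability int R) (A : R^nat) (mu : probability R R).
Hypothesis A_gt0 : forall n, (0 < n)%N -> 0 < A n.
Hypothesis nu_mu : weakly_converges (rescaled_pow (symmetrized nu) A) mu.
Hypothesis mu_nondegenerate : forall x : R, mu [set x] <> 1%E.

Lemma Ex_symmetrized_pow n f : bd f ->
  Ex (convolution_pow (symmetrized nu) n) f = Dif nu n n f.
Proof.
case=> K hK; elim: n f hK => [|n ih] f hK.
  by rewrite Dif0 Ex_pow0.
have bf : bd f by exists K.
rewrite Ex_powS// -[in RHS]addn1 Dif_add// ih; last by move=> x; exact: Ex_norm_le.
congr Dif; apply/funext => x; rewrite Ex_symmetrized; last exact: bd_comp.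
rewrite (@Ex_swap _ _ _ _ K); last by move=> y z; exact: hK.
rewrite /Dif Ex_powS; last by apply: bd_Ex => y z; exact: hK.
rewrite Ex_pow0; apply: eq_Ex => y; rewrite add0r Ex_powS; last first.
  by exists K => z; exact: hK.
by rewrite Ex_pow0; apply: eq_Ex => z; congr f; ring.
Qed.

Lemma difference_tight_symmetrized : difference_tight nu A.
Proof.
move=> eps e0; have [K K0 [n0 h]] := weak_tight A_gt0 nu_mu e0.
exists K => //; exists n0 => n nn.
by rewrite -Ex_symmetrized_pow; [exact: h|exact: bd_far].
Qed.

Lemma difference_spread_symmetrized : difference_spread nu A.
Proof.
have V0 := Ex_capped_gt0 mu_nondegenerate.
set V := Ex mu _ in V0.
have h := weak_Ex nu_mu (@continuous_capped R 1) (bd_capped ler01).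
have V4 : 0 < V / 4 by lra.
have /cvgrPdist_le /(_ _ V4) [n0 _ hn] := h.
exists (V / 4) => //; exists (V / 4) => //.
exists n0.+1 => n nn; have An : 0 < A n by apply: A_gt0; exact: leq_ltn_trans nn.
move: (hn n (ltnW nn)) => /=; rewrite ler_distl => /andP[_ hh].
have : Ex (convolution_pow (symmetrized nu) n) (fun x => capped 1 (x%:~R / A n)) <=
    Dif nu n n (far (V / 4 * A n)) + V / 4.
  rewrite -Ex_symmetrized_pow; last exact: bd_far.
  rewrite -[X in _ + X](Ex_cst (convolution_pow (symmetrized nu) n)) -ExD//; last exact: bd_far.
  apply: le_Ex => [||x]; first exact/bd_comp/bd_capped.
    by apply: bdD => //; exact: bd_far.
  rewrite /capped ge_min /far; case: ltP => hx; first by rewrite lerDl (ltW V4).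
  by rewrite add0r mul1r normrM normfV (gtr0_norm An) ler_pdivrMr// hx orbT.
move: hh; move: (Dif _ _ _ _) => D; move: (Ex (convolution_pow _ _) _) => u.
rewrite -/V; move: (V) V0 => W W0; lra.
Qed.

End weak_limits_symmetrized.

Section first_moment.
Context {R : realType}.
Variable nu : probability int R.

Lemma truncated_moment : nu.-integrable [set: int] (fun z => (z%:~R : R)%:E) ->
  exists2 mu1 : R, 0 <= mu1 &
    forall L, 0 <= L -> Ex nu (fun z => Num.min `|z%:~R| L) <= mu1.
Proof.
move=> inu.
have inu' : nu.-integrable [set: int] (EFin \o (fun z : int => `|z%:~R : R|)).
  exact: (integrable_norm inu).
exists (Ex nu (fun z => `|z%:~R|)); first exact: Ex_ge0.
move=> L L0; apply: le_Rintegral => //.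
  apply: bd_integrable => //; exists L => z.
  by rewrite ger0_norm ?le_min ?normr_ge0// ge_min lexx orbT.
by move=> z _; rewrite ge_min lexx.
Qed.

End first_moment.

(** * Stable laws and superdiffusive growth *)

Section stable_laws.
Context {R : realType}.
Variable mu : probability R R.

Definition realC (s : R) : R := Ex mu (fun u => cos (s * u)).
Definition realS (s : R) : R := Ex mu (fun u => sin (s * u)).
Definition realN (s : R) : R := realC s ^+ 2 + realS s ^+ 2.

Lemma measurable_cosM (s : R) : measurable_fun setT (fun u : R => cos (s * u)).
Proof.
apply: (measurableT_comp (f := @cos R)); last exact: measurable_funM.
by apply: continuous_measurable; exact: continuous_cos.
Qed.

Lemma measurable_sinM (s : R) : measurable_fun setT (fun u : R => sin (s * u)).
Proof.
apply: (measurableT_comp (f := @sin R)); last exact: measurable_funM.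
by apply: continuous_measurable; exact: continuous_sin.
Qed.

Lemma Ex_prod_mul (f g : R -> R) : measurable_fun setT f -> measurable_fun setT g ->
  bd f -> bd g ->
  Ex (mu \x mu)%E (fun p => f p.1 * g p.2) = Ex mu f * Ex mu g.
Proof.
move=> mf mg bf bg.
have mfg : measurable_fun setT (fun p : R * R => f p.1 * g p.2).
  by apply: measurable_funM; apply: measurableT_comp.
have bfg : bd (fun p : R * R => f p.1 * g p.2).
  by apply: bdM; exact: bd_comp.
have intfg : (mu \x mu)%E.-integrable setT (EFin \o (fun p : R * R => f p.1 * g p.2)).
  exact: bd_integrable.
apply: EFin_inj; rewrite -Ex_EFin// -(integral12_prod_meas1 intfg) /fubini_F.
rewrite mulrC -ExZ_meas// -Ex_EFin//; [|exact: measurable_funM|exact: bdZ].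
apply: eq_integral => x _ /=.
by rewrite Ex_EFin// ?ExZ_meas ?[Ex mu g * _]mulrC//; [exact: measurable_funM|exact: bdZ].
Qed.

(** Stability with a = b = 1; the shift only multiplies the characteristic function by a number of
    modulus 1. *)
Lemma stable_realN (beta : R) : stable_distribution beta mu ->
  forall s, realN s ^+ 2 = realN ((1 `^ beta + 1 `^ beta) `^ beta^-1 * s).
Proof.
case=> _ _ /(_ 1 1 ltr01 ltr01) [s' hs] s; set c := _ `^ beta^-1 in hs *.
have law (f : R -> R) : measurable_fun setT f -> bd f ->
    Ex (mu \x mu)%E (fun p => f (p.1 + p.2)) = Ex mu (fun x => f (c * x + s')).
  move=> mf bf; have mE : measurable_fun setT (EFin \o f) by exact/measurable_EFinP.
  have m1 : measurable_fun setT (fun p : R * R => p.1 + p.2) by apply: measurable_funD.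
  have m2 : measurable_fun setT (fun x : R => c * x + s').
    by apply: measurable_funD => //; exact: measurable_funM.
  have mf1 := measurableT_comp mf m1; have mf2 := measurableT_comp mf m2.
  apply: EFin_inj; rewrite -!Ex_EFin//; try exact: bd_comp.
  have i1 := bd_integrable (mu \x mu)%E mf1 (bd_comp (fun p : R * R => p.1 + p.2) bf).
  have i2 := bd_integrable mu mf2 (bd_comp (fun x => c * x + s') bf).
  have := integral_pushforward m1 (D := setT) mE i1 measurableT; rewrite preimage_setT => <-.
  have := integral_pushforward m2 (D := setT) mE i2 measurableT; rewrite preimage_setT => <-.
  apply: eq_measure_integral => B mB _; rewrite /pushforward.
  apply: etrans (hs B mB); congr ((mu \x mu)%E _).
  by apply/seteqP; split => p /=; rewrite !mul1r.
have hc := law (fun u => cos (s * u)) (measurable_cosM s) (bd_cos _).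
have hS := law (fun u => sin (s * u)) (measurable_sinM s) (bd_sin _).
have mc := measurable_cosM s; have ms := measurable_sinM s.
have mcc := measurable_cosM (c * s); have mss := measurable_sinM (c * s).
have bp1 (f g : R -> R) : bd f -> bd g -> bd (fun p : R * R => f p.1 * g p.2).
  by move=> bf bg; apply: bdM; exact: bd_comp.
have mp1 (f g : R -> R) : measurable_fun setT f -> measurable_fun setT g ->
    measurable_fun setT (fun p : R * R => f p.1 * g p.2).
  by move=> mf mg; apply: measurable_funM; apply: measurableT_comp.
have hC1 : Ex (mu \x mu)%E (fun p => cos (s * (p.1 + p.2))) = realC s ^+ 2 - realS s ^+ 2.
  under eq_Ex do rewrite mulrDr cosD.
  rewrite ExB_meas; [|exact: (mp1 _ _ mc mc)|exact: (mp1 _ _ ms ms)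
    |exact: (bp1 (fun u => cos (s * u)) (fun u => cos (s * u)))
    |exact: (bp1 (fun u => sin (s * u)) (fun u => sin (s * u)))].
  by rewrite (Ex_prod_mul mc mc)// (Ex_prod_mul ms ms)// -!expr2.
have hS1 : Ex (mu \x mu)%E (fun p => sin (s * (p.1 + p.2))) = 2 * (realC s * realS s).
  under eq_Ex do rewrite mulrDr sinD.
  rewrite ExD_meas; [|exact: (mp1 _ _ ms mc)|exact: (mp1 _ _ mc ms)
    |exact: (bp1 (fun u => sin (s * u)) (fun u => cos (s * u)))
    |exact: (bp1 (fun u => cos (s * u)) (fun u => sin (s * u)))].
  rewrite (Ex_prod_mul ms mc)// (Ex_prod_mul mc ms)// -/(realC s) -/(realS s).
  by rewrite [realS s * _]mulrC mulr_natl mulr2n.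
have hC2 : Ex mu (fun x => cos (s * (c * x + s'))) =
    cos (s * s') * realC (c * s) - sin (s * s') * realS (c * s).
  have -> : (fun x => cos (s * (c * x + s'))) =
      (fun x => cos (s * s') * cos (c * s * x) - sin (s * s') * sin (c * s * x)).
    by apply/funext => x; rewrite mulrDr cosD mulrA [s * c]mulrC; ring.
  by rewrite ExB_meas ?ExZ_meas//; [exact: measurable_funM|exact: measurable_funM|exact: bdZ|exact: bdZ].
have hS2 : Ex mu (fun x => sin (s * (c * x + s'))) =
    cos (s * s') * realS (c * s) + sin (s * s') * realC (c * s).
  have -> : (fun x => sin (s * (c * x + s'))) =
      (fun x => cos (s * s') * sin (c * s * x) + sin (s * s') * cos (c * s * x)).
    by apply/funext => x; rewrite mulrDr sinD mulrA [s * c]mulrC; ring.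
  by rewrite ExD_meas ?ExZ_meas//; [exact: measurable_funM|exact: measurable_funM|exact: bdZ|exact: bdZ].
rewrite hC1 hC2 in hc; rewrite hS1 hS2 in hS; rewrite /realN.
have -> : (realC s ^+ 2 + realS s ^+ 2) ^+ 2 =
    (realC s ^+ 2 - realS s ^+ 2) ^+ 2 + (2 * (realC s * realS s)) ^+ 2 by ring.
rewrite hc hS; have := cos2Dsin2 (s * s'); move: (cos (s * s')) (sin (s * s')) => x y xy.
transitivity ((x ^+ 2 + y ^+ 2) * (realC (c * s) ^+ 2 + realS (c * s) ^+ 2)); first by ring.
by rewrite xy mul1r.
Qed.

End stable_laws.

Section stable_growth.
Context {R : realType}.
Variables (rho : probability int R) (A : R^nat) (mu : probability R R) (beta : R).
Hypothesis A_gt0 : forall n, (0 < n)%N -> 0 < A n.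
Hypothesis rho_mu : weakly_converges (rescaled_pow rho A) mu.
Hypothesis mu_stable : stable_distribution beta mu.

Lemma charN_cvg (s : R) : (fun n => charN rho (s / A n) ^+ n) @ \oo --> realN mu s.
Proof.
have cC : continuous (fun u : R => cos (s * u)).
  move=> x; apply: (continuous_comp (f := fun u => s * u)); last exact: continuous_cos.
  by apply: continuousM; [exact: cst_continuous|exact: cvg_id].
have cS : continuous (fun u : R => sin (s * u)).
  move=> x; apply: (continuous_comp (f := fun u => s * u)); last exact: continuous_sin.
  by apply: continuousM; [exact: cst_continuous|exact: cvg_id].
have hC := weak_Ex rho_mu cC (bd_cos _); have hS := weak_Ex rho_mu cS (bd_sin _).
have -> : (fun n => charN rho (s / A n) ^+ n) = (fun n =>
    Ex (convolution_pow rho n) (fun x => cos (s * (x%:~R / A n))) *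
    Ex (convolution_pow rho n) (fun x => cos (s * (x%:~R / A n))) +
    Ex (convolution_pow rho n) (fun x => sin (s * (x%:~R / A n))) *
    Ex (convolution_pow rho n) (fun x => sin (s * (x%:~R / A n)))).
  apply/funext => n; rewrite -charN_pow /charN /charC /charS !expr2.
  by congr (_ * _ + _ * _); apply: eq_Ex => x; rewrite mulrA mulrAC.
by rewrite /realN !expr2; apply: cvgD; exact: cvgM.
Qed.

Lemma stable_charN_iter (c : R) : (forall s, realN mu s ^+ 2 = realN mu (c * s)) ->
  forall k s, realN mu s ^+ (2 ^ k) = realN mu (c ^+ k * s).
Proof.
move=> hc; elim=> [|k ih] s; first by rewrite mul1r expr1.
by rewrite expnSr exprM ih hc mulrA -exprS.
Qed.

Lemma exists_large_power (x y : R) : 1 < x -> exists n, y <= x ^+ n.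
Proof.
move=> x1; have x10 : 0 < x - 1 by rewrite subr_gt0.
exists (Num.truncn (`|y| / (x - 1))).+1; set n := _.+1.
have h : `|y| <= n%:R * (x - 1) by rewrite -ler_pdivrMr// ltW// truncnS_gt.
have hB m : 1 + m%:R * (x - 1) <= x ^+ m.
  elim: m => [|m ih]; first by rewrite mul0r addr0 expr0.
  rewrite exprS -(natr1 m); have x0 : 0 <= x by lra.
  apply: le_trans (ler_wpM2l x0 ih).
  have : 0 <= m%:R * (x - 1) ^+ 2 by rewrite mulr_ge0// sqr_ge0.
  by move: (m%:R : R) => u; lra.
by apply: le_trans (hB n); have := ler_norm y; lra.
Qed.

(** The constant is c = 2 ^ (1 / beta), so c ^ 2 > 2 expresses beta < 2. *)
Lemma stable_constant : 1 < beta < 2 ->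
  let c := (1 `^ beta + 1 `^ beta) `^ beta^-1 in 0 < c /\ 2 < c ^+ 2.
Proof.
move=> /andP[b1 b2] c; have b0 : 0 < beta by lra.
have cE : c = 2 `^ beta^-1 by rewrite /c powR1.
split; first by rewrite cE powR_gt0.
rewrite cE -powR_mulrn ?powR_ge0// -powRrM.
rewrite -[X in X < _](@powRr1 R 2)// /powR !gt_eqF//= ltr_expR ltr_pM2r; last first.
  by rewrite ln_gt0// ltr1n.
by rewrite ltr_pdivlMl// mulr1.
Qed.

(** Let m = 4 ^ l n. Iterating the relation 2 l times, |phi_rho (u / A_n)| ^ (2 m) converges to the
    squared modulus of the limit at c ^ (2 l) u = s0, which is below 1. By tightness at time m, such
    a loss forces u A_m / A_n to stay away from 0, so A_m / A_n is at least of order c ^ (2 l),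
    which beats 2 ^ l. *)
Lemma superdiffusive_growth (c : R) : 0 < c -> 2 < c ^+ 2 ->
  (forall s, realN mu s ^+ 2 = realN mu (c * s)) ->
  difference_tight rho A -> difference_spread rho A ->
  exists l n0, forall n, (n0 <= n)%N -> 2 * 2 ^+ l * A n <= A (4 ^ l * n)%N.
Proof.
move=> c0 c2 hc hT hN.
have [s0 s00 [c1 c10 [n1 h1]]] := charN_scale_lower A_gt0 hT hN.
pose eta := c1 * s0 ^+ 2.
have eta0 : 0 < eta by rewrite mulr_gt0// exprn_gt0.
have hs0 : realN mu s0 <= 1 - eta.
  rewrite leNgt; apply/negP => h.
  have e0 : 0 < (realN mu s0 - (1 - eta)) / 2 by rewrite divr_gt0// subr_gt0.
  have /cvgrPdist_le /(_ _ e0) [n2 _ h2] := @charN_cvg s0.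
  pose n := (n1 + n2).+1.
  have An : 0 < A n by exact: A_gt0.
  have n1n : (n1 <= n)%N by rewrite /n leqW// leq_addr.
  have n2n : (n2 <= n)%N by rewrite /n leqW// leq_addl.
  have := h1 n (s0 / A n) n1n; rewrite lexx divr_ge0 ?(ltW s00) ?(ltW An)// => /(_ isT).
  rewrite divfK ?gt_eqF// -/eta; move: (h2 n n2n) => /=.
  rewrite ler_distl => /andP[_]; move: (charN _ _ ^+ n) (realN mu s0) h {h2 e0} => u v; lra.
have e8 : 0 < eta / 8 by rewrite divr_gt0.
have [K K0 [n3 h3]] := hT _ e8.
pose q := Num.sqrt (eta / 2).
have q0 : 0 < q by rewrite sqrtr_gt0 divr_gt0.
have qE : q ^+ 2 = eta / 2 by rewrite sqr_sqrtr// divr_ge0// ltW.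
have x1 : 1 < c ^+ 2 / 2 by rewrite ltr_pdivlMr// mul1r.
(* The growth obtained below is q c ^ (2 l) / (s0 K); this l makes it at least 2 * 2 ^ l. *)
have [l hl] := exists_large_power (2 * (s0 * K) / q) x1.
exists l.
pose u := (c ^+ (2 * l))^-1 * s0.
have cl0 : 0 < c ^+ (2 * l) by rewrite exprn_gt0.
have u0 : 0 < u by rewrite mulr_gt0// invr_gt0.
have hu : realN mu u ^+ (4 ^ l) = realN mu s0.
  have -> : (4 ^ l = 2 ^ (2 * l))%N by rewrite expnM.
  by rewrite (stable_charN_iter hc) /u mulrA mulfV ?mul1r// gt_eqF.
have cvgu : (fun n => (charN rho (u / A n) ^+ n) ^+ (4 ^ l)) @ \oo --> realN mu s0.
  rewrite -hu; elim: (4 ^ l)%N => [|k ih].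
    by under eq_fun do rewrite expr0; rewrite expr0; exact: cvg_cst.
  under eq_fun do rewrite exprS; rewrite exprS; apply: cvgM => //; exact: charN_cvg.
have e2 : 0 < eta / 2 by rewrite divr_gt0.
have /cvgrPdist_le /(_ _ e2) [n4 _ h4] := cvgu.
exists (n3 + n4).+1 => n nn.
have n0 : (0 < n)%N by exact: leq_ltn_trans nn.
have n3n : (n3 <= 4 ^ l * n)%N.
  rewrite (leq_trans _ (leq_pmull n _)) ?expn_gt0//.
  by rewrite (leq_trans _ (ltnW nn))// leq_addr.
have n4n : (n4 <= n)%N by rewrite (leq_trans _ (ltnW nn))// leq_addl.
have An := A_gt0 n0; set m := (4 ^ l * n)%N in n3n *.
have Am : 0 < A m by apply: A_gt0; rewrite muln_gt0 n0 expn_gt0.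
have hlow : eta / 2 <= 1 - charN rho (u / A n) ^+ m.
  rewrite /m mulnC exprM; move: (h4 n n4n) hs0 => /=.
  rewrite ler_distl => /andP[h5 h6]; move: h5 h6.
  move: ((_ ^+ n) ^+ _) (realN mu s0) => x y; move: (eta) => z; lra.
have hup := one_minus_charN_pow_le rho m (u / A n) (ltW (mulr_gt0 K0 Am)).
have hq : q <= u / A n * (K * A m).
  have h0 : 0 <= u / A n * (K * A m) by rewrite ltW// !mulr_gt0// invr_gt0.
  rewrite -(@ler_pXn2r _ 2)// ?nnegrE ?(ltW q0)// qE.
  move: hlow hup (h3 m n3n); move: (Dif _ _ _ _) (1 - _) ((_ * _) ^+ 2) (eta) => x y z w; lra.
have hA : q / (u * K) * A n <= A m.
  rewrite mulrAC ler_pdivrMr; last exact: mulr_gt0.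
  move: hq.
  by rewrite mulrAC ler_pdivlMr//; rewrite [u * (K * _)]mulrA [u * K * _]mulrC.
apply: le_trans hA; rewrite ler_wpM2r ?(ltW An)//.
rewrite ler_pdivlMr; last exact: mulr_gt0.
move: hl; rewrite ler_pdivrMr// expr_div_n -exprM mulrAC ler_pdivlMr ?exprn_gt0// => hl.
rewrite /u -(ler_pM2l cl0); apply: le_trans hl.
rewrite le_eqVlt; apply/orP; left; apply/eqP; field.
by rewrite gt_eqF.
Qed.

(** Shifting the indices by l halves the terms, so the part of a partial sum S beyond l + i0 is at
    most S / 2, and S is at most twice its first l + i0 terms. *)
Lemma halving_sum_bounded (b : nat -> R) (l i0 : nat) : (forall i, 0 <= b i) ->
  (forall i, (i0 <= i)%N -> 2 * b (l + i)%N <= b i) ->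
  exists C : R, forall I, \sum_(0 <= i < I) b i <= C.
Proof.
move=> b0 hb; pose S I := \sum_(0 <= i < I) b i.
have Smono I J : S I <= S (I + J)%N.
  rewrite /S [leRHS](big_cat_nat (n := I)) ?leq_addr//= lerDl.
  by apply: sumr_ge0 => i _.
exists (2 * S (l + i0)%N) => J; rewrite -/(S J).
apply: (le_trans (Smono J (l + i0)%N)); rewrite addnC.
have : 2 * (S (l + i0 + J)%N - S (l + i0)%N) <= S (l + i0 + J)%N.
  have -> : S (l + i0 + J)%N - S (l + i0)%N = \sum_(0 <= i < J) b (l + (i0 + i))%N.
    rewrite /S [X in X - _](big_cat_nat (n := (l + i0)%N)) ?leq_addr//=.
    rewrite addrAC subrr add0r -{1}[(l + i0)%N]add0n big_addn addKn.
    by apply: eq_bigr => i _; rewrite addnC addnA.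
  rewrite mulr_sumr; apply: (@le_trans _ _ (\sum_(0 <= i < J) b (i0 + i)%N)).
    by apply: ler_sum => i _; apply: hb; exact: leq_addr.
  apply: (@le_trans _ _ (S (i0 + J)%N)); last by rewrite -addnA [(l + _)%N]addnC; exact: Smono.
  rewrite /S [leRHS](big_cat_nat (n := i0)) ?leq_addr//=.
  rewrite -{3}[i0]add0n big_addn addKn.
  rewrite (eq_bigr (fun i => b (i + i0)%N)) ?lerDr ?sumr_ge0// => i _.
  by rewrite addnC.
lra.
Qed.

Lemma stable_sum_bounded : 1 < beta < 2 ->
  difference_tight rho A -> difference_spread rho A ->
  exists C : R, forall I, \sum_(0 <= i < I) 2 ^+ i / A (4 ^ i)%N <= C.
Proof.
move=> b12 hT hN; have [c0 c2] := stable_constant b12.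
have [l [n0 h]] := superdiffusive_growth c0 c2 (stable_realN mu_stable) hT hN.
apply: (@halving_sum_bounded _ l n0) => i.
  by rewrite divr_ge0 ?exprn_ge0// ltW// A_gt0// expn_gt0.
move=> ni; have Ai : 0 < A (4 ^ i)%N by apply: A_gt0; rewrite expn_gt0.
have Ali : 0 < A (4 ^ (l + i))%N by apply: A_gt0; rewrite expn_gt0.
rewrite mulrA ler_pdivrMr// mulrAC ler_pdivlMr// exprD.
have -> : 2 * (2 ^+ l * 2 ^+ i) * A (4 ^ i)%N = 2 ^+ i * (2 * 2 ^+ l * A (4 ^ i)%N) by ring.
rewrite ler_wpM2l ?exprn_ge0// expnD; apply: h.
by rewrite (leq_trans ni)// ltnW// ltn_expl.
Qed.

End stable_growth.

(** * Condensation and conclusion *)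

Section condensation.
Context {R : realType}.
Variable A : R^nat.
Hypothesis A_gt0 : forall n, (0 < n)%N -> 0 < A n.
Hypothesis A_incr : forall m n, (0 < m)%N -> (m <= n)%N -> A m <= A n.

Local Notation t n := (1 / (A n * Num.sqrt n%:R)).
Local Notation b i := (2 ^+ i / A (4 ^ i)%N).

Lemma term_ge0 n : 0 <= t n.
Proof.
case: n => [|n]; first by rewrite sqrtr0 mulr0 invr0 mulr0.
by rewrite divr_ge0// mulr_ge0 ?sqrtr_ge0// ltW// A_gt0.
Qed.

Lemma term_anti m n : (0 < m)%N -> (m <= n)%N -> t n <= t m.
Proof.
move=> m0 mn; have n0 := leq_trans m0 mn.
have sm : 0 < Num.sqrt (m%:R : R) by rewrite sqrtr_gt0 ltr0n.
have sn : 0 < Num.sqrt (n%:R : R) by rewrite sqrtr_gt0 ltr0n.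
rewrite !mul1r lef_pV2 ?posrE ?mulr_gt0 ?A_gt0//.
by apply: ler_pM; rewrite ?(ltW sm) ?(ltW (A_gt0 _)) ?A_incr// ler_wsqrtr ?ler_nat.
Qed.

Lemma term_pow4 i : 4 ^+ i * t (4 ^ i)%N = b i.
Proof.
have Ai : 0 < A (4 ^ i)%N by apply: A_gt0; rewrite expn_gt0.
have e : 4 ^+ i = 2 ^+ i * 2 ^+ i :> R by rewrite -exprMn; congr (_ ^+ _); ring.
have -> : Num.sqrt ((4 ^ i)%N%:R : R) = 2 ^+ i.
  by rewrite natrX e -expr2 sqrtr_sqr ger0_norm ?exprn_ge0.
by rewrite e; field; rewrite expf_neq0//= gt_eqF.
Qed.

Lemma block_size (i : nat) (x : R) : \sum_(4 ^ i <= n < 4 ^ i.+1) x = 3 * (4 ^+ i * x).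
Proof.
rewrite sumr_const_nat -[LHS]mulr_natl.
have -> : (4 ^ i.+1 - 4 ^ i = 3 * 4 ^ i)%N by rewrite expnS; lia.
by rewrite natrM natrX mulrA.
Qed.

(** Cauchy condensation in base 4, which makes sqrt (4 ^ i) the integer power 2 ^ i; a block holds 3
    * 4 ^ i terms. *)
Lemma sum_pow4_le I : \sum_(1 <= n < 4 ^ I) t n <= 3 * \sum_(0 <= i < I) b i.
Proof.
elim: I => [|I ih]; first by rewrite !big_geq// mulr0.
rewrite (big_cat_nat (n := (4 ^ I)%N)) ?expn_gt0 ?leq_exp2l//= big_nat_recr//= mulrDr.
apply: lerD ih _; rewrite -term_pow4 -block_size big_nat [leRHS]big_nat.
apply: ler_sum => n /andP[h1 _]; apply: term_anti => //; first by rewrite expn_gt0.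
Qed.

Lemma sum_pow4_ge I : 3 / 4 * \sum_(0 <= i < I) b i.+1 <= \sum_(1 <= n < 4 ^ I) t n.
Proof.
elim: I => [|I ih]; first by rewrite !big_geq// mulr0.
rewrite [leRHS](big_cat_nat (n := (4 ^ I)%N)) ?expn_gt0 ?leq_exp2l//= big_nat_recr//= mulrDr.
apply: lerD ih _; rewrite -term_pow4 exprS.
have -> : 3 / 4 * (4 * 4 ^+ I * t (4 ^ I.+1)%N) =
    3 * (4 ^+ I * t (4 ^ I.+1)%N) by move: (1 / _) => x; field.
rewrite -block_size [leLHS]big_nat [leRHS]big_nat.
apply: ler_sum => n /andP[h1 h2]; apply: term_anti; last exact: ltnW.
by apply: leq_trans h1; rewrite expn_gt0.
Qed.

Lemma condensation : (exists C : R, forall N, \sum_(1 <= n < N) t n <= C) <->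
  (exists C : R, forall I, \sum_(0 <= i < I) b i <= C).
Proof.
split=> -[C hC].
  exists (b 0%N + 4 / 3 * C) => I.
  apply: (@le_trans _ _ (\sum_(0 <= i < I.+1) b i)).
    rewrite big_nat_recr//= lerDl divr_ge0 ?exprn_ge0// ltW// A_gt0//.
    by rewrite expn_gt0.
  rewrite big_nat_recl// lerD2l; have := le_trans (sum_pow4_ge I) (hC _).
  by move: (bigop _ _ _) => x; lra.
exists (3 * C) => N; apply: (@le_trans _ _ (\sum_(1 <= n < 4 ^ N) t n)).
  have [N1|N1] := leqP N 1.
    by rewrite big_geq// sumr_ge0// => n _; exact: term_ge0.
  rewrite [leRHS](big_cat_nat (n := N)) ?(ltnW N1)//=; last by rewrite ltnW// ltn_expl.
  by rewrite lerDl sumr_ge0// => n _; exact: term_ge0.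
by apply: (le_trans (sum_pow4_le N)); rewrite ler_wpM2l.
Qed.

Lemma series_infinite : (\sum_(1 <= n <oo) (t n)%:E)%E = +oo%E <->
  ~ exists C : R, forall N, \sum_(1 <= n < N) t n <= C.
Proof.
split=> [h [C hC]|h].
  have : (\sum_(1 <= n <oo) (t n)%:E <= C%:E)%E.
    apply: lime_le; first by apply: is_cvg_nneseries => n _ _; rewrite lee_fin term_ge0.
    by apply: nearW => N; rewrite sumEFin lee_fin.
  by rewrite h leye_eq.
apply/eqP; rewrite eq_le leey /= leNgt; apply/negP => hlt; apply: h.
set S := limn _ in hlt.
have S0 : (0 <= S)%E by apply: nneseries_ge0 => n _ _; rewrite lee_fin term_ge0.
have Sf : S \is a fin_num by rewrite ge0_fin_numE.
exists (fine S) => N; rewrite -lee_fin fineK// -sumEFin.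
by apply: nneseries_lim_ge => n _ _; rewrite lee_fin term_ge0.
Qed.

End condensation.

Section dichotomy.
Context {R : realType}.
Variables (delta : R) (nu : probability int R) (A : R^nat) (kappa : int).
Hypothesis delta01 : 0 < delta < 1.
Hypothesis kappa1 : kappa = 1 \/ kappa = -1.
Hypothesis A_gt0 : forall n, (0 < n)%N -> 0 < A n.
Hypothesis A_incr : forall m n, (0 < m)%N -> (m <= n)%N -> A m <= A n.
Hypothesis hT : difference_tight nu A.
Hypothesis hN : difference_spread nu A.
Hypothesis hH : heights_tight delta nu A kappa.

Lemma return_sum_bounded :
  (exists C : R, forall N, \sum_(0 <= n < N) ret delta nu kappa n <= C) <->
  (exists C : R, forall I, \sum_(0 <= i < I) 2 ^+ i / A (4 ^ i)%N <= C).
Proof.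
split; first exact: (dyadic_sum_bounded delta01 A_gt0 A_incr kappa1 hH).
move=> [C hC]; have [s0 s00 [c c0 [n0 hlow]]] := charN_lower A_gt0 hT hN.
have A4 i : 0 < A (4 ^ i)%N by apply: A_gt0; rewrite expn_gt0.
have [C' C'0 hC'] := @green_upper R delta nu kappa delta01 kappa1 (fun i => A (4 ^ i)%N) n0 s0 c A4
  (fun i => A_incr (expn_gt0 4 i) (leq_pexp2l (isT : 0 < 4)%N (leqnSn i))) s00 c0
  ltac:(by move=> i t ni /=; rewrite expnS => ht; rewrite -natrX; apply: hlow ht;
        rewrite (leq_trans ni)// ltnW// ltn_expl).
have r0 n : 0 <= ret delta nu kappa n.
  rewrite (ret_popn nu delta01 kappa1); move: (0, 0) {2}(0, 0) => o.
  by elim: n => [|n ih] s /=; [exact: ler0n|exact: (pop_ge0 nu kappa delta01)].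
exists (C' * C) => N; pose I := (n0 + N)%N.
have NI : (N <= 4 ^ I)%N by rewrite (leq_trans _ (ltnW (ltn_expl _ _)))// leq_addl.
apply: (@le_trans _ _ (\sum_(0 <= n < 4 ^ I) ret delta nu kappa n)).
  by rewrite [leRHS](big_cat_nat (n := N))//= lerDl sumr_ge0.
rewrite big_mkord; apply: le_trans (hC' I (leq_addr _ _)) _.
by rewrite ler_wpM2l.
Qed.

Context {d : measure_display} {Omega : measurableType d}.
Variables (P : probability Omega R) (M : nat -> {RV P >-> (int * int)%type}).
Hypothesis hM : markov_chain M (0, 0) (transition delta nu kappa).

Lemma dichotomy :
  (recurrent M <-> (\sum_(1 <= n <oo) (1 / (A n * Num.sqrt n%:R))%:E)%E = +oo%E) /\
  ((exists C : R, forall I, \sum_(0 <= i < I) 2 ^+ i / A (4 ^ i)%N <= C) -> transient M).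
Proof.
have tr := @transient_of_bounded R delta nu kappa delta01 kappa1 d Omega P M hM.
have rc := @recurrent_of_unbounded R delta nu kappa delta01 kappa1 d Omega P M hM.
split; last by move/return_sum_bounded; exact: tr.
apply: iff_trans (iff_sym (series_infinite A_gt0)).
split=> [hr|h]; last by apply: rc => /return_sum_bounded/(condensation A_gt0 A_incr).
move=> /(condensation A_gt0 A_incr)/return_sum_bounded/tr ht.
exact: (not_recurrent_transient ht hr).
Qed.

End dichotomy.

Theorem proposition4p4 (R : realType) (delta : R) (hdelta : 0 < delta < 1)
    (nu : probability int R) (A : R^nat)
    (A_gt0 : forall n, (0 < n)%N -> 0 < A n)
    (A_incr : forall m n, (0 < m)%N -> (m <= n)%N -> A m <= A n)
    (beta : R) (d : measure_display) (Omega : measurableType d)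
    (P : probability Omega R) (M : nat -> {RV P >-> (int * int)%type})
    (hM : case_a delta nu A beta M \/ case_b delta nu A beta M) :
  (recurrent M <->
   (\sum_(1 <= n <oo) (1 / (A n * Num.sqrt n%:R))%:E)%E = +oo%E) /\
  (beta < 2 -> transient M).
Proof.
case: hM => [[_ _ /andP[b1 _] [mu stab weak]]|[inu b1 [mu stab weak]]]; have [_ nondeg _] := stab.
- rewrite (@transition_aE _ delta nu 1 erefl) => chain.
  have hT := difference_tight_plain A_gt0 weak.
  have hN := difference_spread_plain A_gt0 weak nondeg.
  have e2 : 0 < 1 / 2 :> R by rewrite divr_gt0.
  have hH := heights_tight_of_tight hdelta A_gt0 A_incr (weak_tight A_gt0 weak e2).
  have [h1 h2] := dichotomy hdelta (or_introl erefl) A_gt0 A_incr hT hN hH chain.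
  split=> // b2; apply: h2; apply: (stable_sum_bounded A_gt0 weak stab) => //.
  by rewrite b1.
- rewrite (@transition_bE _ delta nu (-1) erefl) => chain.
  have hT := difference_tight_symmetrized A_gt0 weak.
  have hN := difference_spread_symmetrized A_gt0 weak nondeg.
  have [mu1 mu10 hmu1] := truncated_moment inu.
  have hH := heights_tight_of_moment hdelta A_gt0 A_incr mu10 hmu1 hT hN.
  have [h1 h2] := dichotomy hdelta (or_intror erefl) A_gt0 A_incr hT hN hH chain.
  split=> // b2; apply: h2; apply: (stable_sum_bounded A_gt0 weak stab).
  + by rewrite b1.
  (* The growth of A is derived from the symmetrized law itself, so the differences here are those
     of sums of symmetrized steps. *)
  + exact: (difference_tight_plain A_gt0 weak).
  + exact: (difference_spread_plain A_gt0 weak nondeg).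
Qed.
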